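(* Let $m\in\mathbb{N}$, $L,N\in\mathbb{R}_{\ge0}$, and for $i\in\{1,\dots,m\}$, $u\in\mathcal{U}$, $\theta\in\mathbb{R}_{>0}$ consider the interval $$[\mathcal{J}_{N,i}^{m,L}u](\theta)=\left[\ \sup_{\substack{h\in\mathcal{F}_L^m\\ \|h-u\|_{\infty,\theta}\le N}}h^{(i)}(\theta)-\bar g^{m,L}_{N,i}(\theta),\ \inf_{\substack{h\in\mathcal{F}_L^m\\ \|h-u\|_{\infty,\theta}\le N}}h^{(i)}(\theta)+\bar g^{m,L}_{N,i}(\theta)\right],$$ where $[\mathcal{J}_{N,i}^{m,L}u](\theta)=(-\infty,\infty)$ if no $h\in\mathcal{F}_L^m$ satisfies $\|h-u\|_{\infty,\theta}\le N$. Then: a) the interval $[\mathcal{J}_{N,i}^{m,L}u](\theta)$ is nonempty for all $u\in\mathcal{U}$, all $\theta\in\mathbb{R}_{>0}$ and all $i\in\{1,\dots,m\}$; b) a causal differentiator $\mathcal{D}$ of order $m$ has best worst-case error over $\mathcal{F}_L^m$ with respect to noise in $\mathcal{E}_N$ if and only if $[\mathcal{D}_iu](t)\in[\mathcal{J}_{N,i}^{m,L}u](t)$ for all $u\in\mathcal{U}$, all $t>0$ and all $i\in\{1,\dots,m\}$; c) the differentiator $\mathcal{D}$ of order $m$ defined by $$[\mathcal{D}_iu](t)=\begin{cases}\dfrac{\inf[\mathcal{J}_{N,i}^{m,L}u](t)+\sup[\mathcal{J}_{N,i}^{m,L}u](t)}{2}&\text{if }t>0\text{ and }[\mathcal{J}_{N,i}^{m,L}u](t)\text{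 is bounded},\\[1ex]0&\text{otherwise}\end{cases}$$ is causal, has best worst-case error over $\mathcal{F}_L^m$ with respect to noise in $\mathcal{E}_N$, and is robust almost from the beginning over $\mathcal{F}_L^m+\mathcal{E}_{N-\delta}$ for all $\delta\in(0,N]$; d) there exist time-varying parameters $d_{t,i,1},\dots,d_{t,i,P_{t,i}}\in\mathbb{R}$, $\tau_{t,i,1},\dots,\tau_{t,i,P_{t,i}}\in[0,t]$ with $P_{t,i}\in\mathbb{N}$, defined for each $t>0$ and $i\in\{1,\dots,m\}$, such that the linear differentiator $\mathcal{D}$ of order $m$ defined by $$[\mathcal{D}_iu](t)=\begin{cases}\sum_{j=1}^{P_{t,i}}d_{t,i,j}\,u(t-\tau_{t,i,j})&\text{if }t>0,\\0&\text{otherwise}\end{cases}$$ is causal, has best worst-case error over $\mathcal{F}_{\alpha L}^m$ with respect to noise in $\mathcal{E}_{\alpha N}$ for all $\alpha\in\mathbb{R}_{\ge0}$, and is robust almost from the beginning over $\mathcal{U}$ (i.e., strongly robust).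
   Context: For $m\in\mathbb{N}_0$ and $L,N\ge 0$: $\mathcal{F}^m$ is the set of functions $f:\mathbb{R}_{\ge 0}\to\mathbb{R}$ that are $m$ times continuously differentiable with $f^{(m)}$ Lipschitz continuous; $\mathcal{F}_L^m=\{f\in\mathcal{F}^m: |f^{(m+1)}(t)|\le L\text{ a.e. on }\mathbb{R}_{\ge0}\}$; $\mathcal{E}_N=\{\eta:\mathbb{R}_{\ge0}\to\mathbb{R}: |\eta(t)|\le N\text{ for all }t\ge0\}$; $\mathcal{F}_L^m+\mathcal{E}_N=\{f+\eta: f\in\mathcal{F}_L^m,\eta\in\mathcal{E}_N\}$; and $\mathcal{U}=\bigcup_{m\in\mathbb{N}_0,\,L,N\ge0}(\mathcal{F}_L^m+\mathcal{E}_N)$. For $\mathbf{R}=(R_0,\dots,R_m)\in\mathbb{R}_{\ge0}^{m+1}$, $\mathcal{F}_{L,\mathbf{R}}^m=\{f\in\mathcal{F}_L^m:|f^{(i)}(0)|\le R_i,\ i=0,\dots,m\}$. Here $f^{(0)}=f$, derivatives at $0$ are one-sided, and $\|u\|_{\infty,\theta}=\sup_{\tau\in[0,\theta]}|u(\tau)|$. A differentiator of order $m$ is an operator $\mathcal{D}:\mathcal{U}\to(\mathbb{R}_{\ge0}\to\mathbb{R}^m)$, with components $\mathcal{D}_1,\dots,\mathcal{D}_m$. It is causal if for all $t\ge0$, $[\mathcal{D}u_1](t)=[\mathcal{D}u_2](t)$ whenever $u_1=u_2$ on $[0,t]$. Worst-case error over a signal class $\mathcal{S}\subseteq\mathcal{F}_L^m$: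 $M_{N,i}^{\mathcal{S}}(t)=\sup_{f\in\mathcal{S},\,\eta\in\mathcal{E}_N}\ \sup_{\tau\ge t}|f^{(i)}(\tau)-[\mathcal{D}_i(f+\eta)](\tau)|\in[0,\infty]$. For $T>0$, $\mathcal{G}^m_{L,N}(T)=\{g\in\mathcal{F}_L^m:|g(t)|\le N\text{ for all }t\in[0,T]\}$ and $\bar g^{m,L}_{N,k}(T)=\sup\{g^{(k)}(T):g\in\mathcal{G}^m_{L,N}(T)\}$. A causal differentiator $\mathcal{D}$ of order $m$ has best worst-case error over $\mathcal{F}_L^m$ with respect to noise in $\mathcal{E}_N$ if $M_{N,k}^{\mathcal{F}_{L,\mathbf{R}}^m}(t)\le\bar g_{N,k}^{m,L}(t)$ for all $\mathbf{R}\in\mathbb{R}_{\ge0}^{m+1}$, $t>0$ and $k\in\{1,\dots,m\}$. Robustness: for $\mathcal{S}\subseteq\mathcal{U}$ and $\epsilon>0$ let $Q^{\mathcal{S}}_{\epsilon,i}(t)=\sup_{u_1\in\mathcal{S},\,\eta\in\mathcal{E}_\epsilon}\ \sup_{\tau\ge t}|[\mathcal{D}_iu_1](\tau)-[\mathcal{D}_i(u_1+\eta)](\tau)|$ and $Q^{\mathcal{S}}_i(t)=\lim_{\epsilon\to0^+}Q^{\mathcal{S}}_{\epsilon,i}(t)$. $\mathcal{D}$ is robust almost from the beginning over $\mathcal{S}$ if $Q_i^{\mathcal{S}}(t)=0$ for all $t>0$ and $i=1,\dots,m$. A differentiator that is robust over the largest set of inputs in $\mathcal{U}$ on which it is defined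 (here, $\mathcal{U}$ itself) is called strongly robust.
   Formalization: Part d) is stated only for N > 0 or L = 0; for N = 0 < L it is false, since then the bound ḡ is 0 and no finite linear combination of samples differentiates every signal in F_L^m exactly. *)

(* Defs.v *)
From HB Require Import structures.
From mathcomp Require Import all_boot all_order all_algebra.
From mathcomp Require Import all_classical all_reals all_analysis.

Set Implicit Arguments.
Unset Strict Implicit.
Unset Printing Implicit Defensive.

Import Order.TTheory GRing.Theory Num.Theory.
Import numFieldNormedType.Exports.

Local Open Scope classical_set_scope.
Local Open Scope ring_scope.

(** MathComp-Analysis, over an arbitrary [R : realType].

    A function R_{>=0} -> R is represented by a total function [R -> R] whose
    values at negative arguments are irrelevant: every condition below only
    constrains values on [0, +oo[.  Likewise a differentiator is a total
    operator, about which statements are only made for inputs in [inputs] and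
    for nonnegative times; causality forces it to ignore the values of its
    input at negative times. *)

Section Signals.
Variable R : realType.
Implicit Types (f g h u eta : R -> R) (m k : nat) (L N t T theta : R).

(** The limit is taken along s -> t with s >= 0 and s <> t, hence is the
    two-sided derivative at t > 0 and the right derivative at t = 0. *)
Definition half_diff_quot f t := (fun s => (f s - f t) / (s - t)).

Definition half_derivable f t :=
  cvg (half_diff_quot f t @ within `[0, +oo[ t^').

Definition half_derive f : R -> R :=
  fun t => lim (half_diff_quot f t @ within `[0, +oo[ t^').

Definition half_deriven k f : R -> R := iter k half_derive f.

Definition Fspace m : set (R -> R) :=
  [set f | [/\ forall k t, (k < m)%N -> 0 <= t ->
                 half_derivable (half_deriven k f) t,
               forall k, (k <= m)%N ->
                 {within `[0, +oo[, continuous (half_deriven k f)}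
             & [lipschitz half_deriven m f t | t in `[0, +oo[]]].

(** The (m+1)-st derivative only exists almost everywhere; its existence is
    part of the almost-everywhere condition, since [half_derive] has an
    unspecified value where the limit does not exist. *)
Definition F m L : set (R -> R) :=
  [set f | Fspace m f /\
    {ae @lebesgue_measure R, forall t, 0 <= t ->
       half_derivable (half_deriven m f) t /\
       `|half_deriven m.+1 f t| <= L}].

Definition E N : set (R -> R) :=
  [set eta | forall t, 0 <= t -> `|eta t| <= N].

Definition FE m L N : set (R -> R) := [set f \+ eta | f in F m L & eta in E N].

Definition inputs : set (R -> R) :=
  [set u | exists m L N, [/\ 0 <= L, 0 <= N & FE m L N u]].

Definition F_init m L (Rb : 'I_m.+1 -> R) : set (R -> R) :=
  [set f | F m L f /\ forall i : 'I_m.+1, `|half_deriven i f 0| <= Rb i].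

Definition norm_upto u theta : \bar R :=
  ereal_sup [set `|u tau|%:E | tau in `[0, theta]].

Definition G m L N T : set (R -> R) :=
  [set g | F m L g /\ forall t, 0 <= t <= T -> `|g t| <= N].

Definition gbar m L N k T : \bar R :=
  ereal_sup [set (half_deriven k g T)%:E | g in G m L N T].

Definition consistent m L N u theta : set (R -> R) :=
  [set h | F m L h /\ (norm_upto (h \- u)%R theta <= N%:E)%E].

Definition J m L N k u theta : set R :=
  if `[< consistent m L N u theta !=set0 >] then
    [set y | (ereal_sup [set (half_deriven k h theta)%:E
                        | h in consistent m L N u theta] - gbar m L N k theta
              <= y%:E <=
              ereal_inf [set (half_deriven k h theta)%:E
                        | h in consistent m L N u theta] + gbar m L N k theta)%E]
  else setT.

End Signals.

(** The output is a row vector with 0-based coordinates, so that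
    [D u t ord0 i], for [i : 'I_m], estimates the derivative of order i+1. *)
Definition differentiator (R : realType) (m : nat) := (R -> R) -> R -> 'rV[R]_m.

Section Differentiators.
Variables (R : realType) (m : nat).
Implicit Types (D : differentiator R m) (S : set (R -> R)) (i : 'I_m).

Definition causal D :=
  forall u1 u2 (t : R), inputs u1 -> inputs u2 -> 0 <= t ->
    (forall s, 0 <= s <= t -> u1 s = u2 s) -> D u1 t = D u2 t.

Definition worst_error D S (N : R) i (t : R) : \bar R :=
  ereal_sup [set ereal_sup [set
      `|half_deriven i.+1 f tau - D (f \+ eta) tau ord0 i|%:E
    | tau in `[t, +oo[] | f in S & eta in E N].

Definition best_worst_case_error D (L N : R) :=
  forall (Rb : 'I_m.+1 -> R), (forall j, 0 <= Rb j) ->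
  forall (t : R) i, 0 < t ->
    (worst_error D (F_init L Rb) N i t <= gbar m L N i.+1 t)%E.

Definition robustness_eps D S i (t eps : R) : \bar R :=
  ereal_sup [set ereal_sup [set
      `|D u1 tau ord0 i - D (u1 \+ eta) tau ord0 i|%:E
    | tau in `[t, +oo[] | u1 in S & eta in E eps].

Definition robustness D S i (t : R) : \bar R :=
  lim (robustness_eps D S i t eps @[eps --> 0^'+]).

Definition robust_almost_from_beginning D S :=
  forall (t : R) i, 0 < t -> robustness D S i t = 0%E.

Definition strongly_robust D := robust_almost_from_beginning D (@inputs R).

(** [inf] and [sup] are those of sets of reals, which are only meaningful for
    nonempty bounded sets. *)
Definition midpoint_differentiator (L N : R) : differentiator R m :=
  fun u t => \row_(i < m)
    let I := J m L N i.+1 u t in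
    if `[< 0 < t /\ has_lbound I /\ has_ubound I >]
    then (inf I + sup I) / 2 else 0.

Definition linear_differentiator (P : R -> 'I_m -> nat)
    (d tau : R -> 'I_m -> nat -> R) : differentiator R m :=
  fun u t => \row_(i < m)
    if 0 < t then \sum_(j < P t i) d t i j * u (t - tau t i j) else 0.

End Differentiators.

(* Main.v *)
(** Parts (a), (b), (c) rest on convexity.  Two signals consistent with [u] differ by at most
    [2 gbar], since half their difference belongs to [G]; so the interval is nonempty, and the output
    [y] belongs to it iff [|h^(i)(t) - y| <= gbar] for every consistent [h].

    For part (d), the supremum [gbar] is attained at a spline [g] whose top derivative only takes the
    values [L] and [-L] and switches finitely often: on a short interval, a signal can be replaced by
    such a spline with [m+1] switches, having the same derivatives at both endpoints and lying on a
    prescribed side of it, and the splines with a bounded number of switches form a compact family.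
    Being piecewise a nonconstant polynomial, [g] meets [N] and [-N] at finitely many points, and a
    signal bounded by [N] at those points only still has derivative at most [gbar].  Separating a
    convex cone in the finite-dimensional space of sample values then yields the weights. *)
Require Import Defs.
From mathcomp Require Import all_boot all_order all_algebra.
From mathcomp Require Import all_classical all_reals all_analysis.
From mathcomp Require Import ring lra measurable_realfun.
From mathcomp Require polyrcf.

Import Order.TTheory GRing.Theory Num.Theory.
Import numFieldNormedType.Exports.
Local Open Scope classical_set_scope.
Local Open Scope ring_scope.

(** * Derivatives relative to a set *)

(** The prescribed side in the spline replacement is what preserves the bound [N]: on each short
    step the spline lies on the side of the signal that faces zero, and the step is too short for it
    to reach the opposite bound. Its knots come from an L1 approximation problem: the sign changes
    of the error of a minimising polynomial define a step function whose moments are the Taylor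
    remainders of the signal. The minimum exists only if the Lipschitz constant of the signal is
    strictly below [L]. An arbitrary signal is therefore first multiplied by a factor below 1, and
    compactness of the spline family recovers the supremum. Top derivatives exist only almost
    everywhere, so they are eliminated: signals enter through the Lipschitz constant of their [m]-th
    derivative, and moments through integration by parts. One set of weights serves every [alpha]
    because the separated cone contains all rescalings of the class. Testing the functional on the
    zero signal bounds the sum of the absolute weights by [gbar / N]; as [gbar] is nonincreasing in
    time, the outputs are Lipschitz in the input uniformly over later times, hence strong
    robustness. *)

Section RelativeDerivative.
Context {R : realType}.
Implicit Types (D : set R) (f g : R -> R).

(** The derivative is an explicit function and no quotient occurs, so endpoints of [D] need no
    separate treatment, and the notion passes to subsets and can be glued. *)
Definition der_in D f f' := forall t, D t -> forall e, 0 < e ->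
  exists2 d, 0 < d & forall s, D s -> `|s - t| < d ->
    `|f s - f t - f' t * (s - t)| <= e * `|s - t|.

Definition lip_in D (L : R) f :=
  forall s t, D s -> D t -> `|f s - f t| <= L * `|s - t|.

Definition jets D m (df : nat -> R -> R) :=
  forall k, (k < m)%N -> der_in D (df k) (df k.+1).

Lemma der_in_subset D D' f f' : D' `<=` D -> der_in D f f' -> der_in D' f f'.
Proof.
move=> DD h t Dt e e0; have [d d0 hd] := h t (DD _ Dt) e e0.
by exists d => // s Ds; apply: hd; exact: DD.
Qed.

Lemma der_in_eq D f f' g g' : (forall t, D t -> f t = g t) ->
  (forall t, D t -> f' t = g' t) -> der_in D f f' -> der_in D g g'.
Proof.
move=> fg fg' h t Dt e e0; have [d d0 hd] := h t Dt e e0.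
by exists d => // s Ds sd; rewrite -!fg // -fg' //; exact: hd.
Qed.

Lemma der_in_lin D (a b : R) f f' g g' : der_in D f f' -> der_in D g g' ->
  der_in D (fun s => a * f s + b * g s) (fun s => a * f' s + b * g' s).
Proof.
move=> hf hg t Dt e e0.
have a0 : 0 <= `|a| by []. have b0 : 0 <= `|b| by [].
have c0 : 0 < e / (`|a| + `|b| + 1) by apply: divr_gt0 => //; lra.
have [d1 d10 h1] := hf t Dt _ c0; have [d2 d20 h2] := hg t Dt _ c0.
exists (Num.min d1 d2); first by rewrite lt_min d10.
move=> s Ds; rewrite lt_min => /andP[sd1 sd2].
have -> : a * f s + b * g s - (a * f t + b * g t) - (a * f' t + b * g' t) * (s - t)
   = a * (f s - f t - f' t * (s - t)) + b * (g s - g t - g' t * (s - t)) by ring.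
apply: (le_trans (ler_normD _ _)); rewrite !normrM.
have := h1 s Ds sd1; have := h2 s Ds sd2.
set c := e / _ in c0 *; set x := `|s - t|.
have ec : e = c * (`|a| + `|b| + 1) by rewrite /c divfK // gt_eqF //; lra.
have x0 : 0 <= x by rewrite /x.
move=> /(ler_wpM2l b0) H2 /(ler_wpM2l a0) H1; rewrite ec.
have := mulr_ge0 (ltW c0) x0; nra.
Qed.

Lemma der_in_cst D (c : R) : der_in D (fun=> c) (fun=> 0).
Proof.
by move=> t _ e e0; exists 1 => // s _ _; rewrite subrr mul0r subr0 normr0 mulr_ge0 // ltW.
Qed.

Lemma der_in_cont D f f' t e : der_in D f f' -> D t -> 0 < e ->
  exists2 d, 0 < d & forall s, D s -> `|s - t| < d -> `|f s - f t| <= e.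
Proof.
move=> h Dt e0; have [d d0 hd] := h t Dt 1 ltr01.
have k0 : 0 < 1 + `|f' t| by apply: ltr_pwDl.
exists (Num.min d (e / (1 + `|f' t|))); first by rewrite lt_min d0 divr_gt0.
move=> s Ds; rewrite lt_min ltr_pdivlMr // => /andP[sd se].
have := hd s Ds sd; rewrite mul1r => h1.
have -> : f s - f t = (f s - f t - f' t * (s - t)) + f' t * (s - t) by ring.
by apply: (le_trans (ler_normD _ _)); rewrite normrM; nra.
Qed.

Lemma der_in_mul D f f' g g' : der_in D f f' -> der_in D g g' ->
  der_in D (fun s => f s * g s) (fun s => f' s * g s + f s * g' s).
Proof.
move=> hf hg t Dt e e0.
have k0 : 0 < `|g t| + `|f t| + `|f' t| + 1 by have := normr_ge0 (g t); have := normr_ge0 (f t); have := normr_ge0 (f' t); lra.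
(* The cap at 1 controls the product of the first-order error of [f] with the increment of [g]. *)
set k := _ + 1 in k0; pose c := Num.min 1 (e / (2 * k)).
have c0 : 0 < c by rewrite lt_min ltr01 divr_gt0 // mulr_gt0.
have [d1 d10 h1] := hf t Dt _ c0; have [d2 d20 h2] := hg t Dt _ c0.
have [d3 d30 h3] := der_in_cont D f f' t _ hf Dt c0.
have [d4 d40 h4] := der_in_cont D g g' t _ hg Dt c0.
exists (Num.min d1 (Num.min d2 d4)); first by rewrite !lt_min d10 d20 d40.
move=> s Ds; rewrite !lt_min => /and3P[sd1 sd2 sd4].
have -> : f s * g s - f t * g t - (f' t * g t + f t * g' t) * (s - t) =
   (f s - f t - f' t * (s - t)) * g t + f t * (g s - g t - g' t * (s - t))
   + (f s - f t - f' t * (s - t)) * (g s - g t) + f' t * (s - t) * (g s - g t) by ring.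
have H1 := h1 s Ds sd1; have H2 := h2 s Ds sd2; have H4 := h4 s Ds sd4.
set A := (f s - f t - _) in H1 *; set B := (g s - g t - _) in H2 *.
set C := g s - g t in H4 *; set x := s - t in H1 H2 *.
have x0 := normr_ge0 x.
apply: (le_trans (ler_normD _ _)).
have ck : 2 * (c * k) <= e.
  have : c <= e / (2 * k) by rewrite ge_min lexx orbT.
  by rewrite ler_pdivlMr ?mulr_gt0 //; lra.
have c1 : c <= 1 by rewrite ge_min lexx.
have i1 : `|A * g t + f t * B + A * C| <= c * `|x| * `|g t| + `|f t| * (c * `|x|) + c * `|x|.
  apply: (le_trans (ler_normD _ _)); apply: lerD.
    apply: (le_trans (ler_normD _ _)); apply: lerD; rewrite normrM.
      by apply: ler_wpM2r.
    by apply: ler_wpM2l.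
  rewrite normrM -[leRHS]mulr1; apply: ler_pM => //; exact: le_trans c1.
have i2 : `|f' t * x * C| <= `|f' t| * `|x| * c.
  by rewrite !normrM; apply: ler_wpM2l => //; exact: mulr_ge0.
apply: (le_trans (lerD i1 i2)).
have -> : c * `|x| * `|g t| + `|f t| * (c * `|x|) + c * `|x| + `|f' t| * `|x| * c
  = c * k * `|x| by rewrite /k; ring.
apply: ler_wpM2r => //; have := mulr_ge0 (ltW c0) (ltW k0); lra.
Qed.

(* Sweeping argument on the supremum of the points up to which the increment is controlled. *)
Lemma locally_nonincr (a b : R) f : a <= b ->
  (forall s, a <= s <= b -> exists2 d, 0 < d & forall s', a <= s' <= b -> `|s' - s| < d ->
     (s <= s' -> f s' <= f s) /\ (s' <= s -> f s <= f s')) ->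
  f b <= f a.
Proof.
move=> ab h; pose A := [set s | a <= s <= b /\ f s <= f a].
have Aa : A a by rewrite /A /= !lexx ab.
have ubA : ubound A b by move=> s [/andP[]].
have hs : has_sup A by split; [exists a | exists b].
pose c := sup A.
have ac : a <= c by apply: ub_le_sup => //; exists b.
have cb : c <= b by apply: ge_sup => //; exists a.
have [d d0 hd] := h c (introT andP (conj ac cb)).
have Ac : f c <= f a.
  have [x [/andP[ax xb] fx] cx] := sup_adherent d0 hs.
  have xc : x <= c by apply: ub_le_sup => //; [exists b | rewrite /A /= ax xb].
  have [|_ /(_ xc)] := hd x (introT andP (conj ax xb)).
    by rewrite distrC ger0_norm ?subr_ge0 // -/c in cx *; lra.
  by move=> h1; exact: le_trans fx.
case: (leP b c) => [bc|cb']; first by rewrite (le_anti (introT andP (conj bc cb))).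
pose x := Num.min b (c + d / 2).
have cx : c < x by rewrite lt_min cb' /= ltrDl divr_gt0.
have xb : x <= b by rewrite ge_min lexx.
have xd : x <= c + d / 2 by rewrite ge_min lexx orbT.
have ax : a <= x by exact: le_trans (ltW cx).
have [|/(_ (ltW cx)) h1 _] := hd x (introT andP (conj ax xb)).
  by rewrite gtr0_norm ?subr_gt0 //; lra.
have : x <= c by apply: ub_le_sup; [exists b|rewrite /A /= ax xb; split=> //; exact: le_trans Ac].
by rewrite leNgt cx.
Qed.

(** The comparison function [phi] is arbitrary. It is linear for the mean value inequality, contains
    the measure of an open set in [lip_of_ae], and an integral in [weighted_increment_le]. *)
Lemma increment_le (a b : R) f phi : a <= b ->
  (forall s, a <= s <= b -> exists2 d, 0 < d & forall s', a <= s' <= b -> `|s' - s| < d ->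
     (s <= s' -> f s' - f s <= phi s' - phi s) /\ (s' <= s -> f s - f s' <= phi s - phi s')) ->
  f b - f a <= phi b - phi a.
Proof.
move=> ab h; suff : (f b - phi b) <= f a - phi a by lra.
apply: (locally_nonincr a b (fun s => f s - phi s)) => // s sab.
have [d d0 hd] := h s sab; exists d => // s' s'ab s'd.
by have [h1 h2] := hd s' s'ab s'd; split=> [/h1|/h2]; lra.
Qed.

Lemma mean_value_le (a b C : R) f f' : a <= b -> der_in `[a, b] f f' ->
  (forall s, a <= s <= b -> f' s <= C) -> f b - f a <= C * (b - a).
Proof.
move=> ab hf hC; apply/ler_addgt0Pr => e e0.
pose e' := e / (b - a + 1).
have e'0 : 0 < e' by apply: divr_gt0 => //; lra.
have : f b - f a <= (C + e') * (b - a).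
  rewrite mulrBr; apply: (increment_le a b f (fun s => (C + e') * s)) => // s sab.
  have [d d0 hd] := hf s sab e' e'0; exists d => // s' s'ab s'd.
  have H := hd s' s'ab s'd; have Cs := hC s sab; split => ss'.
    by move: H; rewrite (ger0_norm (_ : 0 <= s' - s)) ?subr_ge0 // ler_norml => /andP[_]; nra.
  move: H; rewrite (ler0_norm (_ : s' - s <= 0)) ?subr_le0 // ler_norml => /andP[H _]; nra.
have : e' * (b - a) <= e.
  rewrite /e' mulrAC ler_pdivrMr; last lra.
  by apply: ler_wpM2l; [exact: ltW|lra].
lra.
Qed.

Lemma mean_value_norm (a b C : R) f f' : a <= b -> der_in `[a, b] f f' ->
  (forall s, a <= s <= b -> `|f' s| <= C) -> `|f b - f a| <= C * (b - a).
Proof.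
move=> ab hf hC; rewrite ler_norml lerNl; apply/andP; split; last first.
  apply: (mean_value_le a b C f f') => // s sab; have := hC s sab.
  by rewrite ler_norml => /andP[].
have := mean_value_le a b C (fun s => -1 * f s + 0 * f s) (fun s => -1 * f' s + 0 * f' s) ab.
move=> /(_ (der_in_lin _ _ _ _ _ _ _ hf hf)) H.
suff : -1 * f b + 0 * f b - (-1 * f a + 0 * f a) <= C * (b - a) by lra.
apply: H => s sab; have := hC s sab.
by rewrite ler_norml => /andP[]; lra.
Qed.

Lemma der_in_lip (a b C : R) f f' : der_in `[a, b] f f' ->
  (forall s, a <= s <= b -> `|f' s| <= C) -> lip_in `[a, b] C f.
Proof.
move=> hf hC s t; rewrite /= !in_itv /=.
wlog st : s t / s <= t.
  by move=> H hs ht; case/orP: (le_total s t) => st; [|rewrite distrC (distrC s)]; exact: H.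
move=> /andP[as_ sb] /andP[at_ tb]; rewrite distrC (distrC s) (ger0_norm (_ : 0 <= t - s)) ?subr_ge0 //.
apply: (mean_value_norm s t C f f') => //.
  by apply: der_in_subset hf => x /=; rewrite !in_itv /= => /andP[? ?]; apply/andP; split; lra.
move=> x /andP[? ?]; apply: hC; lra.
Qed.

End RelativeDerivative.

(** * Signals on the half-line *)

Section HalfLine.
Context {R : realType}.
Implicit Types (f g : R -> R) (L : R).

(** Translates the filter limit of the statement into the form of [der_in]. The point [s = t], which
    the punctured filter removes, satisfies the inequality trivially. *)
Lemma half_diff_quot_cvgP f (t l : R) :
  (half_diff_quot f t @ within `[0, +oo[ t^' --> l) <->
  (forall e, 0 < e -> exists2 d, 0 < d & forall s, 0 <= s -> `|s - t| < d ->
     `|f s - f t - l * (s - t)| <= e * `|s - t|).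
Proof.
split.
  move=> /cvgrPdist_le h e e0; have := h e e0.
  rewrite near_withinE /dnbhs near_withinE.
  move=> /nbhs_ballP[d /= d0 hd]; exists d => // s s0 sd.
  have [->|st] := eqVneq s t; first by rewrite !subrr mulr0 subrr normr0 mulr0.
  have := hd s; rewrite /ball /= distrC => /(_ sd st); rewrite in_itv /= andbT => /(_ s0).
  rewrite /half_diff_quot; set q := _ / _ => H.
  have -> : f s - f t - l * (s - t) = - (l - q) * (s - t).
    by rewrite /q opprB mulrBl divfK // subr_eq0.
  by rewrite normrM normrN; exact: ler_wpM2r.
move=> h; apply/cvgrPdist_le => e e0; have [d d0 hd] := h e e0.
rewrite near_withinE /dnbhs near_withinE; apply/nbhs_ballP.
exists d => //= s; rewrite /ball /= distrC => sd st; rewrite in_itv /= andbT => s0.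
have := hd s s0 sd; rewrite /half_diff_quot.
have x0 : 0 < `|s - t| by rewrite normr_gt0 subr_eq0.
have -> : f s - f t - l * (s - t) = - (l - (f s - f t) / (s - t)) * (s - t).
  by rewrite opprB mulrBl divfK // subr_eq0.
by rewrite normrM normrN ler_pM2r.
Qed.

Lemma half_dnbhs_proper (t : R) : 0 <= t -> ProperFilter (within `[0, +oo[ t^').
Proof.
move=> t0; apply: Build_ProperFilter_ex => P.
rewrite /within /dnbhs /within /= => /nbhs_ballP[d /= d0 hd].
exists (t + d / 2); apply: hd; rewrite /ball /=.
- by rewrite opprD addNKr normrN gtr0_norm ?divr_gt0 //; lra.
- by rewrite gt_eqF // ltrDl divr_gt0.
- by rewrite in_itv /= andbT; lra.
Qed.

Lemma half_derivativeE f (t l : R) : 0 <= t ->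
  half_diff_quot f t @ within `[0, +oo[ t^' --> l ->
  half_derivable f t /\ half_derive f t = l.
Proof.
move=> t0 h; have := half_dnbhs_proper t t0 => P.
by split; [apply/cvg_ex; exists l|apply: cvg_lim].
Qed.

Lemma half_derivable_cvg f t : half_derivable f t ->
  half_diff_quot f t @ within `[0, +oo[ t^' --> half_derive f t.
Proof. by []. Qed.

Lemma der_in_half_derive f f' t : der_in `[0, +oo[ f f' -> 0 <= t ->
  half_derivable f t /\ half_derive f t = f' t.
Proof.
move=> h t0; apply: half_derivativeE => //; apply/half_diff_quot_cvgP => e e0.
have [|d d0 hd] := h t _ e e0; first by rewrite /= in_itv /= t0.
by exists d => // s s0; apply: hd; rewrite /= in_itv /= s0.
Qed.

Lemma half_derivable_der_in f : (forall t, 0 <= t -> half_derivable f t) ->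
  der_in `[0, +oo[ f (half_derive f).
Proof.
move=> h t /=; rewrite in_itv /= andbT => t0 e e0.
have /half_diff_quot_cvgP /(_ e e0) [d d0 hd] := half_derivable_cvg f t (h t t0).
by exists d => // s; rewrite /= in_itv /= andbT; exact: hd.
Qed.

(** The filter only sees nonnegative arguments, so a function may be replaced by another
    representative of the same signal. *)
Lemma half_derive_eq f g t : (forall s, 0 <= s -> f s = g s) -> 0 <= t ->
  (half_derivable f t -> half_derivable g t) /\ half_derive f t = half_derive g t.
Proof.
move=> fg t0.
suff E : half_diff_quot f t @ within `[0, +oo[ t^' = half_diff_quot g t @ within `[0, +oo[ t^'.
  by rewrite /half_derivable /half_derive E.
suff H f1 f2 A : (forall s, 0 <= s -> f1 s = f2 s) ->
    (half_diff_quot f1 t @ within `[0, +oo[ t^') A -> (half_diff_quot f2 t @ within `[0, +oo[ t^') A.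
  by apply/predeqP => A; split; apply: H => // s s0; rewrite fg.
move=> f12; apply: (@filterS _ t^') => s /= h s0.
by have := h s0; rewrite /half_diff_quot !f12 //; move: s0; rewrite in_itv /= andbT.
Qed.

Lemma ae_imply (P Q : R -> Prop) : (forall t, P t -> Q t) ->
  {ae @lebesgue_measure R, forall t, P t} -> {ae @lebesgue_measure R, forall t, Q t}.
Proof. by move=> h; apply: (@filterS _ _ (@ae_filter_ringOfSetsType _ (measurableTypeR R) R (@lebesgue_measure R))). Qed.

Lemma ae_imply2 (P1 P2 Q : R -> Prop) : (forall t, P1 t -> P2 t -> Q t) ->
  {ae @lebesgue_measure R, forall t, P1 t} -> {ae @lebesgue_measure R, forall t, P2 t} ->
  {ae @lebesgue_measure R, forall t, Q t}.
Proof. by move=> h; apply: (@filterS2 _ _ (@ae_filter_ringOfSetsType _ (measurableTypeR R) R (@lebesgue_measure R))). Qed.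

Definition ae_half_derivable f :=
  {ae @lebesgue_measure R, forall t, 0 <= t -> half_derivable f t}.

Lemma half_derive_le_lip f L t : 0 <= t -> lip_in `[0, +oo[ L f ->
  half_derivable f t -> `|half_derive f t| <= L.
Proof.
move=> t0 fL /half_derivable_cvg h; apply/ler_addgt0Pr => e e0.
have /half_diff_quot_cvgP /(_ e e0) [d d0 hd] := h.
have dd : `|t + d / 2 - t| = d / 2 by rewrite addrC addKr gtr0_norm // divr_gt0.
have td0 : 0 <= t + d / 2 by lra.
have H := hd _ td0; rewrite dd in H; have {}H := H (ltac:(lra)).
have := fL (t + d / 2) t; rewrite /= !in_itv /= !andbT => /(_ td0 t0).
rewrite dd => HL.
have : `|half_derive f t * (t + d / 2 - t)| <= (L + e) * (d / 2).
  have -> : half_derive f t * (t + d / 2 - t) = (f (t + d / 2) - f t) - (f (t + d / 2) - f t - half_derive f t * (t + d / 2 - t)) by ring.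
  by apply: (le_trans (ler_normB _ _)); lra.
by rewrite normrM dd ler_pM2r // divr_gt0.
Qed.

(** The way into [F] for all later constructions: linear combinations, shifts and splines. The bound
    on the top derivative follows from the Lipschitz constant wherever that derivative exists;
    existence almost everywhere is supplied by each construction. *)
Lemma jets_F df f m L : 0 <= L -> (forall t, 0 <= t -> df 0%N t = f t) ->
  jets `[0, +oo[ m df -> lip_in `[0, +oo[ L (df m) -> ae_half_derivable (df m) ->
  F m L f /\ forall k t, (k <= m)%N -> 0 <= t -> half_deriven k f t = df k t.
Proof.
move=> L0 df0 hj hL hae.
have E k t : (k <= m)%N -> 0 <= t -> half_deriven k f t = df k t.
  elim: k t => [|k IH] t km t0; first by rewrite df0.
  have [_] := half_derive_eq (half_deriven k f) (df k) t (fun s => IH s (ltnW km)) t0.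
  rewrite /half_deriven iterS => ->.
  by have [_ ->] := der_in_half_derive (df k) (df k.+1) t (hj k km) t0.
split => //; split; first split.
- move=> k t km t0.
  have [H _] := half_derive_eq (df k) (half_deriven k f) t (fun s s0 => esym (E k s (ltnW km) s0)) t0.
  by apply: H; have [] := der_in_half_derive (df k) (df k.+1) t (hj k km) t0.
- move=> k km; apply/subspace_continuousP => t /=; rewrite in_itv /= andbT => t0.
  apply/cvgrPdist_le => e e0; rewrite near_withinE; apply/nbhs_ballP.
  suff [d d0 hd] : exists2 d, 0 < d & forall s, 0 <= s -> `|s - t| < d -> `|df k s - df k t| <= e.
    exists d => //= s; rewrite /ball /= distrC in_itv /= andbT => sd s0.
    have : `|half_deriven k f t - half_deriven k f s| <= e by rewrite !E // distrC; exact: hd.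
    by [].
  move: km; rewrite leq_eqVlt => /orP[/eqP ->|km].
    exists (e / (L + 1)); first by apply: divr_gt0 => //; lra.
    move=> s s0; rewrite ltr_pdivlMr; last lra.
    move=> sd; have := hL s t; rewrite /= !in_itv /= !andbT => /(_ s0 t0).
    have := normr_ge0 (s - t); nra.
  have [|d d0 hd] := der_in_cont _ _ _ t e (hj k km) _ e0; first by rewrite /= in_itv /= t0.
  by exists d => // s s0; apply: hd; rewrite /= in_itv /= s0.
- exists L; split; first by rewrite num_real.
  move=> M LM [s t] [/=]; rewrite !in_itv /= !andbT => s0 t0; rewrite !E //.
  apply: (le_trans (hL _ _ _ _)); rewrite /= ?in_itv /= ?andbT //.
  by apply: ler_wpM2r => //; exact: ltW.
- apply: ae_imply hae => t ht t0.
  have [H H'] := half_derive_eq (df m) (half_deriven m f) t (fun s s0 => esym (E m s (leqnn _) s0)) t0.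
  split; first exact: H (ht t0).
  by rewrite /half_deriven iterS -H'; apply: half_derive_le_lip => //; exact: ht.
Qed.

Lemma F_jets m L f : F m L f -> jets `[0, +oo[ m (fun k => half_deriven k f).
Proof.
move=> [[h _ _] _] k km; apply: half_derivable_der_in => t t0.
exact: h.
Qed.

(* Off the exceptional null set the increments of [f] are controlled by [L]; on an open
   neighbourhood [U] of it, of small measure, they are controlled by the Lipschitz constant. *)
Lemma lip_of_ae (f : R -> R) K L : 0 <= L -> lip_in `[0, +oo[ K f ->
  {ae @lebesgue_measure R, forall t, 0 <= t -> half_derivable f t /\ `|half_derive f t| <= L} ->
  lip_in `[0, +oo[ L f.
Proof.
move=> L0 fK [A [mA A0 hA]].
have K0 : 0 <= K.
  have := fK 1 0; rewrite /= !in_itv /= ler01 lexx => /(_ isT isT).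
  by rewrite subr0 normr1 mulr1; exact: le_trans.
(* A one-sided claim for a general [g], with the derivative replaced by a local increment bound, so
   that it applies to both [f] and [- f]. *)
suff H a b (g : R -> R) : 0 <= a -> a <= b -> lip_in `[0, +oo[ K g ->
    (forall t, ~ A t -> 0 <= t -> forall e, 0 < e ->
      exists2 d, 0 < d & forall s, 0 <= s -> `|s - t| < d ->
       `|g s - g t| <= (L + e) * `|s - t|) -> g b - g a <= L * (b - a).
  have Hd t : ~ A t -> 0 <= t -> forall e, 0 < e ->
      exists2 d, 0 < d & forall s, 0 <= s -> `|s - t| < d ->
       `|f s - f t| <= (L + e) * `|s - t|.
    move=> At t0 e e0.
    have [dt Lt] : half_derivable f t /\ `|half_derive f t| <= L.
      by apply: contrapT => nH; apply: At; apply: hA => /= nH'; apply: nH; exact: nH'.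
    have /half_diff_quot_cvgP /(_ e e0) [d d0 hd] := half_derivable_cvg f t dt.
    exists d => // s s0 sd; have := hd s s0 sd => Hs.
    have -> : f s - f t = (f s - f t - half_derive f t * (s - t)) + half_derive f t * (s - t) by ring.
    apply: (le_trans (ler_normD _ _)); rewrite normrM.
    have := normr_ge0 (s - t); nra.
  have H' a b : 0 <= a -> a <= b -> `|f b - f a| <= L * (b - a).
    move=> a0 ab; rewrite ler_norml lerNl; apply/andP; split; last exact: H.
    have : (fun x => - f x) b - (fun x => - f x) a <= L * (b - a); last by rewrite /=; lra.
    apply: (H a b (fun x => - f x)) => //.
      by move=> s t s0 t0; rewrite -opprD normrN; exact: fK.
    move=> t At t0 e e0; have [d d0 hd] := Hd t At t0 e e0.
    by exists d => // s s0 sd; rewrite -opprD normrN; exact: hd.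
  move=> s t; rewrite /= !in_itv /= !andbT => s0 t0.
  case/orP: (le_total s t) => st.
    by rewrite distrC (distrC s) (ger0_norm (_ : 0 <= t - s)) ?subr_ge0 //; exact: H'.
  by rewrite (ger0_norm (_ : 0 <= s - t)) ?subr_ge0 //; exact: H'.
move=> a0 ab gK hd; apply/ler_addgt0Pr => e e0.
pose e1 := e / (b - a + K + 1).
have e10 : 0 < e1 by apply: divr_gt0 => //; lra.
have [|U [oU AU mU]] := @lebesgue_regularity_outer R A e1 mA _ e10.
  by rewrite [X in (X < _)%E](A0 : _ = 0%E).
have mUo : measurable U by exact: open_measurable.
have mUa s : measurable (U `&` `[a, s]) by exact: measurableI.
pose mu : {measure set (measurableTypeR R) -> \bar R} := @lebesgue_measure R.
have muU : (mu U < e1%:E)%E.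
  have -> : mu U = mu (U `\` A); last by [].
  rewrite -[in LHS](setDUK AU) measureU //; last 2 first.
  - exact: measurableD.
  - by rewrite setDE setIA setIAC setICr set0I.
  by rewrite [X in (X + _)%E](A0 : _ = 0%E) add0e.
have fin s : mu (U `&` `[a, s]) \is a fin_num.
  rewrite ge0_fin_numE // (le_lt_trans _ (lt_trans muU (ltry _))) //.
  by apply: le_measure; rewrite ?inE //; exact: mUa.
(* On intervals inside [U] this grows with slope 1, so [K * p] pays there for the crude constant
   [K]; its total growth costs at most [K * e1]. *)
pose p s := fine (mu (U `&` `[a, s])).
have pge s s' : a <= s -> s <= s' -> p s <= p s'.
  move=> as_ ss'; apply: fine_le => //; apply: le_measure; rewrite ?inE //; try exact: mUa.
  move=> x [Ux]; rewrite /= !in_itv /= => /andP[-> xs]; split => //=; exact: le_trans ss'.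
have pU s s' : a <= s -> s <= s' -> `]s, s'] `<=` U -> s' - s <= p s' - p s.
  move=> as_ ss' sU.
  have E : U `&` `[a, s'] = (U `&` `[a, s]) `|` `]s, s'].
    apply/seteqP; split => x /=; rewrite !in_itv /=.
      move=> [Ux /andP[ax xs']]; case: (leP x s) => xs; [left|right]; rewrite ?ax //.
    case=> [[Ux /andP[-> xs]]|/andP[sx xs']]; first by split=> //; exact: le_trans ss'.
    by split; [apply: sU; rewrite /= in_itv /= sx|rewrite xs' (le_trans as_) // ltW].
  rewrite /p E [mu (_ `|` _)]measureU //; last 2 first.
  - exact: mUa.
  - apply/seteqP; split => x //= [[_]]; rewrite !in_itv /= => /andP[_ xs] /andP[sx _].
    by move: (lt_le_trans sx xs); rewrite ltxx.
  have M : lebesgue_measure [set` `]s, s']] = (s' - s)%:E.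
    rewrite lebesgue_measure_itv /= lte_fin; case: ltP => // s's.
    by rewrite (le_anti (introT andP (conj s's ss'))) subrr.
  by rewrite [X in fine (_ + X)%E](M : _ = _) fineD //=; [lra|exact: fin].
have : g b - g a <= ((L + e1) * b + K * p b) - ((L + e1) * a + K * p a).
  apply: (increment_le a b g (fun x => (L + e1) * x + K * p x)) => // s /andP[as_ sb].
  have [Us|Us] := pselect (U s).
    have /nbhs_ballP[d /= d0 Ud] : nbhs s U by apply: open_nbhs_nbhs.
    exists d => // s' /andP[as' s'b] s'd.
    have key x y : a <= x -> x <= y -> `]x, y] `<=` U -> g y - g x <= K * (y - x) -> 
      g y - g x <= (L + e1) * y + K * p y - ((L + e1) * x + K * p x).
      move=> ax xy xyU H.
      have := ler_wpM2l K0 (pU x y ax xy xyU).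
      have := mulr_ge0 L0 (_ : 0 <= y - x); rewrite subr_ge0 => /(_ xy).
      have := mulr_ge0 (ltW e10) (_ : 0 <= y - x); rewrite subr_ge0 => /(_ xy).
      lra.
    have gk x y : a <= x -> x <= y -> g y - g x <= K * (y - x).
      move=> ax xy; rewrite -[in leRHS](ger0_norm (_ : 0 <= y - x)) ?subr_ge0 //.
      apply: (le_trans (ler_norm _)); apply: gK; rewrite /= in_itv /= andbT; lra.
    split=> ss'; apply: key => //; try exact: gk; move=> x; rewrite /= in_itv /= => /andP[? ?];
      apply: Ud; rewrite /ball /=.
      move: s'd; rewrite ger0_norm ?subr_ge0 // distrC ger0_norm; lra.
    move: s'd; rewrite distrC ger0_norm ?subr_ge0 // ger0_norm; lra.
  have As : ~ A s by move=> /AU.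
  have s0 : 0 <= s by lra.
  have [d d0 Hd] := hd s As s0 e1 e10; exists d => // s' /andP[as' s'b] s'd.
  have := Hd s' (le_trans a0 as') s'd => Hs; split => ss'.
    have := ler_wpM2l K0 (pge s s' as_ ss').
    move: Hs; rewrite (ger0_norm (_ : 0 <= s' - s)) ?subr_ge0 // ler_norml => /andP[_]; lra.
  have := ler_wpM2l K0 (pge s' s as' ss').
  move: Hs; rewrite distrC (distrC s') (ger0_norm (_ : 0 <= s - s')) ?subr_ge0 // ler_norml => /andP[_]; lra.
have pa : 0 <= p a by rewrite fine_ge0.
have pb : p b <= e1.
  rewrite -lee_fin fineK //; apply: ltW; apply: le_lt_trans muU.
  by apply: le_measure; rewrite ?inE //; exact: mUa.
have : e1 * (b - a + K + 1) = e by rewrite divfK // gt_eqF //; lra.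
have := ler_wpM2l K0 pb; have := mulr_ge0 K0 pa; lra.
Qed.

Lemma F_lip m L f : 0 <= L -> F m L f -> lip_in `[0, +oo[ L (half_deriven m f).
Proof.
move=> L0 [[_ _ [M0 [M0r hM]]] hae].
apply: (lip_of_ae _ (M0 + 1)) => //.
move=> s t s0 t0; have := hM (M0 + 1) (ltac:(lra)) (s, t); exact.
Qed.

Lemma F_ae m L f : F m L f -> ae_half_derivable (half_deriven m f).
Proof. by move=> [_ h]; apply: ae_imply h => t h /h[]. Qed.

End HalfLine.

(** * Closure of the signal classes under shifts and linear combinations *)

Section SignalClasses.
Context {R : realType}.
Implicit Types (f g : R -> R) (L : R).

(** By uniqueness of the Lebesgue measure it suffices to compare half-open intervals. It is needed
    to translate exceptional null sets. *)
Lemma lebesgue_measure_shift (c : R) (A : set R) : measurable A ->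
  pushforward lebesgue_measure ((fun x => x + c) : _ -> measurableTypeR R) A = lebesgue_measure A.
Proof.
move=> mA; apply/esym/lebesgue_measure_unique => //=; first exact: measurable_funD.
move=> _ _ [[a b]] _ <-.
have -> : pushforward lebesgue_measure ((fun x => x + c) : _ -> measurableTypeR R) `]a, b]%classic
    = lebesgue_measure `]a - c, b - c]%classic.
  congr (lebesgue_measure _); apply/seteqP; split => x /=; rewrite !in_itv /= => /andP[? ?];
    apply/andP; split; lra.
rewrite !lebesgue_measure_itv /= !lte_fin ltrD2r; case: ifP => // _.
by congr (_%:E); lra.
Qed.

Lemma ae_half_derivable_shift f c : 0 <= c -> ae_half_derivable f ->
  ae_half_derivable (fun s => f (s + c)).
Proof.
move=> c0 [A [mA A0 hA]].
have ms : measurable_fun setT ((fun x => x + c) : R -> measurableTypeR R) by exact: measurable_funD.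
exists ((fun x => x + c) @^-1` A); split.
- by rewrite -[X in measurable X]setTI; exact: ms.
- by have := lebesgue_measure_shift c A mA; rewrite /pushforward A0.
- move=> t /= ht; apply: hA => /= H; apply: ht => t0.
  have tc : 0 <= t + c by lra.
  have /half_diff_quot_cvgP h := half_derivable_cvg _ _ (H tc).
  suff : half_diff_quot (fun s => f (s + c)) t @ within `[0, +oo[ t^' --> half_derive f (t + c).
    by case/half_derivativeE.
  apply/half_diff_quot_cvgP => e e0; have [d d0 hd] := h e e0; exists d => // s s0 sd.
  have E : s + c - (t + c) = s - t by ring.
  by have := hd (s + c); rewrite E; apply => //; lra.
Qed.

Lemma ae_half_derivable_lin f g (a b : R) : ae_half_derivable f -> ae_half_derivable g ->
  ae_half_derivable (fun s => a * f s + b * g s).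
Proof.
apply: ae_imply2 => t hf hg t0.
have h1 := half_derivable_cvg _ _ (hf t0); have h2 := half_derivable_cvg _ _ (hg t0).
have P := half_dnbhs_proper t t0.
apply/cvg_ex; exists (a * half_derive f t + b * half_derive g t).
rewrite (_ : half_diff_quot (fun s => a * f s + b * g s) t =
  (fun s => a * half_diff_quot f t s + b * half_diff_quot g t s)).
  by apply: cvgD; apply: cvgM => //; exact: cvg_cst.
by apply/funext => s; rewrite /half_diff_quot; ring.
Qed.

Lemma F_lin m L1 L2 (a b : R) f g : 0 <= L1 -> 0 <= L2 -> F m L1 f -> F m L2 g ->
  F m (`|a| * L1 + `|b| * L2) (fun s => a * f s + b * g s) /\
  forall k t, (k <= m)%N -> 0 <= t -> half_deriven k (fun s => a * f s + b * g s) t =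
    a * half_deriven k f t + b * half_deriven k g t.
Proof.
move=> L10 L20 Ff Fg.
apply: (@jets_F _ (fun k s => a * half_deriven k f s + b * half_deriven k g s)) => //.
- by rewrite addr_ge0 // mulr_ge0.
- by move=> k km; apply: der_in_lin; [exact: (F_jets m L1)|exact: (F_jets m L2)].
- move=> s t s0 t0; have := F_lip m L1 f L10 Ff s t s0 t0; have := F_lip m L2 g L20 Fg s t s0 t0.
  set A := half_deriven m f s - _; set B := half_deriven m g s - _ => HB HA.
  have -> : a * half_deriven m f s + b * half_deriven m g s -
    (a * half_deriven m f t + b * half_deriven m g t) = a * A + b * B by rewrite /A /B; ring.
  apply: (le_trans (ler_normD _ _)); rewrite !normrM mulrDl -!mulrA.
  by apply: lerD; apply: ler_wpM2l.
- exact: ae_half_derivable_lin (F_ae _ _ _ Ff) (F_ae _ _ _ Fg).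
Qed.

Lemma F_le m L L' f : L <= L' -> F m L f -> F m L' f.
Proof.
move=> LL [h1 h2]; split => //; apply: ae_imply h2 => t h t0.
by have [d l] := h t0; split => //; exact: le_trans LL.
Qed.

Lemma F_scale m L (a : R) f : 0 <= L -> F m L f ->
  F m (`|a| * L) (fun s => a * f s) /\
  forall k t, (k <= m)%N -> 0 <= t -> half_deriven k (fun s => a * f s) t = a * half_deriven k f t.
Proof.
move=> L0 Ff; have [H1 H2] := F_lin m L L a 0 f f L0 L0 Ff Ff.
have E : (fun s => a * f s + 0 * f s) = (fun s => a * f s) by apply/funext => s; rewrite mul0r addr0.
rewrite E normr0 mul0r addr0 in H1; split => // k t km t0.
by have := H2 k t km t0; rewrite E mul0r addr0.
Qed.

Lemma F_convex m L (a : R) f g : 0 <= L -> 0 <= a <= 1 -> F m L f -> F m L g ->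
  F m L (fun s => (1 - a) * f s + a * g s) /\
  forall k t, (k <= m)%N -> 0 <= t -> half_deriven k (fun s => (1 - a) * f s + a * g s) t =
    (1 - a) * half_deriven k f t + a * half_deriven k g t.
Proof.
move=> L0 /andP[a0 a1] Ff Fg; have [H1 H2] := F_lin m L L (1 - a) a f g L0 L0 Ff Fg.
split => //; move: H1; rewrite !ger0_norm ?subr_ge0 //.
by rewrite -mulrDl subrK mul1r.
Qed.

Lemma F_shift m L c f : 0 <= L -> 0 <= c -> F m L f ->
  F m L (fun s => f (s + c)) /\
  forall k t, (k <= m)%N -> 0 <= t -> half_deriven k (fun s => f (s + c)) t = half_deriven k f (t + c).
Proof.
move=> L0 c0 Ff.
apply: (@jets_F _ (fun k s => half_deriven k f (s + c))) => //.
- move=> k km t /=; rewrite in_itv /= andbT => t0 e e0.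
  have tc : `[0, +oo[%classic (t + c) by rewrite /= in_itv /= andbT; lra.
  have [d d0 hd] := F_jets m L f Ff k km (t + c) tc e e0.
  exists d => // s; rewrite in_itv /= andbT => s0 sd.
  have E : s + c - (t + c) = s - t by ring.
  have := hd (s + c); rewrite E /= in_itv /= andbT; apply => //; lra.
- move=> s t /=; rewrite !in_itv /= !andbT => s0 t0.
  have E : s + c - (t + c) = s - t by ring.
  rewrite -E; apply: (F_lip m L f) => //; rewrite /= in_itv /= andbT; lra.
- exact: ae_half_derivable_shift (F_ae _ _ _ Ff).
Qed.

Lemma ae_half_derivable_all f : (forall t, 0 <= t -> half_derivable f t) -> ae_half_derivable f.
Proof.
move=> h; exists set0; split => //=; last by move=> t /= H; exfalso; apply: H; exact: h.
Qed.

Lemma F_zero m L : 0 <= L -> F m L (fun=> 0) /\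
  forall k t, (k <= m)%N -> 0 <= t -> half_deriven k (fun=> 0 : R) t = 0.
Proof.
move=> L0; apply: (@jets_F _ (fun k s => 0)) => //.
- by move=> k km; exact: der_in_cst.
- by move=> s t _ _; rewrite subrr normr0 mulr_ge0.
- apply: ae_half_derivable_all => t t0.
  by have [] := der_in_half_derive (fun=> 0) (fun=> 0) t (der_in_cst _ _) t0.
Qed.

Lemma F_continuous m L f t e : 0 <= L -> F m L f -> 0 <= t -> 0 < e ->
  exists2 d, 0 < d & forall s, 0 <= s -> `|s - t| < d -> `|f s - f t| <= e.
Proof.
move=> L0 Ff t0 e0.
have cl : lip_in `[0, +oo[ L (half_deriven m f) by exact: F_lip.
case: m => [|m] in Ff cl *; last first.
  have [|d d0 hd] := der_in_cont _ _ _ t e (F_jets m.+1 L f Ff 0 isT) _ e0; first by rewrite /= in_itv /= t0.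
  by exists d => // s s0; apply: hd; rewrite /= in_itv /= s0.
exists (e / (L + 1)); first by apply: divr_gt0 => //; lra.
move=> s s0; rewrite ltr_pdivlMr; last lra.
move=> sd; have := cl s t; rewrite /= !in_itv /= !andbT => /(_ s0 t0).
by have := normr_ge0 (s - t); nra.
Qed.

End SignalClasses.

(** * Bounds of Landau type for intermediate derivatives *)

Section Landau.
Context {R : realType}.
Implicit Types (df : nat -> R -> R).

Lemma jets_subset (D D' : set R) m df : D' `<=` D -> jets D m df -> jets D' m df.
Proof. by move=> DD h k km; exact: der_in_subset (h k km). Qed.

Lemma jets_le (D : set R) m n df : (n <= m)%N -> jets D m df -> jets D n df.
Proof. by move=> nm h k kn; apply: h; exact: leq_trans nm. Qed.

Lemma itv_cc_subset (a b c d : R) : c <= a -> b <= d -> `[a, b]%classic `<=` `[c, d]%classic.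
Proof. by move=> ca bd x /=; rewrite !in_itv /= => /andP[? ?]; apply/andP; split; lra. Qed.

(** A function whose [m]-th derivative stays above a large constant on a long interval must itself
    become large. The constant [K] depends on [m] only: each order divides the interval by 4, hence
    the powers of 4. *)
Lemma top_derivative_bound m : exists2 K : R, 0 <= K & forall a b c N df,
  a <= b -> jets `[a, b] m df -> (forall s, a <= s <= b -> `|df 0%N s| <= N) ->
  (forall s, a <= s <= b -> c <= df m s) -> c * (b - a) ^+ m <= K * N.
Proof.
elim: m => [|m [K K0 IH]].
  exists 1 => // a b c N df ab _ h0 hc; rewrite expr0 mulr1 mul1r.
  have aab : a <= a <= b by rewrite lexx.
  by apply: (le_trans (hc a aab)); apply: le_trans (h0 a aab); exact: ler_norm.
exists (4%:R ^+ m.+1 * K); first by rewrite mulr_ge0 // exprn_ge0.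
move=> a b c N df ab hj h0 hc.
have N0 : 0 <= N.
  have aab : a <= a <= b by rewrite lexx.
  exact: le_trans (h0 a aab).
have [cle|c0] := leP c 0.
  apply: (@le_trans _ _ 0); last by rewrite !mulr_ge0 // exprn_ge0.
  by rewrite mulr_le0_ge0 // exprn_ge0 // subr_ge0.
pose l := (b - a) / 4; have l0 : 0 <= l by rewrite /l; lra.
have E : c * (b - a) ^+ m.+1 = 4%:R ^+ m.+1 * (c * l * l ^+ m).
  have -> : b - a = 4%:R * l by rewrite /l; field.
  by rewrite exprMn (exprS l); ring.
rewrite E -[leRHS]mulrA; apply: ler_wpM2l; first by rewrite exprn_ge0.
pose x := a + 2 * l.
have inc s s' : a <= s -> s <= s' -> s' <= b -> c * (s' - s) <= df m s' - df m s.
  move=> as_ ss sb.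
  have := mean_value_le s s' (- c) (fun u => -1 * df m u + 0 * df m u) (fun u => -1 * df m.+1 u + 0 * df m.+1 u) ss.
  have hm : der_in `[s, s'] (df m) (df m.+1).
    by apply: der_in_subset (hj m (leqnn _)); exact: itv_cc_subset.
  move=> /(_ (der_in_lin _ _ _ _ _ _ _ hm hm)) H.
  have : -1 * df m s' + 0 * df m s' - (-1 * df m s + 0 * df m s) <= - c * (s' - s).
    apply: H => u /andP[su us]; have := hc u (introT andP (conj (le_trans as_ su) (le_trans us sb))).
    lra.
  lra.
have bE : b = a + 4 * l by rewrite /l; field.
(* Since [df m] has slope at least [c], its sign at the midpoint [x] decides: it is at least [c * l]
   on the last quarter, or at most [- (c * l)] on the first one. The induction hypothesis applies to
   [df] or to its negative there. *)
have [xp|xn] := leP 0 (df m x).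
  have := IH (a + 3 * l) b (c * l) N df.
  have -> : b - (a + 3 * l) = l by lra.
  apply; first lra.
  - by apply: (jets_le _ m.+1) => //; apply: jets_subset hj; apply: itv_cc_subset; lra.
  - by move=> s /andP[? ?]; apply: h0; apply/andP; split; lra.
  - move=> s /andP[s1 s2]; have := inc x s; rewrite /x => H.
    have : c * (s - (a + 2 * l)) <= df m s - df m (a + 2 * l) by apply: H; lra.
    have : c * l <= c * (s - (a + 2 * l)) by apply: ler_wpM2l; lra.
    by rewrite -/x; lra.
have := IH a (a + l) (c * l) N (fun k u => -1 * df k u + 0 * df k u).
have -> : a + l - a = l by lra.
apply; first lra.
- move=> k km; have hk : der_in `[a, a + l] (df k) (df k.+1).
    by apply: der_in_subset (hj k (ltnW km)); apply: itv_cc_subset; lra.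
  exact: der_in_lin.
- move=> s /andP[? ?]; rewrite mul0r addr0 mulN1r normrN; apply: h0; apply/andP; split; lra.
- move=> s /andP[s1 s2]; have := inc s x; rewrite /x => H.
  have : c * (a + 2 * l - s) <= df m (a + 2 * l) - df m s by apply: H; lra.
  have : c * l <= c * (a + 2 * l - s) by apply: ler_wpM2l; lra.
  by rewrite -/x; lra.
Qed.

(** The bound [C] is chosen before the signal. This uniformity makes [gbar] finite, bounds the
    spline parameters, and fixes a common step length. *)
Lemma derivatives_bound (N T : R) : 0 <= N -> 0 < T -> forall m (L : R), 0 <= L ->
  exists2 C : R, 0 <= C & forall df,
  jets `[0, T] m df -> lip_in `[0, T] L (df m) -> (forall s, 0 <= s <= T -> `|df 0%N s| <= N) ->
  forall k s, (k <= m)%N -> 0 <= s <= T -> `|df k s| <= C.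
Proof.
move=> N0 T0; elim=> [|m IH] L L0.
  by exists N => // df _ _ h k s; rewrite leqn0 => /eqP ->; exact: h.
have [K K0 hK] := top_derivative_bound m.+1.
(* If [df m.+1] exceeded [C1] at one point, its Lipschitz bound would keep it above
   [K * N / T ^+ m.+1 + 1] on all of [[0, T]], against [top_derivative_bound]. Then [C1] is the
   Lipschitz constant for the next lower order. *)
pose C1 := L * T + (K * N / T ^+ m.+1 + 1).
have Tm : 0 < T ^+ m.+1 by rewrite exprn_gt0.
have q0 : 0 <= K * N / T ^+ m.+1 by rewrite divr_ge0 ?mulr_ge0 // ltW.
have C10 : 0 <= C1 by rewrite /C1; have := mulr_ge0 L0 (ltW T0); lra.
have [C C0 hC] := IH C1 C10.
exists (Num.max C C1); first by rewrite le_max C0.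
move=> df hj hl h0.
have half df' s : jets `[0, T] m.+1 df' -> lip_in `[0, T] L (df' m.+1) ->
   (forall s, 0 <= s <= T -> `|df' 0%N s| <= N) -> 0 <= s <= T -> df' m.+1 s <= C1.
  move=> hj' hl' h0' sT; rewrite leNgt; apply/negP => H.
  have := hK 0 T (K * N / T ^+ m.+1 + 1) N df' (ltW T0) hj' h0'.
  rewrite subr0 mulrDl divfK ?gt_eqF // mul1r => H1.
  suff : K * N + T ^+ m.+1 <= K * N by rewrite gerDl leNgt Tm.
  apply: H1 => u uT.
  have := hl' u s uT sT; rewrite ler_norml => /andP[H1 _].
  have : L * `|u - s| <= L * T.
    by apply: ler_wpM2l => //; rewrite ler_norml; move: uT sT => /andP[? ?] /andP[? ?]; apply/andP; split; lra.
  by move: H; rewrite /C1; lra.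
have top s : 0 <= s <= T -> `|df m.+1 s| <= C1.
  move=> sT; rewrite ler_norml lerNl; apply/andP; split; last exact: half.
  have := half (fun k u => -1 * df k u + 0 * df k u) s.
  rewrite mul0r addr0 mulN1r; apply => //.
  - by move=> k km; have hk := hj k km; exact: der_in_lin.
  - by move=> x y xT yT; rewrite !mul0r !addr0 !mulN1r -opprD normrN; exact: hl.
  - by move=> x xT; rewrite mul0r addr0 mulN1r normrN; exact: h0.
move=> k s; rewrite leq_eqVlt => /orP[/eqP ->|km] sT; rewrite le_max.
  by rewrite top ?orbT.
rewrite (hC df) //; first exact: jets_le hj.
apply: der_in_lip; first exact: hj.
exact: top.
Qed.

End Landau.

(** * Best accuracy, and the interval of optimal outputs *)

Section BestAccuracy.
Context {R : realType}.
Implicit Types (f g h u : R -> R) (m k : nat) (L N T : R).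

Definition gbarR m L N k T : R := fine (gbar m L N k T).

Lemma G_derivatives_bound m L N T : 0 <= L -> 0 <= N -> 0 < T ->
  exists2 C : R, 0 <= C & forall g, G m L N T g ->
    forall k s, (k <= m)%N -> 0 <= s <= T -> `|half_deriven k g s| <= C.
Proof.
move=> L0 N0 T0; have [C C0 hC] := derivatives_bound N T N0 T0 m L L0.
exists C => // g [Fg gN]; apply: (hC (fun k => half_deriven k g)) => //.
- by apply: jets_subset (F_jets m L g Fg) => x /=; rewrite !in_itv /= => /andP[->].
- move=> s t /=; rewrite !in_itv /= => /andP[s0 _] /andP[t0 _].
  by apply: (F_lip m L g) => //; rewrite /= in_itv /= andbT.
Qed.

Lemma G_zero m L N T : 0 <= L -> 0 <= N -> G m L N T (fun=> 0).
Proof. by move=> L0 N0; split; [case: (F_zero m L L0)|move=> t _; rewrite normr0]. Qed.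

(** Finite by the Landau bound, nonnegative because the zero signal competes. From here on the real
    number [gbarR] replaces the extended one. *)
Lemma gbarE m L N k T : (k <= m)%N -> 0 <= L -> 0 <= N -> 0 < T ->
  gbar m L N k T = (gbarR m L N k T)%:E /\ 0 <= gbarR m L N k T.
Proof.
move=> km L0 N0 T0; have [C C0 hC] := G_derivatives_bound m L N T L0 N0 T0.
have le : (gbar m L N k T <= C%:E)%E.
  apply/ereal_supP => _ [g Gg <-]; rewrite lee_fin.
  by apply: (le_trans (ler_norm _)); apply: hC => //; rewrite ltW //= lexx.
have ge : (0%:E <= gbar m L N k T)%E.
  apply: ereal_sup_ubound; exists (fun=> 0); first exact: G_zero.
  by have [_ ->] := F_zero m L L0 => //; exact: ltW.
have fin : gbar m L N k T \is a fin_num.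
  by rewrite fin_numE; apply/andP; split; apply/eqP => E; move: ge le; rewrite E.
by split; [rewrite /gbarR fineK|rewrite /gbarR -lee_fin fineK].
Qed.

Lemma gbarR_ub m L N k T g : (k <= m)%N -> 0 <= L -> 0 <= N -> 0 < T ->
  G m L N T g -> `|half_deriven k g T| <= gbarR m L N k T.
Proof.
move=> km L0 N0 T0 Gg; have [E _] := gbarE m L N k T km L0 N0 T0.
have ub g' : G m L N T g' -> half_deriven k g' T <= gbarR m L N k T.
  by move=> G'; rewrite -lee_fin -E; apply: ereal_sup_ubound; exists g'.
rewrite ler_norml lerNl; apply/andP; split; last exact: ub.
have [Fg gN] := Gg; have [F' E'] := F_scale m L (-1) g L0 Fg.
have := ub (fun s => -1 * g s); rewrite E' // ?(ltW T0) // mulN1r; apply; split.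
  by move: F'; rewrite normrN1 mul1r.
by move=> t tT; rewrite mulN1r normrN; exact: gN.
Qed.

Lemma gbarR_le m L N k T c : (k <= m)%N -> 0 <= L -> 0 <= N -> 0 < T ->
  (forall g, G m L N T g -> half_deriven k g T <= c) -> gbarR m L N k T <= c.
Proof.
move=> km L0 N0 T0 h; have [E _] := gbarE m L N k T km L0 N0 T0.
by rewrite -lee_fin -E; apply/ereal_supP => _ [g Gg <-]; rewrite lee_fin; exact: h.
Qed.

(** Shifting the final window [[T - t, T]] to the origin turns a competitor for [T] into one for
    [t]. This is why a bound at time [t] covers all later times, in accuracy and in robustness. *)
Lemma gbarR_anti m L N k t T : (k <= m)%N -> 0 <= L -> 0 <= N -> 0 < t -> t <= T ->
  gbarR m L N k T <= gbarR m L N k t.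
Proof.
move=> km L0 N0 t0 tT; apply: gbarR_le => //; first exact: lt_le_trans tT.
move=> g [Fg gN]; have Tt0 : 0 <= T - t by rewrite subr_ge0.
have [F' E'] := F_shift m L (T - t) g L0 Tt0 Fg.
rewrite (_ : half_deriven k g T = half_deriven k (fun s => g (s + (T - t))) t); last first.
  by rewrite E' // ?(ltW t0) // addrC subrK.
apply: (le_trans (ler_norm _)); apply: gbarR_ub => //; split => // s /andP[s0 st].
by apply: gN; apply/andP; split; lra.
Qed.

Lemma gbarR_scale m L N k T (a : R) : (k <= m)%N -> 0 <= L -> 0 <= N -> 0 < T -> 0 < a ->
  a * gbarR m L N k T <= gbarR m (a * L) (a * N) k T.
Proof.
move=> km L0 N0 T0 a0; rewrite mulrC -ler_pdivlMr //; apply: gbarR_le => // g [Fg gN].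
have [F' E'] := F_scale m L a g L0 Fg.
rewrite ler_pdivlMr // mulrC -E' // ?(ltW T0) //; apply: (le_trans (ler_norm _)); apply: gbarR_ub => //.
- by rewrite mulr_ge0 // ltW.
- by rewrite mulr_ge0 // ltW.
split; first by rewrite gtr0_norm in F'.
by move=> s sT; rewrite normrM gtr0_norm // ler_pM2l //; exact: gN.
Qed.

Lemma norm_uptoP u T N : (norm_upto u T <= N%:E)%E <-> forall s, 0 <= s <= T -> `|u s| <= N.
Proof.
split => [/ereal_supP h s sT|h].
  by rewrite -lee_fin; apply: h; exists s.
by apply/ereal_supP => _ [s sT <-]; rewrite lee_fin; exact: h.
Qed.

Lemma consistentP m L N u T h : consistent m L N u T h <->
  F m L h /\ forall s, 0 <= s <= T -> `|h s - u s| <= N.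
Proof. by split=> -[Fh /norm_uptoP hN]; split. Qed.

Lemma consistent_diff m L N u T k h1 h2 : (k <= m)%N -> 0 <= L -> 0 <= N -> 0 < T ->
  consistent m L N u T h1 -> consistent m L N u T h2 ->
  `|half_deriven k h1 T - half_deriven k h2 T| <= 2 * gbarR m L N k T.
Proof.
move=> km L0 N0 T0 /consistentP[F1 u1] /consistentP[F2 u2].
have [F' E'] := F_lin m L L (1/2) (-(1/2)) h1 h2 L0 L0 F1 F2.
have h0 : (0 : R) <= 1 / 2 by lra.
have := gbarR_ub m L N k T (fun s => 1 / 2 * h1 s + - (1 / 2) * h2 s) km L0 N0 T0.
rewrite E' // ?(ltW T0) // => H.
have -> : half_deriven k h1 T - half_deriven k h2 T =
   2 * (1 / 2 * half_deriven k h1 T + - (1 / 2) * half_deriven k h2 T) by field.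
rewrite normrM ger0_norm // ler_pM2l //; apply: H; split.
  by move: F'; rewrite normrN ger0_norm // (_ : 1 / 2 * L + 1 / 2 * L = L) //; field.
move=> s sT; have := u1 s sT; have := u2 s sT; rewrite !ler_norml => /andP[? ?] /andP[? ?].
by apply/andP; split; lra.
Qed.

Lemma mem_JP m L N k u T (y : R) : (k <= m)%N -> 0 <= L -> 0 <= N -> 0 < T ->
  J m L N k u T y <-> forall h, consistent m L N u T h -> `|half_deriven k h T - y| <= gbarR m L N k T.
Proof.
move=> km L0 N0 T0; have [E _] := gbarE m L N k T km L0 N0 T0.
rewrite /J; case: asboolP => [_|n0]; last first.
  by split => // _ h hc; exfalso; apply: n0; exists h.
rewrite /= E; split.
  move=> /andP[]; rewrite leeBlDr // => /ereal_supP H1; rewrite -leeBlDr // => /ereal_infP H2 h hc.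
  have := H1 _ (ex_intro2 _ _ h hc erefl); have := H2 _ (ex_intro2 _ _ h hc erefl).
  by rewrite -EFinB -EFinD !lee_fin ler_norml => ? ?; apply/andP; split; lra.
move=> H; apply/andP; split.
  rewrite leeBlDr //; apply/ereal_supP => _ [h hc <-]; have := H h hc.
  by rewrite -EFinD lee_fin ler_norml => /andP[_]; lra.
rewrite -leeBlDr //; apply/ereal_infP => _ [h hc <-]; have := H h hc.
by rewrite -EFinB lee_fin ler_norml => /andP[]; lra.
Qed.

Definition consistent_values m L N k u T : set R :=
  [set half_deriven k h T | h in consistent m L N u T].

Lemma consistent_values_bnd m L N k u T : (k <= m)%N -> 0 <= L -> 0 <= N -> 0 < T ->
  consistent m L N u T !=set0 ->
  [/\ has_sup (consistent_values m L N k u T), has_inf (consistent_values m L N k u T) &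
   sup (consistent_values m L N k u T) - gbarR m L N k T <= inf (consistent_values m L N k u T) + gbarR m L N k T].
Proof.
move=> km L0 N0 T0 [h0 h0c]; set V := consistent_values _ _ _ _ _ _.
have V0 : V !=set0 by exists (half_deriven k h0 T), h0.
have d x y : V x -> V y -> x - y <= 2 * gbarR m L N k T.
  move=> [h1 c1 <-] [h2 c2 <-].
  by apply: (le_trans (ler_norm _)); exact: consistent_diff c1 c2.
have [x0 Vx0] := V0.
have hs : has_sup V by split => //; exists (x0 + 2 * gbarR m L N k T) => x Vx; have := d x x0 Vx Vx0; lra.
have hi : has_inf V by split => //; exists (x0 - 2 * gbarR m L N k T) => x Vx; have := d x0 x Vx0 Vx; lra.
split => //.
suff : sup V - 2 * gbarR m L N k T <= inf V by lra.
apply: lb_le_inf => // y Vy; rewrite lerBlDr; apply: ge_sup => // x Vx.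
by have := d x y Vx Vy; lra.
Qed.

Lemma J_itv m L N k u T : (k <= m)%N -> 0 <= L -> 0 <= N -> 0 < T ->
  consistent m L N u T !=set0 ->
  J m L N k u T = `[sup (consistent_values m L N k u T) - gbarR m L N k T,
                    inf (consistent_values m L N k u T) + gbarR m L N k T]%classic.
Proof.
move=> km L0 N0 T0 c0; have [hs hi _] := consistent_values_bnd m L N k u T km L0 N0 T0 c0.
apply/seteqP; split => y.
  move=> /(mem_JP m L N k u T y km L0 N0 T0) H; rewrite /= in_itv /=; apply/andP; split.
    rewrite lerBlDr; apply: ge_sup; first by case: hs.
    by move=> _ [h hc <-]; have := H h hc; rewrite ler_norml => /andP[_]; lra.
  rewrite -lerBlDr; apply: lb_le_inf; first by case: hi.
  by move=> _ [h hc <-]; have := H h hc; rewrite ler_norml => /andP[]; lra.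
rewrite /= in_itv /= => /andP[y1 y2]; apply/(mem_JP m L N k u T y km L0 N0 T0) => h hc.
have V : consistent_values m L N k u T (half_deriven k h T) by exists h.
have : half_deriven k h T <= sup (consistent_values m L N k u T).
  by apply: ub_le_sup => //; case: hs.
have : inf (consistent_values m L N k u T) <= half_deriven k h T.
  by apply: ge_inf => //; case: hi.
by rewrite ler_norml => ? ?; apply/andP; split; lra.
Qed.

Lemma J_nonempty m L N k u T : (k <= m)%N -> 0 <= L -> 0 <= N -> 0 < T ->
  J m L N k u T !=set0.
Proof.
move=> km L0 N0 T0; have [c0|n0] := pselect (consistent m L N u T !=set0); last first.
  by exists 0; apply/mem_JP => // h hc; exfalso; apply: n0; exists h.
rewrite J_itv //; have [_ _ ?] := consistent_values_bnd m L N k u T km L0 N0 T0 c0.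
by exists (sup (consistent_values m L N k u T) - gbarR m L N k T); rewrite /= in_itv /= lexx /=.
Qed.

End BestAccuracy.

(** * Optimality as membership in the interval, and the midpoint differentiator *)

Section Differentiators.
Context {R : realType} (m : nat).
Implicit Types (D : differentiator R m) (i : 'I_m) (L N : R).

Lemma F_E_inputs L N f eta : 0 <= L -> 0 <= N -> F m L f -> E N eta -> @inputs R (f \+ eta).
Proof. by move=> L0 N0 Ff Ee; exists m, L, N; split => //; exists f => //; exists eta. Qed.

(** The true signal [f] is itself consistent with [f + eta] at every [tau], so the error at [tau] is
    at most [gbar] at [tau], which is at most [gbar] at [t]. *)
Lemma best_of_mem_J D L N : 0 <= L -> 0 <= N ->
  (forall u (t : R) i, inputs u -> 0 < t -> J m L N i.+1 u t (D u t ord0 i)) ->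
  best_worst_case_error D L N.
Proof.
move=> L0 N0 h Rb Rb0 t i t0; have [E _] := gbarE m L N i.+1 t (ltn_ord i) L0 N0 t0.
rewrite E; apply/ereal_supP => _ [f [Ff _] [eta Ee <-]].
apply/ereal_supP => _ [tau ttau <-]; rewrite lee_fin.
have {}ttau : t <= tau by move: ttau; rewrite /= in_itv /= andbT.
have tau0 : 0 < tau by exact: lt_le_trans ttau.
apply: le_trans (gbarR_anti m L N i.+1 t tau (ltn_ord i) L0 N0 t0 ttau).
apply: (iffLR (mem_JP m L N i.+1 (f \+ eta) tau _ (ltn_ord i) L0 N0 tau0)).
  by apply: h => //; exact: F_E_inputs Ff Ee.
apply/consistentP; split => // s /andP[s0 _].
by rewrite /= opprD addrA subrr sub0r normrN; exact: Ee.
Qed.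

(** Any signal [h] consistent with [u] up to time [t] might be the true one, and a causal
    differentiator cannot tell the difference at time [t]. *)
Lemma mem_J_of_best D L N u t i : 0 <= L -> 0 <= N -> causal D -> best_worst_case_error D L N ->
  inputs u -> 0 < t -> J m L N i.+1 u t (D u t ord0 i).
Proof.
move=> L0 N0 cD bD iu t0; apply/mem_JP => // h /consistentP[Fh hN].
(* After [t] nothing bounds [u - h], so the noise is cut off there; causality makes the output at
   [t] the same as for [u]. *)
pose eta s := if s <= t then u s - h s else 0.
have Ee : E N eta.
  move=> s s0; rewrite /eta; case: (leP s t) => st; last by rewrite normr0.
  by rewrite distrC; apply: hN; rewrite s0.
have -> : D u t = D (h \+ eta) t.
  apply: cD => //; [exact: F_E_inputs Fh Ee|exact: ltW|].
  by move=> s /andP[_ st]; rewrite /= /eta st addrC subrK.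
have [E _] := gbarE m L N i.+1 t (ltn_ord i) L0 N0 t0.
(* The initial bounds are taken from [h] itself, which places it in the restricted class. *)
have := bD (fun j => `|half_deriven j h 0|) (fun j => normr_ge0 _) t i t0.
rewrite E => /ereal_supP H; rewrite -lee_fin.
have := H _ (ex_intro2 _ _ h (conj Fh (fun j => lexx _)) (ex_intro2 _ _ eta Ee erefl)).
move=> /ereal_supP; apply; exists t => //.
by rewrite /= in_itv /= lexx.
Qed.

Lemma robustness_zero D S i (t C e0 : R) : S !=set0 -> 0 < e0 -> 0 <= C ->
  (forall e u eta tau, 0 < e -> e < e0 -> S u -> E e eta -> t <= tau ->
     `|D u tau ord0 i - D (u \+ eta) tau ord0 i| <= C * e) ->
  robustness D S i t = 0%E.
Proof.
move=> [u0 Su0] e00 C0 h; apply: cvg_lim => //.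
apply: (@squeeze_cvge _ _ _ _ (cst 0%E) _ (fun e => (C * e)%:E)).
- near=> e.
  have epos : 0 < e by near: e; exact: nbhs_right_gt.
  have elt : e < e0 by near: e; exact: nbhs_right_lt.
  apply/andP; split.
    (* The lower bound needs a member of [S], since the supremum of an empty family is -oo; [u0]
       with zero noise serves. *)
    apply: (@le_trans _ _ (`|D u0 t ord0 i - D (u0 \+ (fun=> 0)) t ord0 i|%:E)); first by rewrite lee_fin.
    apply: le_trans; last first.
      apply: ereal_sup_ubound; exists u0 => //; exists (fun=> 0); last reflexivity.
      by move=> s _; rewrite normr0 ltW.
    by apply: ereal_sup_ubound; exists t => //; rewrite /= in_itv /= lexx.
  apply/ereal_supP => _ [u Su [eta Ee <-]]; apply/ereal_supP => _ [tau ttau <-].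
  by rewrite lee_fin; apply: h => //; move: ttau; rewrite /= in_itv /= andbT.
- exact: cvg_cst.
- apply: cvg_EFin; first exact: nearW.
  rewrite -[X in _ --> X](mulr0 C); apply: cvgM; first exact: cvg_cst.
  exact: cvg_at_right_filter.
Unshelve. all: end_near. Qed.

Lemma midpoint_causal L N : causal (midpoint_differentiator m L N).
Proof.
move=> u1 u2 t _ _ _ eu.
have E i : J m L N i.+1 u1 t = J m L N i.+1 u2 t.
  rewrite /J; suff -> : consistent m L N u1 t = consistent m L N u2 t by [].
  apply/seteqP; split => h /consistentP[Fh H]; apply/consistentP; split => // s st.
    by rewrite -eu //; exact: H.
  by rewrite eu //; exact: H.
by apply/rowP => i; rewrite [LHS]mxE [RHS]mxE E.
Qed.

(** The two shifts by [gbar] cancel. Robustness thus reduces to following the extreme consistent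
    values when the input changes. *)
Lemma midpointE L N u t i : 0 <= L -> 0 <= N -> 0 < t -> consistent m L N u t !=set0 ->
  midpoint_differentiator m L N u t ord0 i =
  (sup (consistent_values m L N i.+1 u t) + inf (consistent_values m L N i.+1 u t)) / 2.
Proof.
move=> L0 N0 t0 c0; have [_ _ le] := consistent_values_bnd m L N i.+1 u t (ltn_ord i) L0 N0 t0 c0.
rewrite mxE /= (J_itv m L N i.+1 u t (ltn_ord i) L0 N0 t0 c0) asboolT.
  by rewrite inf_itvcc // sup_itvcc //; lra.
by split => //; split.
Qed.

Lemma midpoint_best L N : 0 <= L -> 0 <= N -> best_worst_case_error (midpoint_differentiator m L N) L N.
Proof.
move=> L0 N0; apply: best_of_mem_J => // u t i _ t0.
have [c0|n0] := pselect (consistent m L N u t !=set0); last first.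
  by apply/mem_JP => // h hc; exfalso; apply: n0; exists h.
have [_ _ le] := consistent_values_bnd m L N i.+1 u t (ltn_ord i) L0 N0 t0 c0.
by rewrite midpointE // (J_itv m L N i.+1 u t (ltn_ord i) L0 N0 t0 c0) /= in_itv /=; apply/andP; split; lra.
Qed.

Lemma sup_close (A B : set R) r : has_sup A -> has_sup B ->
  (forall x, A x -> exists2 y, B y & `|x - y| <= r) -> sup A <= sup B + r.
Proof.
move=> [A0 _] [_ hB] h; apply: ge_sup => // x /h[y By].
by rewrite ler_norml => /andP[_ xy]; have := ub_le_sup hB By; lra.
Qed.

Lemma inf_close (A B : set R) r : has_inf A -> has_inf B ->
  (forall x, A x -> exists2 y, B y & `|x - y| <= r) -> inf B - r <= inf A.
Proof.
move=> [A0 _] [_ hB] h; apply: lb_le_inf => // x /h[y By].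
by rewrite ler_norml => /andP[xy _]; have := ge_inf hB By; lra.
Qed.

(* Moving a consistent [h] towards the strictly consistent [f] by the fraction [e / delta]
   restores consistency after a perturbation of the input of size [e]. *)
Lemma consistent_transfer L N (delta e : R) u1 u2 f t k h : (k <= m)%N ->
  0 <= L -> 0 <= N -> 0 < t -> 0 < delta -> 0 < e -> e < delta ->
  F m L f -> (forall s, 0 <= s <= t -> `|u1 s - u2 s| <= e) ->
  (forall s, 0 <= s <= t -> `|f s - u1 s| <= N - delta) \/
  (forall s, 0 <= s <= t -> `|f s - u2 s| <= N - delta) ->
  consistent m L N u1 t f ->
  consistent m L N u1 t h -> exists2 h', consistent m L N u2 t h' &
   `|half_deriven k h t - half_deriven k h' t| <= 2 * (e / delta) * gbarR m L N k t.
Proof.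
move=> km L0 N0 t0 d0 e0 ed Ff u12 fu cf ch; have [Fh hN] := iffLR (consistentP _ _ _ _ _ _) ch.
pose a := e / delta.
have a0 : 0 <= a by rewrite divr_ge0 // ltW.
have a1 : a <= 1 by rewrite ler_pdivrMr // mul1r ltW.
have ad : a * delta = e by rewrite divfK // gt_eqF.
rewrite -/a; clearbody a.
have [F' E'] := F_convex m L a h f L0 (introT andP (conj a0 a1)) Fh Ff.
exists (fun s => (1 - a) * h s + a * f s).
  apply/consistentP; split => // s st.
  have b1 : 0 <= 1 - a by lra.
  have H1 := u12 s st; have H2 := hN s st.
  have cvx x y p q : `|x| <= p -> `|y| <= q -> `|(1 - a) * x + a * y| <= (1 - a) * p + a * q.
    move=> xp yq; apply: (le_trans (ler_normD _ _)); rewrite !normrM (ger0_norm a0) (ger0_norm b1).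
    by apply: lerD; exact: ler_wpM2l.
  (* First case: mixing leaves slack [a * delta = e] with respect to [u1], which absorbs the change
     of input. Second case: [h] is within [N + e] of [u2], and [(1 - a) * (N + e) + a * (N - delta)
     = N - a * e]. *)
  case: fu => H3; have {}H3 := H3 s st.
    have -> : (1 - a) * h s + a * f s - u2 s =
       ((1 - a) * (h s - u1 s) + a * (f s - u1 s)) + (u1 s - u2 s) by ring.
    by apply: (le_trans (ler_normD _ _)); have := cvx _ _ _ _ H2 H3; nra.
  have H4 : `|h s - u2 s| <= N + e.
    have -> : h s - u2 s = (h s - u1 s) + (u1 s - u2 s) by ring.
    by apply: (le_trans (ler_normD _ _)); exact: lerD.
  have -> : (1 - a) * h s + a * f s - u2 s =
       ((1 - a) * (h s - u2 s) + a * (f s - u2 s)) by ring.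
  by have := cvx _ _ _ _ H4 H3; nra.
rewrite E' // ?(ltW t0) //.
have -> : half_deriven k h t - ((1 - a) * half_deriven k h t + a * half_deriven k f t) =
   a * (half_deriven k h t - half_deriven k f t) by ring.
rewrite normrM (ger0_norm a0) [leRHS](_ : _ = a * (2 * gbarR m L N k t)); last by ring.
apply: ler_wpM2l => //.
exact: consistent_diff ch cf.
Qed.

(** With noise at most [N - delta], the true signal is strictly consistent. Consistent values then
    transfer between the two inputs, in both directions, with an error proportional to [e], so
    supremum, infimum and midpoint move by no more than that. *)
Lemma midpoint_robust L N (delta : R) : 0 <= L -> 0 < delta <= N ->
  robust_almost_from_beginning (midpoint_differentiator m L N) (FE m L (N - delta)).
Proof.
move=> L0 /andP[d0 dN] t i t0; have N0 : 0 <= N by lra.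
have [_ g0] := gbarE m L N i.+1 t (ltn_ord i) L0 N0 t0.
apply: (@robustness_zero _ _ _ _ (2 * (gbarR m L N i.+1 t / delta)) delta) => //.
- exists ((fun=> 0) \+ (fun=> 0)); exists (fun=> 0); first by case: (F_zero m L L0).
  by exists (fun=> 0) => // s _; rewrite normr0 subr_ge0.
- by rewrite mulr_ge0 // divr_ge0 // ltW.
move=> e _ eta tau e0 ed [f Ff [eta1 E1 <-]] Ee ttau.
have tau0 : 0 < tau by exact: lt_le_trans ttau.
set u1 := f \+ eta1; set u2 := u1 \+ eta.
have f1 s : 0 <= s <= tau -> `|f s - u1 s| <= N - delta.
  by move=> /andP[s0 _]; rewrite /u1 /= opprD addrA subrr sub0r normrN; exact: E1.
have u12 s : 0 <= s <= tau -> `|u1 s - u2 s| <= e.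
  by move=> /andP[s0 _]; rewrite /u2 /= opprD addrA subrr sub0r normrN; exact: Ee.
clearbody u2; clearbody u1.
have c1 : consistent m L N u1 tau f.
  by apply/consistentP; split => // s /f1; lra.
have c2 : consistent m L N u2 tau f.
  apply/consistentP; split => // s st; have := f1 s st; have := u12 s st.
  have -> : f s - u2 s = (f s - u1 s) + (u1 s - u2 s) by ring.
  by move=> ? ?; apply: (le_trans (ler_normD _ _)); lra.
have [s1 i1 _] := consistent_values_bnd m L N i.+1 u1 tau (ltn_ord i) L0 N0 tau0 (ex_intro _ f c1).
have [s2 i2 _] := consistent_values_bnd m L N i.+1 u2 tau (ltn_ord i) L0 N0 tau0 (ex_intro _ f c2).
set r := 2 * (e / delta) * gbarR m L N i.+1 tau.
have k12 x : consistent_values m L N i.+1 u1 tau x ->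
    exists2 y, consistent_values m L N i.+1 u2 tau y & `|x - y| <= r.
  move=> [h hc <-].
  have [|h' hc' H] := @consistent_transfer L N delta e u1 u2 f tau i.+1 h (ltn_ord i) L0 N0 tau0 d0 e0 ed Ff u12 _ c1 hc; first by left.
  by exists (half_deriven i.+1 h' tau) => //; exists h'.
(* Strict consistency of [f] is known for [u1] only, so the transfer back uses the other alternative
   of [consistent_transfer]. *)
have k21 x : consistent_values m L N i.+1 u2 tau x ->
    exists2 y, consistent_values m L N i.+1 u1 tau y & `|x - y| <= r.
  have u21 s : 0 <= s <= tau -> `|u2 s - u1 s| <= e by rewrite distrC; exact: u12.
  move=> [h hc <-].
  have [|h' hc' H] := @consistent_transfer L N delta e u2 u1 f tau i.+1 h (ltn_ord i) L0 N0 tau0 d0 e0 ed Ff u21 _ c2 hc; first by right.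
  by exists (half_deriven i.+1 h' tau) => //; exists h'.
have e1 := midpointE L N u1 tau i L0 N0 tau0 (ex_intro _ f c1).
have e2 := midpointE L N u2 tau i L0 N0 tau0 (ex_intro _ f c2).
have A1 := sup_close _ _ _ s1 s2 k12; have A2 := sup_close _ _ _ s2 s1 k21.
have A3 := inf_close _ _ _ i1 i2 k12; have A4 := inf_close _ _ _ i2 i1 k21.
have rle : r <= 2 * (gbarR m L N i.+1 t / delta) * e.
  have -> : 2 * (gbarR m L N i.+1 t / delta) * e = 2 * (e / delta) * gbarR m L N i.+1 t by ring.
  apply: ler_wpM2l; first by rewrite mulr_ge0 // divr_ge0 // ltW.
  exact: gbarR_anti.
move: (midpoint_differentiator m L N) e1 e2 => D e1 e2.
by rewrite e1 e2 ler_norml {e1 e2}; apply/andP; split; lra.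
Qed.

End Differentiators.

(** * Sign patterns and splines *)

Section SignPatterns.
Context {R : realType}.
Implicit Types (f g : R -> R) (a b c : R) (l : seq R).

Definition incr (sg : R) f a b := forall s s', a <= s -> s <= s' -> s' <= b -> sg * f s <= sg * f s'.

Fixpoint knots a b l : Prop :=
  if l is c :: l' then a <= c <= b /\ knots c b l' else True.

(** Signs are weak and knots may coincide, so a list of length [n] encodes at most [n] sign changes
    while its length can still be counted exactly. *)
Fixpoint alt_sign l (sg : R) f a b : Prop :=
  if l is c :: l' then
    [/\ a <= c <= b, forall s, a < s < c -> 0 <= sg * f s & alt_sign l' (- sg) f c b]
  else forall s, a < s < b -> 0 <= sg * f s.

Fixpoint alt_mono l (sg : R) f a b : Prop :=
  if l is c :: l' then [/\ a <= c <= b, incr sg f a c & alt_mono l' (- sg) f c b]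
  else incr sg f a b.

Lemma alt_sign_knots l sg f a b : alt_sign l sg f a b -> knots a b l.
Proof. by elim: l sg a => [|c l IH] //= sg a [-> _ /IH]. Qed.

Lemma alt_sign_prefix l sg f a c b : a <= c -> c <= b -> (forall s, a < s <= c -> 0 <= sg * f s) ->
  alt_sign l sg f c b -> alt_sign l sg f a b.
Proof.
move=> ac cb h; case: l => [|d l] /=.
  by move=> H s /andP[as_ sb]; case: (leP s c) => sc; [apply: h|apply: H]; apply/andP.
move=> [/andP[cd db] H1 H2]; split => //; first by rewrite db andbT (le_trans ac).
by move=> s /andP[as_ sd]; case: (leP s c) => sc; [apply: h|apply: H1]; apply/andP.
Qed.

(** The threshold is the supremum of the points where [sg * f] is negative, with [a] adjoined to
    keep the set nonempty. *)
Lemma incr_threshold (sg : R) f a b : a <= b -> incr sg f a b ->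
  exists c, [/\ a <= c <= b, forall s, a < s < c -> 0 <= (- sg) * f s &
    forall s, c < s <= b -> 0 <= sg * f s].
Proof.
move=> ab h; pose A := [set s | a <= s <= b /\ (s = a \/ sg * f s < 0)].
have Aa : A a by split; [rewrite lexx|left].
have hs : has_sup A by split; [exists a|exists b => s [/andP[]]].
have ac : a <= sup A by apply: ub_le_sup => //; case: hs.
have cb : sup A <= b by apply: ge_sup; [exists a|move=> s [/andP[]]].
exists (sup A); split; first by rewrite ac.
- move=> s /andP[as_ sc]; rewrite mulNr oppr_ge0.
  have e0 : 0 < sup A - s by rewrite subr_gt0.
  have [x [/andP[ax xb] H]] := sup_adherent e0 hs.
  rewrite subKr => sx.
  case: H => [xa|fx]; first by move: as_ sx; rewrite xa; lra.
  by have := h s x (ltW as_) _ xb; lra.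
move=> s /andP[cs sb]; rewrite leNgt; apply/negP => fs.
have : s <= sup A by apply: ub_le_sup; [case: hs|split; [rewrite sb andbT; lra|right]].
by rewrite leNgt cs.
Qed.

(** Each monotone piece contains at most one sign change, so passing from slopes to values costs one
    switch. The next two lemmas save it: a zero at the right end fixes the sign on the last piece,
    and a further zero at the left end fixes it on the first. *)
Lemma alt_mono_sign l sg f a b : a <= b -> alt_mono l sg f a b ->
  exists2 l', size l' = (size l).+1 & alt_sign l' (- sg) f a b.
Proof.
elim: l sg a => [|c0 l IH] sg a ab /=.
  move=> /(incr_threshold _ _ _ _ ab)[c [cab h1 h2]]; exists [:: c] => //=; split => //.
  by rewrite opprK => s /andP[? ?]; apply: h2; apply/andP; split => //; exact: ltW.
move=> [/andP[ac cb] hi hM]; have [l' sl' hS] := IH _ _ cb hM.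
have [c [/andP[ac' cc0] h1 h2]] := incr_threshold _ _ _ _ ac hi.
exists (c :: l'); first by rewrite /= sl'.
split => //; first by rewrite ac' (le_trans cc0).
by apply: alt_sign_prefix cc0 cb _ hS; rewrite opprK.
Qed.

Lemma alt_mono_sign_right l sg f a b : a <= b -> f b = 0 -> alt_mono l sg f a b ->
  exists2 l', size l' = size l & alt_sign l' (- sg) f a b.
Proof.
move=> + fb; elim: l sg a => [|c0 l IH] sg a ab /=.
  move=> hi; exists [::] => //= s /andP[as_ sb].
  by have := hi s b (ltW as_) (ltW sb) (lexx _); rewrite fb mulr0; lra.
move=> [/andP[ac cb] hi hM]; have [l' sl' hS] := IH _ _ cb hM.
have [c [/andP[ac' cc0] h1 h2]] := incr_threshold _ _ _ _ ac hi.
exists (c :: l'); first by rewrite /= sl'.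
split => //; first by rewrite ac' (le_trans cc0).
by apply: alt_sign_prefix cc0 cb _ hS; rewrite opprK.
Qed.

Lemma alt_mono_sign_both c l sg f a b : f a = 0 -> f b = 0 -> alt_mono (c :: l) sg f a b ->
  exists2 l', size l' = size l & alt_sign l' sg f a b.
Proof.
move=> fa fb [/andP[ac cb] hi hM]; have [l' sl' hS] := alt_mono_sign_right _ _ _ _ _ cb fb hM.
exists l' => //; rewrite opprK in hS; apply: alt_sign_prefix ac cb _ hS => s /andP[as_ sc].
by have := hi a s (lexx _) (ltW as_) sc; rewrite fa mulr0.
Qed.

Lemma incr_derivative sg f f' a b : der_in `[a, b] f f' ->
  (forall s, a < s < b -> 0 <= sg * f' s) -> incr sg f a b.
Proof.
move=> hd h.
have inner s s' : a < s -> s <= s' -> s' < b -> sg * f s <= sg * f s'.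
  move=> as_ ss sb.
  have hd' : der_in `[s, s'] f f' by apply: der_in_subset hd; apply: itv_cc_subset; exact: ltW.
  have := mean_value_le s s' 0 (fun x => (- sg) * f x + 0 * f x) (fun x => (- sg) * f' x + 0 * f' x) ss.
  move=> /(_ (der_in_lin _ _ _ _ _ _ _ hd' hd')) H.
  have : - sg * f s' + 0 * f s' - (- sg * f s + 0 * f s) <= 0 * (s' - s); last lra.
  apply: H => x /andP[sx xs]; have := h x.
  by rewrite (lt_le_trans as_ sx) (le_lt_trans xs sb) => /(_ isT); lra.
have cont t e : a <= t <= b -> 0 < e -> exists2 d, 0 < d & forall s, a <= s <= b -> `|s - t| < d -> `|sg * f s - sg * f t| <= e.
  move=> tab e0; have k0 : 0 < `|sg| + 1 by rewrite ltr_wpDl.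
  have [d d0 hdd] := der_in_cont _ _ _ t (e / (`|sg| + 1)) hd tab (divr_gt0 e0 k0).
  exists d => // s sab sd; rewrite -mulrBr normrM.
  have := hdd s sab sd; rewrite ler_pdivlMr // mulrC mulrDl mul1r => H.
  by apply: le_trans H; rewrite lerDl.
(* The sign of the derivative is known in the open interval only, so the end values are reached by
   continuity. *)
have right s : a < s -> s < b -> sg * f s <= sg * f b.
  move=> as_ sb; apply/ler_addgt0Pr => e e0.
  have [|d d0 H] := cont b e _ e0; first by rewrite lexx andbT; lra.
  pose x := Num.max s (b - d / 2).
  have sx : s <= x by rewrite le_max lexx.
  have xb : x < b by rewrite gt_max sb /=; lra.
  have dx : b - d / 2 <= x by rewrite le_max lexx orbT.
  have := inner s x as_ sx xb; have := H x.
  rewrite (_ : `|x - b| = b - x); last by rewrite distrC ger0_norm // subr_ge0 ltW.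
  by rewrite ler_norml => /(_ _ _)/andP H' ?; have := H' (ltac:(lra)) (ltac:(lra)); lra.
have left s : a < s -> s < b -> sg * f a <= sg * f s.
  move=> as_ sb; apply/ler_addgt0Pr => e e0.
  have [|d d0 H] := cont a e _ e0; first by rewrite lexx /=; lra.
  pose x := Num.min s (a + d / 2).
  have sx : x <= s by rewrite ge_min lexx.
  have xb : a < x by rewrite lt_min as_ /=; lra.
  have dx : x <= a + d / 2 by rewrite ge_min lexx orbT.
  have := inner x s xb sx sb; have := H x.
  rewrite (_ : `|x - a| = x - a); last by rewrite ger0_norm // subr_ge0 ltW.
  by rewrite ler_norml => /(_ _ _)/andP H' ?; have := H' (ltac:(lra)) (ltac:(lra)); lra.
move=> s s' as_ ss sb.
have [->|ss'] := eqVneq s s'; first exact: lexx.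
have {}ss' : s < s' by rewrite lt_neqAle ss' ss.
have [<-|as'] := eqVneq a s; last first.
  have {}as' : a < s by rewrite lt_neqAle as' as_.
  have [->|sb'] := eqVneq s' b; first by apply: right => //; lra.
  by apply: inner => //; rewrite lt_neqAle sb' sb.
have [E|sb'] := eqVneq s' b; last first.
  by apply: left; [lra|rewrite lt_neqAle sb' sb].
have := left ((a + b) / 2); have := right ((a + b) / 2); rewrite E.
move=> H1 H2; apply: (@le_trans _ _ (sg * f ((a + b) / 2))); [apply: H2|apply: H1]; lra.
Qed.

Lemma alt_sign_mono l sg f f' a b : der_in `[a, b] f f' -> alt_sign l sg f' a b -> alt_mono l sg f a b.
Proof.
elim: l sg a => [|c l IH] sg a hd /=; first exact: incr_derivative.
move=> [/andP[ac cb] h1 h2]; split; first by rewrite ac.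
  by apply: incr_derivative h1; apply: der_in_subset hd; exact: itv_cc_subset.
by apply: IH h2; apply: der_in_subset hd; exact: itv_cc_subset.
Qed.

(* Repeated Rolle: each integration from a double zero at the endpoints removes one switch. *)
Lemma one_sign m d l sg a b : a < b -> jets `[a, b] m d ->
  (forall k, (k <= m)%N -> d k a = 0 /\ d k b = 0) -> size l = m.+1 -> alt_mono l sg (d m) a b ->
  forall s, a <= s <= b -> 0 <= sg * d 0%N s.
Proof.
move=> ab; elim: m l => [|m IH] [|c l] //= hj hz [sl] hM.
  have [d0a d0b] := hz 0%N isT.
  have [l'] := alt_mono_sign_both _ _ _ _ _ _ d0a d0b hM.
  rewrite sl => /size0nil -> /= h s /andP[as_ sb].
  have [<-|as'] := eqVneq a s; first by rewrite d0a mulr0.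
  have [->|sb'] := eqVneq s b; first by rewrite d0b mulr0.
  by apply: h; rewrite !lt_neqAle as' as_ sb' sb.
have [dma dmb] := hz m.+1 (leqnn _).
have [l' sl' hS] := alt_mono_sign_both _ _ _ _ _ _ dma dmb hM.
apply: (IH l'); first exact: jets_le hj.
- by move=> k km; apply: hz; exact: leqW.
- by rewrite sl'.
- exact: alt_sign_mono (hj m (leqnn _)) hS.
Qed.

(** Applied to differences, it identifies two functions with equal initial derivatives and equal
    [m]-th derivative. *)
Lemma jets_zero m d a b : a <= b -> jets `[a, b] m d -> (forall k, (k <= m)%N -> d k a = 0) ->
  (forall s, a <= s <= b -> d m s = 0) -> forall k s, (k <= m)%N -> a <= s <= b -> d k s = 0.
Proof.
move=> ab; elim: m => [|m IH] hj ha hm k s.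
  by rewrite leqn0 => /eqP -> /hm.
rewrite leq_eqVlt => /orP[/eqP -> /hm //|km] sab; apply: IH => //.
- exact: jets_le hj.
- by move=> j jm; apply: ha; exact: leqW.
move=> x /andP[ax xb].
have h : der_in `[a, x] (d m) (d m.+1) by apply: der_in_subset (hj m (leqnn _)); exact: itv_cc_subset.
have : `|d m x - d m a| <= 0 * (x - a).
  apply: mean_value_norm h _ => // y /andP[ay yx]; rewrite hm ?normr0 //.
  by rewrite ay (le_trans yx).
by rewrite (ha m (leqW (leqnn _))) subr0 mul0r normr_le0 => /eqP.
Qed.

Lemma jets_small m d (M : R) a b : a <= b -> 0 <= M -> jets `[a, b] m d ->
  (forall k, (k <= m)%N -> d k a = 0) -> lip_in `[a, b] M (d m) ->
  forall k s, (k <= m)%N -> a <= s <= b -> `|d k s| <= M * (b - a) ^+ (m.+1 - k).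
Proof.
move=> ab M0 hj ha hl.
have ba : 0 <= b - a by rewrite subr_ge0.
suff H j s : (j <= m)%N -> a <= s <= b -> `|d (m - j)%N s| <= M * (b - a) ^+ j.+1.
  move=> k s km sab; have := H (m - k)%N s (leq_subr _ _) sab.
  by rewrite subKn // subSn.
elim: j s => [|j IH] s jm sab.
  rewrite subn0 expr1; have aab : `[a, b]%classic a by rewrite /= in_itv /= lexx.
  have := hl s a sab aab; rewrite ha // subr0 => H; apply: (le_trans H).
  apply: ler_wpM2l => //; move: sab => /andP[as_ sb].
  by rewrite ger0_norm ?subr_ge0 // lerB.
have [as_ sb] := andP sab.
have E : (m - j = (m - j.+1).+1)%N by rewrite subnSK.
have h : der_in `[a, s] (d (m - j.+1)%N) (d (m - j)%N).
  rewrite E; apply: der_in_subset (hj (m - j.+1)%N _); first exact: itv_cc_subset.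
  by rewrite ltn_subrL (leq_ltn_trans _ jm).
have := mean_value_norm a s (M * (b - a) ^+ j.+1) _ _ as_ h.
rewrite ha ?leq_subr // subr0 => H.
apply: (@le_trans _ _ (M * (b - a) ^+ j.+1 * (s - a))).
  by apply: H => x /andP[ax xs]; apply: IH; [exact: ltnW|rewrite ax (le_trans xs)].
rewrite (exprSr _ j.+1) mulrA; apply: ler_wpM2l; last by rewrite lerB.
by rewrite mulr_ge0 // exprn_ge0.
Qed.

End SignPatterns.

(** * Perfect splines in closed form *)

Section Splines.
Context {R : realType}.
Implicit Types (a b c s : R) (l : seq R).

(** Normalised so that differentiation lowers the index, for truncated powers too; [tpow 0] is the
    unit step, equal to 1 at the jump. *)
Definition pw n (x : R) : R := x ^+ n / n`!%:R.
Definition tpow n (x : R) : R := if 0 <= x then pw n x else 0.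

(* For [l = [:: c_0; c_1; ...]] this is [tpow n (s - c_0) - tpow n (s - c_1) + ...], so that
   [1 - 2 * alt 0 l] is the step function that starts at 1 and changes sign at each knot. *)
Fixpoint alt n l s : R := if l is c :: l' then tpow n (s - c) - alt n l' s else 0.

Definition taylor n (c : nat -> R) s : R := \sum_(j < n) c j * pw j s.

(** The [k]-th derivative of a perfect spline: the Taylor polynomial with initial derivatives [c],
    plus the iterated integral of the step function [L * (1 - 2 * alt 0 l)]. Carrying [k] as an
    argument gives all derivatives up to order [m] in closed form. *)
Definition spl m (L : R) (c : nat -> R) l k s : R :=
  taylor (m.+1 - k) (fun j => c (k + j)%N) s + L * (pw (m.+1 - k) s - 2 * alt (m.+1 - k) l s).

Lemma pw0 x : pw 0 x = 1. Proof. by rewrite /pw expr0 divr1. Qed.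
Lemma pwS0 n : pw n.+1 0 = 0. Proof. by rewrite /pw expr0n mul0r. Qed.
Lemma pw1 x : pw 1 x = x. Proof. by rewrite /pw expr1 divr1. Qed.
Lemma tpow1E x : tpow 1 x = Num.max 0 x.
Proof. by rewrite /tpow pw1; case: leP. Qed.
Lemma tpow_le0 n x : x <= 0 -> tpow n.+1 x = 0.
Proof.
by rewrite /tpow => x0; case: leP => // x0'; rewrite (le_anti (introT andP (conj x0 x0'))) pwS0.
Qed.
Lemma tpow_ge0 n x : 0 <= x -> tpow n x = pw n x. Proof. by rewrite /tpow => ->. Qed.

Lemma pw_ge0 n x : 0 <= x -> 0 <= pw n x.
Proof. by move=> x0; rewrite divr_ge0 // exprn_ge0. Qed.

Lemma der_in_id (D : set R) : der_in D id (fun=> 1).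
Proof. by move=> t _ e e0; exists 1 => // s _ _; rewrite mul1r subrr normr0 mulr_ge0 // ltW. Qed.

Lemma der_in_pow (D : set R) c n : der_in D (fun s => (s - c) ^+ n.+1) (fun s => n.+1%:R * (s - c) ^+ n).
Proof.
have h1 : der_in D (fun s => s - c) (fun=> 1).
  have := der_in_lin D 1 (- c) id (fun=> 1) (fun=> 1) (fun=> 0) (der_in_id D) (der_in_cst D 1).
  by apply: der_in_eq => t _; ring.
elim: n => [|n IH].
  by apply: der_in_eq h1 => t _; rewrite ?expr1 // expr0 mulr1.
apply: der_in_eq (der_in_mul D _ _ _ _ h1 IH) => t _; first by rewrite -exprS.
by rewrite mul1r mulrCA -exprS -[n.+2]addn1 natrD; ring.
Qed.

Lemma der_in_scale (D : set R) (k : R) f f' : der_in D f f' -> der_in D (fun s => k * f s) (fun s => k * f' s).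
Proof.
by move=> h; apply: der_in_eq (der_in_lin D k 0 _ _ _ _ h h) => t _; rewrite mul0r addr0.
Qed.

Lemma der_in_add (D : set R) f f' g g' : der_in D f f' -> der_in D g g' ->
  der_in D (fun s => f s + g s) (fun s => f' s + g' s).
Proof.
by move=> h1 h2; apply: der_in_eq (der_in_lin D 1 1 _ _ _ _ h1 h2) => t _; rewrite !mul1r.
Qed.

Lemma der_in_subtract (D : set R) f f' g g' : der_in D f f' -> der_in D g g' ->
  der_in D (fun s => f s - g s) (fun s => f' s - g' s).
Proof.
by move=> h1 h2; apply: der_in_eq (der_in_lin D 1 (-1) _ _ _ _ h1 h2) => t _; rewrite mul1r mulN1r.
Qed.

Lemma der_in_pw (D : set R) c n : der_in D (fun s => pw n.+1 (s - c)) (fun s => pw n (s - c)).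
Proof.
apply: der_in_eq (der_in_scale D (n.+1`!%:R^-1) _ _ (der_in_pow D c n)) => t _; rewrite /pw.
  by rewrite mulrC.
rewrite factS natrM; field.
by rewrite -(natrD _ 1) !pnatr_eq0 -lt0n fact_gt0.
Qed.

Lemma der_in_pw_rev (D : set R) b n : der_in D (fun s => pw n.+1 (b - s)) (fun s => - pw n (b - s)).
Proof.
have pwN k (x : R) : pw k (- x) = (-1) ^+ k * pw k x by rewrite /pw [in LHS]exprNn mulrA.
apply: der_in_eq (der_in_scale D ((-1) ^+ n.+1) _ _ (der_in_pw D b n)) => t _.
  by rewrite -pwN opprB.
by rewrite exprS mulN1r mulNr -pwN opprB.
Qed.

Lemma der_in_glue (D : set R) c f1 f1' f2 f2' : f1 c = f2 c -> f1' c = f2' c ->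
  der_in D f1 f1' -> der_in D f2 f2' ->
  der_in D (fun s => if c <= s then f2 s else f1 s) (fun s => if c <= s then f2' s else f1' s).
Proof.
move=> fc fc' h1 h2 t Dt e e0.
have [d1 d10 H1] := h1 t Dt e e0; have [d2 d20 H2] := h2 t Dt e e0.
have [ct|tc|E] := ltgtP c t.
- exists (Num.min d2 (t - c)); first by rewrite lt_min d20 subr_gt0.
  move=> s Ds; rewrite lt_min => /andP[sd sc].
  rewrite ifT; first exact: H2.
  by move: sc; rewrite ltr_norml => /andP[]; lra.
- exists (Num.min d1 (c - t)); first by rewrite lt_min d10 subr_gt0.
  move=> s Ds; rewrite lt_min => /andP[sd sc].
  rewrite ifF; first exact: H1.
  by apply/negbTE; rewrite -ltNge; move: sc; rewrite ltr_norml => /andP[]; lra.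
exists (Num.min d1 d2); first by rewrite lt_min d10.
move=> s Ds; rewrite lt_min => /andP[sd1 sd2]; case: ifP => _; first exact: H2.
by rewrite -E -fc -fc' E; exact: H1.
Qed.

(** The index starts at 2 because [tpow 1] has a kink; accordingly the [m]-th derivative of a spline
    is only Lipschitz. *)
Lemma der_in_tpow (D : set R) c n : der_in D (fun s => tpow n.+2 (s - c)) (fun s => tpow n.+1 (s - c)).
Proof.
have := der_in_glue D c (fun=> 0) (fun=> 0) _ _ _ _ (der_in_cst D 0) (der_in_pw D c n.+1).
rewrite subrr !pwS0 => /(_ erefl erefl).
by apply: der_in_eq => t _; rewrite /tpow subr_ge0.
Qed.

Lemma der_in_alt (D : set R) l n : der_in D (alt n.+2 l) (alt n.+1 l).
Proof.
elim: l => [|c l IH] /=; first exact: der_in_cst.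
by apply: der_in_subtract => //; exact: der_in_tpow.
Qed.

Lemma der_in_taylor (D : set R) n (c : nat -> R) : der_in D (taylor n.+1 c) (taylor n (fun j => c j.+1)).
Proof.
elim: n => [|n IH].
  apply: der_in_eq (der_in_cst D (c 0%N)) => t _; rewrite /taylor ?big_ord0 //.
  by rewrite big_ord_recr big_ord0 /= add0r pw0 mulr1.
have hp : der_in D (fun s => c n.+1 * pw n.+1 s) (fun s => c n.+1 * pw n s).
  apply: der_in_scale; have := der_in_pw D 0 n.
  by apply: der_in_eq => t _; rewrite subr0.
by apply: der_in_eq (der_in_add D _ _ _ _ IH hp) => t _; rewrite /taylor [RHS]big_ord_recr.
Qed.

Lemma jets_spl (D : set R) m L (c : nat -> R) l : jets D m (spl m L c l).
Proof.
move=> k km; rewrite /spl subSn ?(ltnW km) // subSS -(subnSK km).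
apply: der_in_add.
  have := der_in_taylor D (m - k.+1).+1 (fun j => c (k + j)%N).
  by apply: der_in_eq => // t _; apply: eq_bigr => j _; rewrite addnS addSn.
apply: der_in_scale; apply: der_in_subtract; last by apply: der_in_scale; exact: der_in_alt.
have := der_in_pw D 0 (m - k.+1).+1.
by apply: der_in_eq => t _; rewrite subr0.
Qed.

Lemma knots_all a b l : knots a b l -> {in l, forall c, a <= c <= b}.
Proof.
elim: l a => [|c l IH] a //= [/andP[ac cb] hl] x; rewrite inE => /predU1P[->|xl].
  by rewrite ac.
by have /andP[cx ->] := IH c hl x xl; rewrite (le_trans ac).
Qed.

Lemma knots_sub a a' b b' l : a' <= a -> b <= b' -> knots a b l -> knots a' b' l.
Proof.
move=> aa bb; elim: l a a' aa => [|c l IH] a a' aa //= [/andP[ac cb] hl]; split.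
  by rewrite (le_trans aa) // (le_trans cb).
exact: IH hl.
Qed.

Lemma knots_cat a b c l1 l2 : a <= b -> b <= c -> knots a b l1 -> knots b c l2 -> knots a c (l1 ++ l2).
Proof.
move=> + bc; elim: l1 a => [|x l IH] a ab /=; first by move=> _; exact: knots_sub.
by move=> [/andP[ax xb] hl] h2; split; [rewrite ax (le_trans xb)|exact: IH].
Qed.

Lemma alt_le n l s : {in l, forall c, s <= c} -> alt n.+1 l s = 0.
Proof.
elim: l => [|c l IH] //= h; rewrite IH ?subr0 ?tpow_le0 ?subr_le0 // ?h ?mem_head //.
by move=> x xl; apply: h; rewrite inE xl orbT.
Qed.

Lemma alt_cat n l1 l2 s : alt n (l1 ++ l2) s = alt n l1 s + (-1) ^+ size l1 * alt n l2 s.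
Proof.
elim: l1 => [|c l IH] /=; first by rewrite add0r mul1r.
by rewrite IH exprS; ring.
Qed.

Lemma tpow1_incr c s s' : s <= s' -> 0 <= tpow 1 (s' - c) - tpow 1 (s - c).
Proof. by move=> ss; rewrite !tpow1E; case: (leP 0 (s' - c)) => ?; case: (leP 0 (s - c)) => ?; lra. Qed.

Lemma tpow1_incr_le c c' s s' : s <= s' -> c <= c' ->
  tpow 1 (s' - c') - tpow 1 (s - c') <= tpow 1 (s' - c) - tpow 1 (s - c).
Proof.
move=> ss cc; rewrite !tpow1E.
case: (leP 0 (s' - c')) => ?; case: (leP 0 (s - c')) => ?; case: (leP 0 (s' - c)) => ?;
  case: (leP 0 (s - c)) => ?; lra.
Qed.

(** As for an alternating series: the increment of [tpow 1 (s - c)] decreases in [c], so the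
    alternating sum over ordered knots lies between 0 and its largest possible first term. Hence
    [s - 2 * alt 1 l s] has slopes in [[-1, 1]]. *)
Lemma alt1_incr a b l s s' : s <= s' -> knots a b l ->
  0 <= alt 1 l s' - alt 1 l s <= tpow 1 (s' - a) - tpow 1 (s - a).
Proof.
move=> ss; elim: l a => [|c l IH] a /=.
  by move=> _; rewrite subrr lexx tpow1_incr.
move=> [/andP[ac cb] /IH /andP[h1 h2]].
by have := tpow1_incr_le a c s s' ss ac => H; apply/andP; split; lra.
Qed.

Lemma alt1_lip a b l s s' : s <= s' -> knots a b l ->
  `|(s' - 2 * alt 1 l s') - (s - 2 * alt 1 l s)| <= s' - s.
Proof.
move=> ss hl; have /andP[h1 h2] := alt1_incr a b l s s' ss hl.
have h3 : tpow 1 (s' - a) - tpow 1 (s - a) <= s' - s.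
  by rewrite !tpow1E; case: (leP 0 (s' - a)) => ?; case: (leP 0 (s - a)) => ?; lra.
by rewrite ler_norml; apply/andP; split; lra.
Qed.

Lemma alt1_after l a s : {in l, forall c, c <= a} -> a <= s ->
  (s - 2 * alt 1 l s) - (a - 2 * alt 1 l a) = (-1) ^+ size l * (s - a).
Proof.
elim: l => [|c l IH] /=; first by move=> _ _; rewrite mulr0 subr0 subr0 mul1r.
move=> h as_; have ca : c <= a by apply: h; rewrite mem_head.
have := IH (fun x xl => h x (mem_behead (s := c :: l) xl)) as_.
rewrite exprS !tpow_ge0 ?subr_ge0 ?(le_trans ca) // !pw1; lra.
Qed.

Lemma spl_top m L (c : nat -> R) l s : spl m L c l m s = c m + L * (s - 2 * alt 1 l s).
Proof.
by rewrite /spl subSnn /taylor big_ord_recl big_ord0 addr0 addn0 pw0 mulr1 pw1.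
Qed.

Lemma spl_lip (D : set R) m (L a b : R) (c : nat -> R) l : 0 <= L -> knots a b l -> lip_in D L (spl m L c l m).
Proof.
move=> L0 hl s t _ _; rewrite !spl_top.
wlog st : s t / s <= t.
  by move=> H; case/orP: (le_total s t) => st; [|rewrite distrC (distrC s)]; exact: H.
rewrite distrC (distrC s) (ger0_norm (_ : 0 <= t - s)) ?subr_ge0 //.
have -> : c m + L * (t - 2 * alt 1 l t) - (c m + L * (s - 2 * alt 1 l s)) =
  L * ((t - 2 * alt 1 l t) - (s - 2 * alt 1 l s)) by ring.
rewrite normrM (ger0_norm L0); apply: ler_wpM2l => //; exact: alt1_lip hl.
Qed.

Lemma taylor0 n (c : nat -> R) : taylor n.+1 c 0 = c 0%N.
Proof.
rewrite /taylor big_ord_recl /= pw0 mulr1 big1 ?addr0 // => j _.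
by rewrite /bump /= add1n pwS0 mulr0.
Qed.

(** Between knots the spline part has slope [L] or [- L], which dominates every slope of [G]; so
    spline minus signal, at order [m], is monotone with direction reversed at each knot. This is the
    input of [one_sign]. *)
Lemma alt_mono_spline (L : R) sg a b l G : 0 <= L -> `|sg| = 1 -> knots a b l -> lip_in `[a, b] L G ->
  forall f C, (forall s, a <= s <= b -> f s = C + sg * L * ((s - a) - 2 * alt 1 l s) - G s) ->
  a <= b -> alt_mono l sg f a b.
Proof.
move=> L0; elim: l sg a => [|c l IH] sg a sg1 /= hk hG f C hf ab.
  move=> s s' as_ ss sb.
  rewrite !hf ?as_ ?(le_trans ss sb) ?sb ?andbT ?(le_trans as_ ss) //=.
  have := hG s' s; rewrite /= !in_itv /= as_ sb (le_trans as_ ss) (le_trans ss sb) => /(_ isT isT).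
  rewrite (ger0_norm (_ : 0 <= s' - s)) ?subr_ge0 // => H.
  have : `|sg * (G s' - G s)| <= L * (s' - s) by rewrite normrM sg1 mul1r.
  rewrite ler_norml => /andP[_].
  have : sg * sg = 1 by rewrite -expr2 -real_normK ?num_real // sg1 expr1n.
  rewrite mulr0 !subr0; set x := G s'; set y := G s => E.
  have -> : sg * (C + sg * L * (s - a) - y) = sg * C + (sg * sg) * (L * (s - a)) - sg * y by ring.
  have -> : sg * (C + sg * L * (s' - a) - x) = sg * C + (sg * sg) * (L * (s' - a)) - sg * x by ring.
  by rewrite E; lra.
have [/andP[ac cb] hk'] := hk.
have zero s : s <= c -> alt 1 l s = 0.
  move=> sc; apply: alt_le => x xl.
  by have /andP[cx _] := knots_all c b l hk' x xl; exact: le_trans cx.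
split; first by rewrite ac.
  move=> s s' as_ ss sc.
  have sb := le_trans sc cb.
  rewrite !hf ?as_ ?(le_trans ss sb) ?sb ?andbT ?(le_trans as_ ss) //=.
  rewrite !zero ?(le_trans ss sc) // !tpow_le0 ?subr_le0 ?(le_trans ss sc) //.
  have := hG s' s; rewrite /= !in_itv /= as_ sb (le_trans as_ ss) (le_trans ss sb) => /(_ isT isT).
  rewrite (ger0_norm (_ : 0 <= s' - s)) ?subr_ge0 // => H.
  have : `|sg * (G s' - G s)| <= L * (s' - s) by rewrite normrM sg1 mul1r.
  rewrite ler_norml => /andP[_].
  have : sg * sg = 1 by rewrite -expr2 -real_normK ?num_real // sg1 expr1n.
  rewrite !subr0 mulr0 !subr0; set x := G s'; set y := G s => E.
  have -> : sg * (C + sg * L * (s - a) - y) = sg * C + (sg * sg) * (L * (s - a)) - sg * y by ring.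
  have -> : sg * (C + sg * L * (s' - a) - x) = sg * C + (sg * sg) * (L * (s' - a)) - sg * x by ring.
  by rewrite E; lra.
apply: (IH (- sg) c _ _ _ f (C + sg * L * (c - a))) => //; first by rewrite normrN.
- by move=> s t /= hs ht; apply: hG; [move: hs|move: ht]; apply: itv_cc_subset.
- move=> s /andP[cs sb]; rewrite hf; last by rewrite (le_trans ac).
  by rewrite tpow_ge0 ?subr_ge0 // pw1; ring.
Qed.

End Splines.

(** * Splines with prescribed derivatives at both ends of an interval *)

Section Integrals.
Context {R : realType}.
Implicit Types (f g F : R -> R) (a b c s : R) (l : seq R).
Local Notation mu := (@lebesgue_measure R).
Local Notation integ D f := (mu.-integrable D (EFin \o f)).

Lemma der_in_continuous f f' : der_in setT f f' -> continuous f.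
Proof.
move=> h x; apply/cvgrPdist_le => e e0; apply/nbhs_ballP.
have [d d0 hd] := der_in_cont _ _ _ x e h I e0.
by exists d => //= s; rewrite /ball /= distrC => sd; rewrite distrC; exact: hd.
Qed.

Lemma continuous_integ a b f : continuous f -> integ `[a, b] f.
Proof.
move=> cf; apply: continuous_compact_integrable; first exact: segment_compact.
exact: continuous_subspaceT.
Qed.

Lemma lebesgue_measure_oc (a b : R) : a <= b -> fine (mu `]a, b]%classic) = b - a.
Proof.
move=> ab; rewrite lebesgue_measure_itv /= lte_fin; case: ltP => //= ba.
by rewrite (le_anti (introT andP (conj ba ab))) subrr.
Qed.

Lemma Rintegral_near f a b C e : a <= b -> integ `]a, b] f ->
  (forall x, a < x <= b -> `|f x - C| <= e) ->
  `|\int[mu]_(x in `]a, b]) f x - C * (b - a)| <= e * (b - a).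
Proof.
move=> ab fi h.
have ic r : integ `]a, b] (fun=> r).
  apply: (@integrableS _ _ _ mu `[a, b]%classic) => //; last first.
    by apply: continuous_integ => x; exact: cvg_cst.
  exact: subset_itv_oc_cc.
have m1 : \int[mu]_(x in `]a, b]) (C - e) <= \int[mu]_(x in `]a, b]) f x.
  apply: le_Rintegral => // x; rewrite /= in_itv /= => /h; rewrite ler_norml => /andP[]; lra.
have m2 : \int[mu]_(x in `]a, b]) f x <= \int[mu]_(x in `]a, b]) (C + e).
  apply: le_Rintegral => // x; rewrite /= in_itv /= => /h; rewrite ler_norml => /andP[]; lra.
move: m1 m2; rewrite !Rintegral_cst // !lebesgue_measure_oc //.
set I := Rintegral _ _ _; move: I => I m1 m2; clear -m1 m2.
by rewrite ler_norml; apply/andP; split; lra.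
Qed.

Lemma Rintegral_diff f a s s' : continuous f -> a <= s -> s <= s' ->
  \int[mu]_(x in `[a, s']) f x - \int[mu]_(x in `[a, s]) f x = \int[mu]_(x in `]s, s']) f x.
Proof.
move=> cf as_ ss; rewrite Rintegral_itvB //; exact: continuous_integ.
Qed.

Lemma der_in_Rintegral f a b : continuous f ->
  der_in `[a, b] (fun s => \int[mu]_(x in `[a, s]) f x) f.
Proof.
move=> cf t tab e e0.
have /cvgrPdist_le /(_ e e0) /nbhs_ballP[d /= d0 hd] := cf t.
exists d => // s sab sd; move: tab sab; rewrite /= !in_itv /= => /andP[at_ tb] /andP[as_ sb].
have io u v : a <= u -> u <= v -> integ `]u, v] f.
  move=> au uv; apply: (@integrableS _ _ _ mu `[u, v]%classic) => //; last exact: continuous_integ.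
  exact: subset_itv_oc_cc.
have near x : `|x - t| < d -> `|f x - f t| <= e.
  by move=> xd; rewrite distrC; apply: hd; rewrite /ball /= distrC.
case/orP: (le_total t s) => ts.
  rewrite Rintegral_diff // (ger0_norm (_ : 0 <= s - t)) ?subr_ge0 //.
  apply: Rintegral_near => //; first exact: io.
  move=> x /andP[tx xs]; apply: near; move: sd.
  by rewrite !ger0_norm ?subr_ge0 //; [lra|exact: ltW].
have N : `|\int[mu]_(x in `]s, t]) f x - f t * (t - s)| <= e * (t - s).
  apply: Rintegral_near => //; first exact: io.
  move=> x /andP[sx xt]; apply: near; move: sd.
  rewrite distrC (distrC x) !ger0_norm ?subr_ge0 //; lra.
move: N; rewrite -(Rintegral_diff f a) // (distrC s) (ger0_norm (_ : 0 <= t - s)) ?subr_ge0 //.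
set I1 := Rintegral _ _ _; set I2 := Rintegral _ _ _; move: I1 I2 => I1 I2.
by rewrite (_ : I2 - I1 - f t * (s - t) = - (I1 - I2 - f t * (t - s))) ?normrN //; ring.
Qed.

Lemma Rintegral_FTC f F a b : a <= b -> continuous f -> der_in `[a, b] F f ->
  \int[mu]_(x in `[a, b]) f x = F b - F a.
Proof.
move=> ab cf hF; have h := der_in_subtract _ _ _ _ _ (der_in_Rintegral f a b cf) hF.
have := mean_value_norm a b 0 _ _ ab h.
rewrite mul0r normr_le0 set_itv1 Rintegral_set1 sub0r => H.
have /eqP : \int[mu]_(x in `[a, b]) f x - F b - (- F a) == 0.
  by apply: H => s _; rewrite subrr normr0.
lra.
Qed.

(** Formally, [AA + G * q] has derivative [G' * q], which is at most [M] times the absolute value of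
    [q]. As [G] is merely Lipschitz, the argument compares increments. *)
Lemma weighted_increment_le a b (M : R) AA q q' G phi : a <= b -> 0 <= M ->
  der_in `[a, b] AA (fun s => G s * q' s) -> der_in `[a, b] q (fun s => - q' s) ->
  lip_in `[a, b] M G -> der_in `[a, b] phi (fun s => `|q s|) ->
  (AA b + G b * q b) - (AA a + G a * q a) <= M * (phi b - phi a).
Proof.
move=> ab M0 hA hq hG hphi; apply/ler_addgt0Pr => e e0.
pose e2 := e / (b - a + 1).
have e20 : 0 < e2 by apply: divr_gt0 => //; lra.
have : (AA b + G b * q b) - (AA a + G a * q a) <= (M * phi b + e2 * b) - (M * phi a + e2 * a).
  apply: (increment_le a b (fun s => AA s + G s * q s) (fun s => M * phi s + e2 * s)) => // s sab.
  have Gs0 := normr_ge0 (G s).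
  pose e1 := e2 / (1 + `|G s| + 2 * M).
  have k0 : 0 < 1 + `|G s| + 2 * M by lra.
  have e10 : 0 < e1 by exact: divr_gt0.
  have ee : e1 * (1 + `|G s| + 2 * M) = e2 by rewrite divfK // gt_eqF.
  have [d1 d10 h1] := hA s sab e1 e10; have [d2 d20 h2] := hq s sab e1 e10.
  have [d3 d30 h3] := hphi s sab e1 e10; have [d4 d40 h4] := der_in_cont _ _ _ s e1 hq sab e10.
  exists (Num.min (Num.min d1 d2) (Num.min d3 d4)); first by rewrite !lt_min d10 d20 d30.
  move=> s' s'ab; rewrite !lt_min => /andP[/andP[sd1 sd2] /andP[sd3 sd4]].
  have H1 := h1 s' s'ab sd1; have H2 := h2 s' s'ab sd2.
  have H3 := h3 s' s'ab sd3; have H4 := h4 s' s'ab sd4.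
  have HG := hG s' s s'ab sab.
  set x := `|s' - s| in H1 H2 H3 HG; have x0 : 0 <= x by rewrite /x.
  have H5 : `|q s'| <= `|q s| + e1.
    have -> : q s' = q s + (q s' - q s) by ring.
    by apply: (le_trans (ler_normD _ _)); exact: lerD.
  have key : `|(AA s' + G s' * q s') - (AA s + G s * q s)| <= e1 * x + `|G s| * (e1 * x) + M * x * (`|q s| + e1).
    have -> : (AA s' + G s' * q s') - (AA s + G s * q s) =
      (AA s' - AA s - G s * q' s * (s' - s)) + G s * (q s' - q s - - q' s * (s' - s)) + (G s' - G s) * q s' by ring.
    apply: (le_trans (ler_normD _ _)); apply: lerD.
      by apply: (le_trans (ler_normD _ _)); apply: lerD => //; rewrite normrM; exact: ler_wpM2l.
    by rewrite normrM; apply: ler_pM.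
  have kk : e1 * x + `|G s| * (e1 * x) + M * x * (`|q s| + e1) = e2 * x - M * (e1 * x) + M * (`|q s| * x).
    by rewrite -ee; ring.
  rewrite kk ler_norml in key; have {key} /andP[k1 k2] := key.
  move: H3; rewrite ler_norml => /andP[p1 p2].
  split => ss.
    have xE : s' - s = x by rewrite /x ger0_norm // subr_ge0.
    have E2 : e2 * x = e2 * s' - e2 * s by rewrite -xE; ring.
    rewrite xE in p1; have : M * (`|q s| * x - e1 * x) <= M * (phi s' - phi s) by apply: ler_wpM2l => //; lra.
    by clear -k2 E2; lra.
  have xE : s' - s = - x by rewrite /x distrC ger0_norm ?subr_ge0 // opprB.
  have E2 : e2 * x = e2 * s - e2 * s' by rewrite -mulrBr -(opprB s') xE opprK.
  rewrite xE in p2; have : M * (`|q s| * x - e1 * x) <= M * (phi s - phi s') by apply: ler_wpM2l => //; lra.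
  by clear -k1 E2; lra.
have : e2 * (b - a + 1) = e by rewrite divfK // gt_eqF //; lra.
lra.
Qed.

Lemma weighted_increment a b (M : R) AA q q' G phi : a <= b -> 0 <= M ->
  der_in `[a, b] AA (fun s => G s * q' s) -> der_in `[a, b] q (fun s => - q' s) ->
  lip_in `[a, b] M G -> der_in `[a, b] phi (fun s => `|q s|) ->
  `|(AA b + G b * q b) - (AA a + G a * q a)| <= M * (phi b - phi a).
Proof.
move=> ab M0 hA hq hG hphi; rewrite ler_norml lerNl; apply/andP; split; last exact: weighted_increment_le hA hq hG hphi.
have := weighted_increment_le a b M (fun s => -1 * AA s) q q' (fun s => -1 * G s) phi ab M0 _ hq _ hphi.
have h1 : der_in `[a, b] (fun s => -1 * AA s) (fun s => -1 * G s * q' s).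
  by apply: der_in_eq (der_in_scale _ (-1) _ _ hA) => // t _; rewrite mulrA.
have h2 : lip_in `[a, b] M (fun s => -1 * G s).
  by move=> s t hs ht; rewrite -mulrBr mulN1r normrN; exact: hG.
by move=> /(_ h1 h2); lra.
Qed.

Lemma der_in_sum (D : set R) n (f f' : nat -> R -> R) :
  (forall j, (j < n)%N -> der_in D (f j) (f' j)) ->
  der_in D (fun s => \sum_(j < n) f j s) (fun s => \sum_(j < n) f' j s).
Proof.
elim: n => [|n IH] h.
  by apply: der_in_eq (der_in_cst D 0) => t _; rewrite big_ord0.
have h1 := IH (fun j jn => h j (ltnW jn)); have h2 := h n (leqnn _).
by apply: der_in_eq (der_in_add _ _ _ _ _ h1 h2) => t _; rewrite big_ord_recr.
Qed.

Definition pw_deriv k (x : R) : R := if k is k'.+1 then pw k' x else 0.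

Lemma der_in_pw_deriv (D : set R) b k : der_in D (fun s => pw k (b - s)) (fun s => - pw_deriv k (b - s)).
Proof.
case: k => [|k] /=; last exact: der_in_pw_rev.
by apply: der_in_eq (der_in_cst D 1) => t _; rewrite ?pw0 // oppr0.
Qed.

(* Equals the moment [\int_a^b dg m.+1 s * pw k (b - s) ds], in a form without [dg m.+1]. *)
Definition taylor_rem m (dg : nat -> R -> R) a b k : R :=
  dg (m - k)%N b - \sum_(j < k.+1) dg (m - k + j)%N a * pw j (b - a).

(** The left side is the integral of the missing derivative [dg m.+1] against the polynomial with
    coefficients [c] in [b - s]; [weighted_increment] with [G := dg m] gives the bound. *)
Lemma moment_bound m dg a b (M : R) (c : nat -> R) : a <= b -> 0 <= M -> jets `[a, b] m dg ->
  lip_in `[a, b] M (dg m) ->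
  `|\sum_(k < m.+1) c k * taylor_rem m dg a b k| <=
     M * \int[mu]_(s in `[a, b]) `|taylor m.+1 c (b - s)|.
Proof.
move=> ab M0 hj hl.
pose q s := taylor m.+1 c (b - s).
pose q' s := \sum_(k < m.+1) c k * pw_deriv k (b - s).
(* Repeated integration by parts: in the derivative of this sum all terms cancel in pairs except
   [dg m s * pw_deriv k (b - s)]. *)
pose A k s := \sum_(j < k) dg (m - k + j)%N s * pw j (b - s).
have hA k : (k <= m)%N -> der_in `[a, b] (A k) (fun s => dg m s * pw_deriv k (b - s)).
  move=> km; have : der_in `[a, b] (A k) (fun s => \sum_(j < k)
      (dg (m - k + j).+1 s * pw j (b - s) + dg (m - k + j)%N s * - pw_deriv j (b - s))).
    apply: (@der_in_sum _ k (fun j s => dg (m - k + j)%N s * pw j (b - s))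
      (fun j s => dg (m - k + j).+1 s * pw j (b - s) + dg (m - k + j)%N s * - pw_deriv j (b - s))) => j jk.
    apply: der_in_mul; last exact: der_in_pw_deriv.
    by apply: hj; rewrite -[X in (_ < X)%N](subnK km) ltn_add2l.
  apply: der_in_eq => // t _.
  transitivity (\sum_(0 <= j < k) (dg (m - k + j.+1)%N t * pw_deriv j.+1 (b - t) - dg (m - k + j)%N t * pw_deriv j (b - t))).
    by rewrite big_mkord; apply: eq_bigr => j _; rewrite addnS mulrN.
  by rewrite telescope_sumr // subnK // addn0 mulr0 subr0.
have hq : der_in `[a, b] q (fun s => - q' s).
  have := @der_in_sum `[a, b] m.+1 (fun k s => c k * pw k (b - s)) (fun k s => c k * - pw_deriv k (b - s))
     (fun k _ => der_in_scale _ (c k) _ _ (der_in_pw_deriv _ b k)).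
  by apply: der_in_eq => // t _; rewrite /q' -sumrN; apply: eq_bigr => k _; rewrite mulrN.
have hAA : der_in `[a, b] (fun s => \sum_(k < m.+1) c k * A k s) (fun s => dg m s * q' s).
  have := @der_in_sum `[a, b] m.+1 (fun k s => c k * A k s) (fun k s => c k * (dg m s * pw_deriv k (b - s)))
     (fun k km => der_in_scale _ (c k) _ _ (hA k km)).
  apply: der_in_eq => // t _; rewrite /q' mulr_sumr; apply: eq_bigr => k _; ring.
have cq : continuous (fun s => `|q s|).
  move=> s; apply: cvg_norm.
  have hq' : der_in setT q (fun s => - q' s).
    have := @der_in_sum setT m.+1 (fun k s => c k * pw k (b - s)) (fun k s => c k * - pw_deriv k (b - s))
      (fun k _ => der_in_scale _ (c k) _ _ (der_in_pw_deriv _ b k)).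
    by apply: der_in_eq => // t _; rewrite /q' -sumrN; apply: eq_bigr => k _; rewrite mulrN.
  exact: der_in_continuous hq' _.
have := weighted_increment a b M _ q q' (dg m) _ ab M0 hAA hq hl (der_in_Rintegral _ a b cq).
rewrite set_itv1 Rintegral_set1 subr0.
suff -> : \sum_(k < m.+1) c k * A k b + dg m b * q b - (\sum_(k < m.+1) c k * A k a + dg m a * q a) =
   \sum_(k < m.+1) c k * taylor_rem m dg a b k by [].
have T s : \sum_(k < m.+1) c k * A k s + dg m s * q s =
   \sum_(k < m.+1) c k * \sum_(j < k.+1) dg (m - k + j)%N s * pw j (b - s).
  rewrite /q /taylor mulr_sumr -big_split; apply: eq_bigr => k _ /=.
  by rewrite [in RHS]big_ord_recr /= subnK ?leq_ord // mulrDr; congr (_ + _); ring.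
rewrite !T -sumrB; apply: eq_bigr => k _; rewrite -mulrBr; congr (_ * (_ - _)).
rewrite subrr big_ord_recl /= addn0 pw0 mulr1 big1 ?addr0 // => j _.
by rewrite /bump /= add1n pwS0 mulr0.
Qed.

End Integrals.

(** * Minimisation over finite-dimensional parameters *)

Section RowVectors.
Context {R : realType}.

Lemma rV_coord_le n (v : 'rV[R]_n) j : `|v ord0 j| <= `|v|.
Proof.
rewrite [`|v|]mx_normrE.
exact: (le_bigmax _ (fun ij => `|v ij.1 ij.2|) (ord0, j)).
Qed.

Lemma rV_lipschitz_continuous n (f : 'rV[R]_n -> R) (C : R) : 0 <= C ->
  (forall u v, f u <= f v + C * `|u - v|) -> continuous f.
Proof.
move=> C0 h u; apply/(@cvgrPdist_le _ _ _ _ (nbhs_filter u)) => e e0.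
have r0 : 0 < e / (C + 1) by apply: divr_gt0 => //; lra.
have near : \forall v \near u, `|u - v| < e / (C + 1).
  by have /cvgrPdist_lt/(_ _ r0) : id @ u --> u by exact: cvg_id.
apply: filterS near => v; rewrite ltr_pdivlMr; last lra.
move=> uv; have := h u v; have := h v u; rewrite (distrC v).
have := normr_ge0 (u - v); rewrite ler_norml => ? ? ?; apply/andP; split; nra.
Qed.

Lemma coercive_min n (f : 'rV[R]_n -> R) (c C : R) : continuous f -> 0 < c ->
  (forall v, c * `|v| - C <= f v) -> exists u, forall v, f u <= f v.
Proof.
move=> cf c0 h; pose r := (`|f 0| + `|C|) / c.
have r0 : 0 <= r by rewrite divr_ge0 ?addr_ge0 // ltW.
pose A := [set v : 'rV[R]_n | `|v| <= r].
have cA : compact A.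
  apply: bounded_closed_compact.
    by exists r; split; [rewrite num_real|move=> M rM v /= vr; exact: le_trans (ltW rM)].
  have -> : A = (fun v : 'rV[R]_n => `|v|) @^-1` [set x | x <= r] by [].
  apply: closed_comp; last exact: closed_le.
  by move=> v _; exact: norm_continuous.
have [|u uA hu] := @EVT_min_rV R n f A _ cA (continuous_subspaceT cf).
  by exists 0; rewrite /A /= normr0.
exists u => v; have [vr|rV_seq] := leP `|v| r; first by apply: hu; rewrite inE.
have f0 : f u <= f 0 by apply: hu; rewrite inE /A /= normr0.
apply: (le_trans f0); apply: le_trans (h v).
have : c * r <= c * `|v| by rewrite ler_pM2l // ltW.
have -> : c * r = `|f 0| + `|C| by rewrite /r mulrC divfK // gt_eqF.
by have := ler_norm (f 0); have := ler_norm C; lra.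
Qed.

Lemma norm_equiv n (f : 'rV[R]_n -> R) : continuous f ->
  (forall (a : R) v, f (a *: v) = `|a| * f v) -> (forall v, v != 0 -> 0 < f v) ->
  exists2 c, 0 < c & forall v, c * `|v| <= f v.
Proof.
move=> cf hh hp; pose A := [set v : 'rV[R]_n | `|v| = 1].
have unit v : v != 0 -> A (`|v|^-1 *: v).
  by move=> v0; rewrite /A /= normrZ normfV normr_id mulVf // normr_eq0.
have f0 : f 0 = 0 by rewrite -(scale0r (0 : 'rV[R]_n)) hh normr0 mul0r.
have [A0|nA] := pselect (A !=set0); last first.
  exists 1 => // v; have [->|v0] := eqVneq v 0; first by rewrite normr0 mulr0 f0.
  by exfalso; apply: nA; exists (`|v|^-1 *: v); exact: unit.
have cA : compact A.
  apply: bounded_closed_compact.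
    by exists 1; split; [rewrite num_real|move=> M rM v /= ->; exact: ltW].
  have -> : A = (fun v : 'rV[R]_n => `|v|) @^-1` [set 1] by [].
  apply: closed_comp; last exact: closed_eq.
  by move=> v _; exact: norm_continuous.
have [u uA hu] := @EVT_min_rV R n f A A0 cA (continuous_subspaceT cf).
exists (f u) => [|v].
  apply: hp; apply/eqP => u0; move: uA; rewrite inE /A /= u0 normr0 => /eqP.
  by rewrite eq_sym oner_eq0.
have [->|v0] := eqVneq v 0; first by rewrite normr0 mulr0 f0.
have : f u <= f (`|v|^-1 *: v) by apply: hu; rewrite inE; exact: unit.
by rewrite hh normfV normr_id mulrC ler_pdivlMr ?normr_gt0 // mulrC.
Qed.

End RowVectors.

(** * Sign changes of polynomials and their L1 norms *)

Section PrincipalSpline.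
Context {R : realType}.
Implicit Types (f g F : R -> R) (a b s : R) (l : seq R).
Local Notation mu := (@lebesgue_measure R).
Local Notation integ D f := (mu.-integrable D (EFin \o f)).

Lemma der_in_zero a b f f' : a < b -> der_in `[a, b] f f' ->
  (forall s, a <= s <= b -> f s = 0) -> forall s, a <= s <= b -> f' s = 0.
Proof.
move=> ab hf f0 t tab; apply/eqP; rewrite -normr_le0 leNgt; apply/negP => ft.
have [d d0 hd] := hf t tab (`|f' t| / 2) (ltac:(lra)).
have [atb1 atb2] := andP tab.
have [s [sab st sd]] : exists s, [/\ a <= s <= b, s != t & `|s - t| < d].
  have [tb|bt] := ltP t b.
    exists (Num.min b (t + d / 2)).
    have h1 : Num.min b (t + d / 2) <= b by rewrite ge_min lexx.
    have h2 : Num.min b (t + d / 2) <= t + d / 2 by rewrite ge_min lexx orbT.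
    have h3 : t < Num.min b (t + d / 2) by rewrite lt_min tb; lra.
    split; [apply/andP; split; lra|by rewrite gt_eqF|].
    by rewrite ger0_norm ?subr_ge0; lra.
  exists (Num.max a (t - d / 2)).
  have h1 : a <= Num.max a (t - d / 2) by rewrite le_max lexx.
  have h2 : t - d / 2 <= Num.max a (t - d / 2) by rewrite le_max lexx orbT.
  have h3 : Num.max a (t - d / 2) < t by rewrite gt_max; apply/andP; split; lra.
  split; [apply/andP; split; lra|by rewrite lt_eqF|].
  by rewrite distrC ger0_norm ?subr_ge0; lra.
have := hd s sab sd; rewrite !f0 // subrr sub0r normrN normrM.
have : 0 < `|s - t| by rewrite normr_gt0 subr_eq0.
by move=> x0; rewrite ler_pM2r //; lra.
Qed.

Lemma taylor_rev_der (D : set R) n (c : nat -> R) b :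
  der_in D (fun s => taylor n c (b - s)) (fun s => \sum_(j < n) c j * - pw_deriv j (b - s)).
Proof.
exact: (@der_in_sum _ D n (fun k s => c k * pw k (b - s)) (fun k s => c k * - pw_deriv k (b - s))
     (fun k _ => der_in_scale _ (c k) _ _ (der_in_pw_deriv _ b k))).
Qed.

Lemma taylor_rev_derS (D : set R) n (c : nat -> R) b :
  der_in D (fun s => taylor n.+1 c (b - s)) (fun s => - taylor n (fun j => c j.+1) (b - s)).
Proof.
apply: der_in_eq (taylor_rev_der D n.+1 c b) => // t _.
rewrite big_ord_recl /= oppr0 mulr0 add0r /taylor -sumrN; apply: eq_bigr => j _.
by rewrite /bump /= add1n mulrN.
Qed.

Lemma taylor_rev_continuous n (c : nat -> R) b : continuous (fun s => taylor n c (b - s)).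
Proof. exact: der_in_continuous (taylor_rev_der setT n c b). Qed.

Lemma continuous_norm f : continuous f -> continuous (fun s => `|f s|).
Proof. by move=> cf s; apply: cvg_norm; exact: cf. Qed.

Lemma taylor_rev_zero n (c : nat -> R) a b : a < b ->
  (forall s, a <= s <= b -> taylor n c (b - s) = 0) -> forall j, (j < n)%N -> c j = 0.
Proof.
move=> ab; elim: n c => [|n IH] c h [|j] //= jn.
  by have := h b; rewrite subrr taylor0; apply; rewrite lexx ltW.
apply: (IH (fun j => c j.+1)) => // s sab; apply/eqP; rewrite -oppr_eq0; apply/eqP.
exact: (der_in_zero a b _ _ ab (taylor_rev_derS _ n c b) h).
Qed.

Lemma Rintegral_norm_zero f a b : a < b -> continuous f ->
  \int[mu]_(s in `[a, b]) `|f s| = 0 -> forall s, a <= s <= b -> f s = 0.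
Proof.
move=> ab cf h s sab; apply/eqP; rewrite -normr_eq0; apply/eqP.
have cn := continuous_norm f cf.
apply: (der_in_zero a b _ _ ab (der_in_Rintegral _ a b cn)) => // x /andP[ax xb].
apply/eqP; rewrite eq_le; apply/andP; split; last by apply: Rintegral_ge0.
have := Rintegral_diff (fun s => `|f s|) a x b cn ax xb; rewrite h.
have : 0 <= \int[mu]_(y in `]x, b]) `|f y| by apply: Rintegral_ge0.
lra.
Qed.

Lemma Rintegral_norm_close f g a b C : a <= b -> continuous f -> continuous g ->
  (forall s, a <= s <= b -> `|f s - g s| <= C) ->
  \int[mu]_(s in `[a, b]) `|f s| <= \int[mu]_(s in `[a, b]) `|g s| + C * (b - a).
Proof.
move=> ab cf cg h.
have E : \int[mu]_(s in `[a, b]) (fun=> C) s = C * (b - a).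
  rewrite (Rintegral_FTC (fun=> C) (fun s => C * s) a b ab); last 2 first.
  - by move=> x; exact: cvg_cst.
  - by apply: der_in_eq (der_in_scale _ C _ _ (der_in_id _)) => // t _; rewrite mulr1.
  by rewrite mulrBr.
have i1 : integ `[a, b] (fun s => `|f s|) by apply: continuous_integ; exact: continuous_norm.
have i2 : integ `[a, b] (fun s => `|g s|) by apply: continuous_integ; exact: continuous_norm.
have i3 : integ `[a, b] (fun=> C) by apply: continuous_integ => x; exact: cvg_cst.
rewrite -E -RintegralD //; apply: le_Rintegral => //.
  apply: continuous_integ => x; apply: cvgD; [exact: continuous_norm|exact: cvg_cst].
move=> s; rewrite /= in_itv /= => /h H.
have -> : f s = g s + (f s - g s) by ring.
by apply: (le_trans (ler_normD _ _)); exact: lerD.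
Qed.

(** Induction on the degree: the derivative has [n] sign changes, and integrating adds one.
    Reversing the variable to [b - s] flips the sign of the derivative, which [alt_mono_sign] flips
    back. *)
Lemma taylor_alt_sign n (c : nat -> R) a b : a <= b -> c n = 1 ->
  exists2 l, size l = n & alt_sign l 1 (fun s => taylor n.+1 c (b - s)) a b.
Proof.
move=> ab; elim: n c => [|n IH] c cn.
  exists [::] => //= s _.
  by rewrite mul1r /taylor big_ord_recl big_ord0 addr0 /= pw0 mulr1 cn.
have [l sl hS] := IH (fun j => c j.+1) cn.
have hS' : alt_sign l (-1) (fun s => - taylor n.+1 (fun j => c j.+1) (b - s)) a b.
  have flip l' (sg : R) f x : alt_sign l' sg f x b -> alt_sign l' (- sg) (fun s => - f s) x b.
    elim: l' sg x => [|y l' IHl] sg x /=; first by move=> H s /H; rewrite mulrNN.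
    by move=> [H1 H2 H3]; split=> // [s /H2|]; [rewrite mulrNN|exact: IHl].
  exact: flip.
have := alt_sign_mono _ _ _ _ _ _ (taylor_rev_derS `[a, b]%classic n.+1 c b) hS'.
move=> /(alt_mono_sign _ _ _ _ _ ab)[l' sl' H]; exists l'; first by rewrite sl' sl.
by rewrite opprK in H.
Qed.

Lemma alt_lt n l s : {in l, forall c, s < c} -> alt n l s = 0.
Proof.
elim: l => [|c l IH] //= h; rewrite IH ?subr0 /tpow ?ifF //.
  by apply/negbTE; rewrite -ltNge subr_lt0 h ?mem_head.
by move=> x xl; apply: h; rewrite inE xl orbT.
Qed.

(** Off the knots, [sg] times the step function of [l] acts as the sign of [f]. This links sign
    changes to spline knots. *)
Lemma alt_sign_norm l (sg : R) f a b s : `|sg| = 1 -> alt_sign l sg f a b -> a < s < b -> s \notin l ->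
  `|1 - 2 * alt 0 l s| = 1 /\ `|f s| = sg * (1 - 2 * alt 0 l s) * f s.
Proof.
elim: l sg a => [|c l IH] sg a sg1 /=.
  move=> h sab _; rewrite mulr0 subr0 normr1 mulr1; split=> //.
  by rewrite -[LHS]mul1r -sg1 -normrM ger0_norm // h.
move=> [/andP[ac cb] h hS] /andP[as_ sb]; rewrite inE negb_or => /andP[sc sl].
have [cs|sc'] := ltP c s.
  have [|H1 H2] := IH (- sg) c _ hS (introT andP (conj cs sb)) sl; first by rewrite normrN.
  rewrite tpow_ge0 ?subr_ge0 ?(ltW cs) // pw0.
  have -> : 1 - 2 * (1 - alt 0 l s) = - (1 - 2 * alt 0 l s) by ring.
  by rewrite normrN; split=> //; rewrite H2 mulrN mulNr.
have {}sc' : s < c by rewrite lt_neqAle sc sc'.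
rewrite alt_lt; last first.
  by move=> x xl; have /andP[cx _] := knots_all c b l (alt_sign_knots _ _ _ _ _ hS) x xl; exact: lt_le_trans cx.
rewrite /tpow ifF ?sub0r ?oppr0 ?mulr0 ?subr0 ?normr1 ?mulr1; last first.
  by apply/negbTE; rewrite -ltNge subr_lt0.
by split => //; rewrite -[LHS]mul1r -sg1 -normrM ger0_norm // h // as_.
Qed.

End PrincipalSpline.

Section PrincipalSplineExistence.
Context {R : realType}.
Implicit Types (f g F : R -> R) (a b s : R) (l : seq R).
Local Notation mu := (@lebesgue_measure R).
Local Notation integ D f := (mu.-integrable D (EFin \o f)).

Lemma negligible_seq (z : seq R) : mu.-negligible [set` z].
Proof.
elim: z => [|x z IH].
  by apply: negligibleS (negligible_set0 mu) => x.
have hx : mu.-negligible [set x].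
  by apply/negligibleP; [exact: measurable_set1|exact: lebesgue_measure_set1].
apply: negligibleS (negligibleU hx IH) => y; rewrite /= inE => /predU1P[->|yz]; [left|right] => //.
Qed.

(** First-order condition for an L1 minimum. Off the finite set [z] the function [w] is the sign of
    [P], so the one-sided derivative of the norm in direction [- q] is minus the integral of
    [w * q]. Dominated convergence along steps [1 / (n + 1)] makes this rigorous. *)
Lemma stationarity a b (L B : R) (P q w : R -> R) (z : seq R) : 0 < L ->
  continuous P -> continuous q -> integ `[a, b] (fun s => w s * q s) ->
  (forall s, a < s < b -> s \notin z -> [/\ P s != 0, `|w s| = 1 & `|P s| = w s * P s]) ->
  (forall n : nat, 0 <= L * (\int[mu]_(s in `[a, b]) `|P s - n.+1%:R^-1 * q s|
     - \int[mu]_(s in `[a, b]) `|P s|) + n.+1%:R^-1 * B) ->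
  L * \int[mu]_(s in `[a, b]) (w s * q s) <= B.
Proof.
move=> L0 cP cq iw hw hmin.
(* Difference quotients, dominated by the absolute value of [q]; at a fixed point with [P s != 0]
   they are eventually constant in [n]. *)
pose fn n s := n.+1%:R * (`|P s - n.+1%:R^-1 * q s| - `|P s|).
have n0 n : 0 < n.+1%:R :> R by [].
have cnq n : continuous (fun s => P s - n.+1%:R^-1 * q s).
  by move=> x; apply: cvgB; [exact: cP|apply: cvgM; [exact: cvg_cst|exact: cq]].
have cd n : continuous (fun s => `|P s - n.+1%:R^-1 * q s| - `|P s|).
  by move=> x; apply: cvgB; [exact: (continuous_norm _ (cnq n) x)|exact: (continuous_norm _ cP x)].
have cfn n : continuous (fn n).
  by move=> x; apply: cvgM; [exact: cvg_cst|exact: cd].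
have key n : - (B / L) <= \int[mu]_(s in `[a, b]) fn n s.
  rewrite RintegralZl //; last first.
    exact: continuous_integ (cd n).
  rewrite RintegralB //; last 2 first.
  - by apply: continuous_integ; exact: continuous_norm.
  - by apply: continuous_integ; exact: continuous_norm.
  have := hmin n; set I := _ - _ => H.
  rewrite lerNl -mulrN ler_pdivlMr // .
  have : 0 <= n.+1%:R * (L * I + n.+1%:R^-1 * B) by rewrite mulr_ge0.
  rewrite mulrDr mulVKf ?gt_eqF //; lra.
have mD : measurable (`[a, b]%classic : set (measurableTypeR R)) by [].
have [] := @dominated_convergence _ (measurableTypeR R) R mu `[a, b]%classic mD
  (fun n s => (fn n s)%:E) (fun s => (- (w s * q s))%:E) (fun s => `|q s|%:E).
- move=> n; apply/measurable_EFinP; apply: measurable_funTS.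
  exact: continuous_measurable_fun.
- by apply: measurable_int; apply: integrableN iw.
- apply: negligibleS (negligible_seq [:: a, b & z]) => s /= ns.
  apply: contrapT => sz; apply: ns; rewrite in_itv /= => /andP[as_ sb].
  have [sa [sb' sz']] : s != a /\ s != b /\ s \notin z.
    by move/negP: sz; rewrite !inE !negb_or => /and3P[? ? ?].
  have [|P0 w1 Pw] := hw s _ sz'; first by rewrite !lt_neqAle as_ sb eq_sym sa sb'.
  apply: cvg_near_cst.
  have Ps0 : 0 < `|P s| by rewrite normr_gt0.
  near=> n.
  congr EFin; rewrite /fn.
  have small : n.+1%:R^-1 * `|q s| < `|P s|.
    rewrite mulrC ltr_pdivrMr //.
    have : `|q s| / `|P s| < n.+1%:R.
      have : `|q s| / `|P s| < n%:R by near: n; exact: nbhs_infty_gtr.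
      by move=> h; apply: lt_trans h _; rewrite ltr_nat.
    by rewrite ltr_pdivrMr // mulrC.
  have E : `|P s - n.+1%:R^-1 * q s| = w s * (P s - n.+1%:R^-1 * q s).
    have ww : w s * w s = 1 by rewrite -expr2 -real_normK ?num_real // w1 expr1n.
    rewrite -[LHS]mul1r -w1 -normrM ger0_norm // mulrBr -Pw subr_ge0.
    apply: le_trans (ltW small); apply: (le_trans (ler_norm _)).
    by rewrite !normrM w1 mul1r gtr0_norm // invr_gt0.
  rewrite E Pw mulrBr mulrDr; field.
  by rewrite -(natrD _ 1) pnatr_eq0.
- by apply: continuous_integ; exact: continuous_norm.
- apply: aeW => s n _ /=; rewrite lee_fin /fn normrM gtr0_norm //.
  have : `| `|P s - n.+1%:R^-1 * q s| - `|P s| | <= n.+1%:R^-1 * `|q s|.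
    apply: (le_trans (ler_dist_dist _ _)).
    by rewrite addrAC subrr sub0r normrN normrM gtr0_norm // invr_gt0.
  by move=> H; have := ler_wpM2l (ltW (n0 n)) H; rewrite mulVKf ?gt_eqF.
move=> fi _ cv.
have : ((- (B / L))%:E <= \int[mu]_(s in `[a, b]) (- (w s * q s))%:E)%E.
  apply: (cvge_ge _ cv); apply: nearW => n.
  have := key n; rewrite -lee_fin /Rintegral fineK //.
  by apply: integrable_fin_num => //; exact: continuous_integ.
rewrite -[leRHS]fineK; last exact: integrable_fin_num.
rewrite lee_fin -/(Rintegral _ _ _) => H.
have : \int[mu]_(s in `[a, b]) (- (w s * q s)) = - \int[mu]_(s in `[a, b]) (w s * q s).
  rewrite (_ : (fun s => - (w s * q s)) = (fun s => -1 * (w s * q s))).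
    by rewrite RintegralZl // mulN1r.
  by apply/funext => s; rewrite mulN1r.
by move=> E; rewrite E lerN2 ler_pdivlMr // mulrC in H.
Unshelve. all: end_near. Qed.

End PrincipalSplineExistence.

Section Segment.
Context {R : realType}.
Implicit Types (f g F : R -> R) (a b s : R) (l : seq R).
Local Notation mu := (@lebesgue_measure R).
Local Notation integ D f := (mu.-integrable D (EFin \o f)).

Lemma integD a b f g : integ `[a, b] f -> integ `[a, b] g -> integ `[a, b] (fun s => f s + g s).
Proof.
move=> i1 i2; have mD : measurable (`[a, b]%classic : set (measurableTypeR R)) by [].
by apply: eq_integrable (integrableD mD i1 i2).
Qed.

Lemma integB a b f g : integ `[a, b] f -> integ `[a, b] g -> integ `[a, b] (fun s => f s - g s).
Proof.
move=> i1 i2; have mD : measurable (`[a, b]%classic : set (measurableTypeR R)) by [].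
by apply: eq_integrable (integrableB mD i1 i2).
Qed.

Lemma integZ a b k f : integ `[a, b] f -> integ `[a, b] (fun s => k * f s).
Proof.
move=> i1; have mD : measurable (`[a, b]%classic : set (measurableTypeR R)) by [].
by apply: eq_integrable (integrableZl mD k i1).
Qed.

Definition tpoly n (c : nat -> R) : {poly R} := \poly_(j < n) (c j / j`!%:R).

Lemma tpolyE n c x : taylor n c x = (tpoly n c).[x].
Proof. by rewrite /tpoly horner_poly; apply: eq_bigr => j _; rewrite /pw mulrA mulrAC. Qed.

Lemma tpoly_neq0 n c j : (j < n)%N -> c j != 0 -> tpoly n c != 0.
Proof.
move=> jn cj; apply/eqP => /(congr1 (fun p : {poly R} => p`_j)).
rewrite coef_poly jn coef0 => /eqP; rewrite mulf_eq0 (negbTE cj) /= invr_eq0.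
by rewrite pnatr_eq0 -leqn0 leqNgt fact_gt0.
Qed.

Lemma poly_zeros (p : {poly R}) (a b : R) : p != 0 ->
  exists z : seq R, forall x, a <= x <= b -> root p x -> x \in z.
Proof.
(* The margin includes the endpoints, since [roots] refers to an open interval. *)
move=> p0; exists (polyrcf.roots p (a - 1) (b + 1)) => x /andP[ax xb] px.
by rewrite polyrcf.in_roots px p0 andbT in_itv /=; apply/andP; split; lra.
Qed.

Lemma Rintegral_tpow0 a b c k : a <= c <= b ->
  integ `[a, b] (fun s => tpow 0 (s - c) * pw k (b - s)) /\
  \int[mu]_(s in `[a, b]) (tpow 0 (s - c) * pw k (b - s)) = tpow k.+1 (b - c).
Proof.
move=> /andP[ac cb].
have E : (fun s => tpow 0 (s - c) * pw k (b - s)) = (fun s => pw k (b - s)) \_ `[c, +oo[.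
  apply/funext => s; rewrite patchE; case: ifPn => [|ns].
    by rewrite inE /= in_itv /= andbT => cs; rewrite tpow_ge0 ?subr_ge0 // pw0 mul1r.
  rewrite /tpow ifF ?mul0r //; apply/negbTE; rewrite subr_ge0 -ltNge ltNge; apply/negP => cs.
  by move/negP: ns; apply; rewrite inE /= in_itv /= cs.
have I : `[a, b]%classic `&` `[c, +oo[ = `[c, b]%classic.
  apply/seteqP; split => x; rewrite /= !in_itv /=.
    by move=> [/andP[_ ->]]; rewrite !andbT => ->.
  by move=> /andP[cx xb]; rewrite cx xb (le_trans ac).
have cpw : continuous (fun s => pw k (b - s)).
  exact: der_in_continuous (der_in_pw_deriv setT b k).
rewrite E; split.
  rewrite -restrict_EFin; apply/integrable_restrict => //; rewrite I.
  exact: continuous_integ.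
rewrite -Rintegral_mkcondr I.
rewrite (Rintegral_FTC (fun s => pw k (b - s)) (fun s => - pw k.+1 (b - s)) c b cb cpw).
  by rewrite subrr pwS0 oppr0 sub0r opprK tpow_ge0 ?subr_ge0.
apply: der_in_eq (der_in_scale _ (-1) _ _ (der_in_pw_rev _ b k)) => t _; rewrite mulN1r //.
by rewrite opprK.
Qed.

Lemma Rintegral_alt0 a b l k : {in l, forall c, a <= c <= b} ->
  integ `[a, b] (fun s => alt 0 l s * pw k (b - s)) /\
  \int[mu]_(s in `[a, b]) (alt 0 l s * pw k (b - s)) = alt k.+1 l b.
Proof.
elim: l => [|c l IH] h /=.
  rewrite (_ : (fun s => _) = (fun=> 0)); last by apply/funext => s; rewrite mul0r.
  split; first by apply: continuous_integ => x; exact: cvg_cst.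
  by rewrite Rintegral_cst // mul0r.
have [i1 e1] := Rintegral_tpow0 a b c k (h c (mem_head _ _)).
have [|i2 e2] := IH; first by move=> x xl; apply: h; rewrite inE xl orbT.
rewrite (_ : (fun s => _) = (fun s => tpow 0 (s - c) * pw k (b - s) - alt 0 l s * pw k (b - s))); last first.
  by apply/funext => s; rewrite mulrBl.
split; last by rewrite RintegralB // e1 e2.
exact: integB.
Qed.

Lemma Rintegral_step a b l k : a <= b -> {in l, forall c, a <= c <= b} ->
  integ `[a, b] (fun s => (1 - 2 * alt 0 l s) * pw k (b - s)) /\
  \int[mu]_(s in `[a, b]) ((1 - 2 * alt 0 l s) * pw k (b - s)) = pw k.+1 (b - a) - 2 * alt k.+1 l b.
Proof.
move=> ab h; have [i2 e2] := Rintegral_alt0 a b l k h.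
(* On [[a, b]] the constant 1 is the step with the single knot [a], so the same lemma also
   integrates this part. *)
have [i1 e1] := Rintegral_alt0 a b [:: a] k (ltac:(by move=> x; rewrite inE => /eqP ->; rewrite lexx)).
have E s : a <= s -> (1 - 2 * alt 0 l s) * pw k (b - s) =
   alt 0 [:: a] s * pw k (b - s) - 2 * (alt 0 l s * pw k (b - s)).
  by move=> as_; rewrite /= tpow_ge0 ?subr_ge0 // pw0; ring.
have i3 : integ `[a, b] (fun s => 2 * (alt 0 l s * pw k (b - s))).
  exact: integZ.
have i4 : integ `[a, b] (fun s => alt 0 [:: a] s * pw k (b - s) - 2 * (alt 0 l s * pw k (b - s))).
  exact: integB.
split.
  apply: eq_integrable i4 => //= s; rewrite inE /= in_itv /= => /andP[as_ _].
  by rewrite -(E s as_).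
transitivity (\int[mu]_(s in `[a, b]) (alt 0 [:: a] s * pw k (b - s) - 2 * (alt 0 l s * pw k (b - s)))).
  by apply: eq_Rintegral => s; rewrite inE /= in_itv /= => /andP[as_ _]; exact: E.
rewrite RintegralB // RintegralZl // e1 e2 /= subr0 tpow_ge0 ?subr_ge0 //.
Qed.

Definition rV_seq m (v : 'rV[R]_m.+1) : nat -> R := fun j => v ord0 (inord j).

(* Among the polynomials [q] in [x = b - s], of degree at most [m] and with coefficients [v], one
   minimises [L * \int_a^b `|pw m.+1 x - q x| + sg * \sum_k v_k * taylor_rem k]; as [M < L] this is
   coercive.  The knots are the sign changes of [pw m.+1 - q] at the minimiser, where stationarity in
   the direction [pw k] is the equation on [taylor_rem k]. *)
Lemma principal_knots m dg a b (M L sg : R) : a < b -> 0 <= M -> M < L -> sg * sg = 1 ->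
  jets `[a, b] m dg -> lip_in `[a, b] M (dg m) ->
  exists2 l, size l = m.+1 /\ knots a b l & forall k, (k <= m)%N ->
    taylor_rem m dg a b k = sg * L * (pw k.+1 (b - a) - 2 * alt k.+1 l b).
Proof.
move=> ab M0 ML sg1 hj hl; have ab' := ltW ab; have L0 : 0 < L by exact: le_lt_trans ML.
pose rho := taylor_rem m dg a b.
pose cp (v : 'rV[R]_m.+1) := fun j => if j == m.+1 then 1 else - rV_seq m v j.
pose P v s := taylor m.+2 (cp v) (b - s).
pose q v s := taylor m.+1 (rV_seq m v) (b - s).
have PE v s : P v s = pw m.+1 (b - s) - q v s.
  rewrite /P /q /taylor big_ord_recr /= /cp eqxx mul1r addrC; congr (_ + _).
  rewrite -sumrN; apply: eq_bigr => j _.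
  by rewrite ifF ?mulNr //; apply/negbTE; rewrite neq_ltn ltn_ord.
have cP v : continuous (P v) by exact: taylor_rev_continuous.
have cq v : continuous (q v) by exact: taylor_rev_continuous.
have qD (x : R) u v s : q (u + x *: v) s = q u s + x * q v s.
  rewrite /q /taylor mulr_sumr -big_split; apply: eq_bigr => j _ /=.
  by rewrite /rV_seq !mxE; ring.
pose K := \sum_(j < m.+1) pw j (b - a).
have K0 : 0 <= K by apply: sumr_ge0 => j _; apply: pw_ge0; rewrite subr_ge0.
have qK v s : a <= s <= b -> `|q v s| <= K * `|v|.
  move=> /andP[as_ sb]; apply: (le_trans (ler_norm_sum _ _ _)); rewrite /K mulr_suml.
  apply: ler_sum => j _; rewrite normrM mulrC; apply: ler_pM => //; last exact: rV_coord_le.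
  rewrite ger0_norm; last by apply: pw_ge0; rewrite subr_ge0.
  by apply: ler_wpM2r; [rewrite invr_ge0|apply: lerXn2r; rewrite ?nnegrE ?subr_ge0 // lerB].
pose I v := \int[mu]_(s in `[a, b]) `|q v s|.
pose Phi v := \int[mu]_(s in `[a, b]) `|P v s|.
pose B (v : 'rV[R]_m.+1) := \sum_(k < m.+1) rV_seq m v k * rho k.
have BD x u v : B (u + x *: v) = B u + x * B v.
  rewrite /B mulr_sumr -big_split; apply: eq_bigr => j _ /=.
  by rewrite /rV_seq !mxE; ring.
have qB u v s : q u s - q v s = q (u - v) s by rewrite -(scaleN1r v) qD mulN1r.
have Kba : 0 <= K * (b - a) by rewrite mulr_ge0 // subr_ge0.
have cI : continuous I.
  apply: (rV_lipschitz_continuous _ _ (K * (b - a))) => // u v.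
  rewrite mulrAC; apply: Rintegral_norm_close => // s sab.
  by rewrite qB; exact: qK.
have cPhi : continuous Phi.
  apply: (rV_lipschitz_continuous _ _ (K * (b - a))) => // u v.
  rewrite mulrAC; apply: Rintegral_norm_close => // s sab.
  by rewrite !PE (_ : _ - _ = q (v - u) s) ?(distrC u) ?qK // -qB; ring.
have cB : continuous B.
  have S0 : 0 <= \sum_(k < m.+1) `|rho k| by exact: sumr_ge0.
  apply: (rV_lipschitz_continuous _ _ (\sum_(k < m.+1) `|rho k|)) => // u v.
  have -> : B u = B v + B (u - v) by rewrite -[u in LHS](subrK v) addrC -[u - v in LHS]scale1r BD mul1r.
  rewrite lerD2l; apply: (le_trans (ler_norm _)); apply: (le_trans (ler_norm_sum _ _ _)).
  rewrite mulr_suml; apply: ler_sum => k _; rewrite normrM mulrC.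
  by apply: ler_wpM2l => //; exact: rV_coord_le.
have [c c0 hc] : exists2 c, 0 < c & forall v, c * `|v| <= I v.
  apply: norm_equiv => //.
    move=> x v; rewrite /I -RintegralZl //; last by apply: continuous_integ; exact: continuous_norm.
    apply: eq_Rintegral => s _; rewrite -normrM; congr (`|_|).
    have := qD x 0 v s; rewrite add0r => ->.
    have -> : q 0 s = 0 by rewrite /q /taylor big1 // => j _; rewrite /rV_seq mxE mul0r.
    by rewrite add0r.
  move=> v v0; rewrite lt_neqAle eq_sym; apply/andP; split; last by apply: Rintegral_ge0.
  apply: contra_neq v0 => /(Rintegral_norm_zero _ _ _ ab (cq v)) h.
  apply/rowP => j; rewrite mxE.
  by have := taylor_rev_zero _ _ _ _ ab h j (ltn_ord j); rewrite /rV_seq inord_val.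
have cpw : continuous (fun s => pw m.+1 (b - s)) by exact: der_in_continuous (der_in_pw_deriv setT b m.+1).
pose C0 := \int[mu]_(s in `[a, b]) `|pw m.+1 (b - s)|.
have IP v : I v <= Phi v + C0.
  have iP := continuous_integ a b _ (continuous_norm _ (cP v)).
  have ip := continuous_integ a b _ (continuous_norm _ cpw).
  rewrite -RintegralD //; apply: le_Rintegral => //.
  - by apply: continuous_integ; exact: continuous_norm.
  - exact: integD.
  move=> s _; have -> : q v s = - P v s + pw m.+1 (b - s) by rewrite PE; ring.
  by apply: (le_trans (ler_normD _ _)); rewrite normrN.
pose Psi v := L * Phi v + sg * B v.
have sgn : `|sg| = 1 by have /eqP := sg1; rewrite -expr2 sqrf_eq1 => /orP[] /eqP ->; rewrite ?normrN normr1.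
have [u hu] : exists u, forall v, Psi u <= Psi v.
  (* By [IP] the first term of [Psi] is at least [L * I v - L * C0], and the moment term is at least
     [- M * I v]; the difference [L - M > 0] makes [Psi] coercive. *)
  apply: (coercive_min _ _ ((L - M) * c) (L * C0)).
  - have cst (x : R) : continuous (fun _ : 'rV[R]_m.+1 => x) by exact: cst_continuous.
    move=> v; exact: (continuousD (continuousM (cst L v) (cPhi v)) (continuousM (cst sg v) (cB v))).
  - by rewrite mulr_gt0 // subr_gt0.
  move=> v; rewrite /Psi.
  have : `|sg * B v| <= M * I v by rewrite normrM sgn mul1r; exact: moment_bound.
  rewrite ler_norml => /andP[h1 _].
  have h2 := ler_wpM2l (ltW L0) (IP v).
  have : (L - M) * (c * `|v|) <= (L - M) * I v by apply: ler_wpM2l => //; lra.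
  by rewrite mulrA; lra.
(* The leading coefficient is fixed at 1: the error has at most [m.+1] sign changes and finitely
   many zeros, as [taylor_alt_sign] and [stationarity] require. *)
have cp1 : cp u m.+1 = 1 by rewrite /cp eqxx.
have cp0 : cp u m.+1 != 0 by rewrite cp1 oner_eq0.
have [l sl hS] := taylor_alt_sign m.+1 (cp u) a b ab' cp1.
have hk := alt_sign_knots _ _ _ _ _ hS.
exists l => // k km.
have [z0 hz0] := poly_zeros (tpoly m.+2 (cp u)) 0 (b - a)
  (tpoly_neq0 _ _ m.+1 (ltnSn _) cp0).
pose z := l ++ [seq b - x | x <- z0].
have hw s : a < s < b -> s \notin z ->
    [/\ P u s != 0, `|1 - 2 * alt 0 l s| = 1 & `|P u s| = (1 - 2 * alt 0 l s) * P u s].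
  move=> sab; rewrite mem_cat negb_or => /andP[snl snz].
  have [w1 w2] := alt_sign_norm _ _ _ _ _ _ (normr1 R) hS sab snl.
  split => //; last by rewrite w2 mul1r.
  apply: contra snz => P0; apply/mapP; exists (b - s); last by rewrite subKr.
  have /andP[? ?] := sab; apply: hz0; first by apply/andP; split; lra.
  by rewrite /root -tpolyE.
have hl' := knots_all _ _ _ hk.
have [iw ew] := Rintegral_step a b l k ab' hl'.
pose ek : 'rV[R]_m.+1 := delta_mx ord0 (inord k).
have qe (x : R) s : q (x *: ek) s = x * pw k (b - s).
  rewrite /q /taylor (bigD1 (inord k : 'I_m.+1)) //= big1.
    by rewrite /rV_seq !mxE inord_val !eqxx mulr1 addr0 inordK.
  move=> j jk; rewrite /rV_seq !mxE inord_val [in X in _ * (X%:R)]eqxx /=.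
  by rewrite (negbTE jk) mulr0 mul0r.
have Be (x : R) : B (x *: ek) = x * rho k.
  rewrite /B (bigD1 (inord k : 'I_m.+1)) //= big1.
    by rewrite /rV_seq !mxE inord_val !eqxx mulr1 addr0 inordK.
  move=> j jk; rewrite /rV_seq !mxE inord_val [in X in _ * (X%:R)]eqxx /=.
  by rewrite (negbTE jk) mulr0 mul0r.
(* Stationarity in the direction [x *: ek]; the cases [x = 1] and [x = -1] give opposite
   inequalities, hence the equation. *)
have st (x : R) : x * (L * (pw k.+1 (b - a) - 2 * alt k.+1 l b)) <= x * (sg * rho k).
  have E : (fun s => (1 - 2 * alt 0 l s) * q (x *: ek) s) = (fun s => x * ((1 - 2 * alt 0 l s) * pw k (b - s))).
    by apply/funext => s; rewrite qe mulrCA.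
  have -> : x * (L * (pw k.+1 (b - a) - 2 * alt k.+1 l b)) =
     L * \int[mu]_(s in `[a, b]) ((1 - 2 * alt 0 l s) * q (x *: ek) s).
    by rewrite E RintegralZl // ew; ring.
  apply: (stationarity a b L _ (P u) (q (x *: ek)) _ z) => //.
    rewrite E; exact: integZ.
  move=> n; have := hu (u + n.+1%:R^-1 *: (x *: ek)).
  rewrite /Psi BD Be.
  have -> : Phi (u + n.+1%:R^-1 *: (x *: ek)) = \int[mu]_(s in `[a, b]) `|P u s - n.+1%:R^-1 * q (x *: ek) s|.
    by apply: eq_Rintegral => s _; congr (`|_|); rewrite !PE qD; ring.
  rewrite -/(Phi u); set X := \int[mu]_(s in `[a, b]) `|_ - _ * _|.
  move: X (Phi u) (B u) (rho k) (n.+1%:R^-1) => X Y Z W e H.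
  have -> : L * (X - Y) + e * (x * (sg * W)) = (L * X + sg * (Z + e * (x * W))) - (L * Y + sg * Z) by ring.
  by rewrite subr_ge0.
have h1 := st 1; have h2 := st (-1).
have E : L * (pw k.+1 (b - a) - 2 * alt k.+1 l b) = sg * rho k.
  by apply/eqP; rewrite eq_le; apply/andP; split; lra.
have -> : taylor_rem m dg a b k = sg * (sg * rho k) by rewrite mulrA sg1 mul1r.
by rewrite -E mulrA.
Qed.

End Segment.

(** * Extremal splines *)

Section PerfectSplineApproximation.
Context {R : realType}.
Implicit Types (f g F : R -> R) (a b s : R) (l : seq R).

Lemma spl_cat m (L : R) (c : nat -> R) l l' k s : (k <= m)%N -> {in l', forall x, s <= x} ->
  spl m L c (l ++ l') k s = spl m L c l k s.
Proof.
by move=> km h; rewrite /spl subSn // alt_cat (alt_le _ l') // mulr0 addr0.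
Qed.

Lemma spl_start m (L : R) (c : nat -> R) l k : (k <= m)%N -> {in l, forall x, 0 <= x} ->
  spl m L c l k 0 = c k.
Proof.
by move=> km h; rewrite /spl subSn // alt_le // pwS0 mulr0 subr0 mulr0 addr0 taylor0 addn0.
Qed.

Lemma alt_shift n l a s : alt n [seq x - a | x <- l] (s - a) = alt n l s.
Proof. by elim: l => [|c l IH] //=; rewrite IH opprB addrA subrK. Qed.

Lemma jets_shift (D : set R) m (d : nat -> R -> R) a : jets setT m d -> jets D m (fun k s => d k (s - a)).
Proof.
move=> hj k km t _ e e0; have [r r0 hr] := hj k km (t - a) I e e0.
exists r => // s _ sr; have E : s - a - (t - a) = s - t by ring.
by have := hr (s - a) I; rewrite E; exact.
Qed.

Lemma jets_subtract (D : set R) m (d1 d2 : nat -> R -> R) : jets D m d1 -> jets D m d2 ->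
  jets D m (fun k s => d1 k s - d2 k s).
Proof. by move=> h1 h2 k km; apply: der_in_subtract; [exact: h1|exact: h2]. Qed.

Lemma lip_in_subtract (D : set R) (M1 M2 : R) f g : lip_in D M1 f -> lip_in D M2 g ->
  lip_in D (M1 + M2) (fun s => f s - g s).
Proof.
move=> h1 h2 s t hs ht.
have -> : f s - g s - (f t - g t) = (f s - f t) - (g s - g t) by ring.
by apply: (le_trans (ler_normB _ _)); rewrite mulrDl; apply: lerD; [exact: h1|exact: h2].
Qed.

(** The spline stays within [2 * L * (b - a)] of the signal, and the signal within [C * (b - a)] of
    its value at [a]. Being on the side of the signal that faces zero at [a], the spline respects
    one bound because the signal does, and the other because [(b - a) * (C + 2 * L) <= N]. A step
    costs [m.+1] switches, plus at most one to set the initial slope. *)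
Lemma perfect_spline_step m (L N M C t a b : R) dg l : (0 < m)%N -> 0 <= M -> M < L ->
  jets `[0, t] m dg -> lip_in `[0, t] M (dg m) ->
  (forall s, 0 <= s <= t -> `|dg 0%N s| <= N) -> (forall s, 0 <= s <= t -> `|dg 1%N s| <= C) ->
  0 <= a -> a < b -> b <= t -> b - a <= 1 -> (b - a) * (C + 2 * L) <= N ->
  knots 0 a l -> (forall k, (k <= m)%N -> spl m L (dg^~ 0) l k a = dg k a) ->
  exists l', [/\ knots 0 b l', (size l' <= size l + m.+2)%N,
    forall s, s <= a -> spl m L (dg^~ 0) l' 0 s = spl m L (dg^~ 0) l 0 s,
    forall k, (k <= m)%N -> spl m L (dg^~ 0) l' k b = dg k b &
    forall s, a <= s <= b -> `|spl m L (dg^~ 0) l' 0 s| <= N].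
Proof.
move=> m0 M0 ML hj hl h0 h1 a0 ab bt ba1 baN hk hm; set c := dg^~ 0.
have ab' := ltW ab; have L0 : 0 < L by exact: le_lt_trans ML.
have sub : `[a, b]%classic `<=` `[0, t]%classic by exact: itv_cc_subset.
have hj' := jets_subset _ _ _ _ sub hj.
have hl' : lip_in `[a, b] M (dg m) by move=> x y hx hy; apply: hl; exact: sub.
have hlL : lip_in `[a, b] L (dg m).
  by move=> x y hx hy; apply: (le_trans (hl' x y hx hy)); apply: ler_wpM2r => //; exact: ltW.
(* The spline runs below the signal if the signal starts nonnegative, and above it otherwise. *)
pose sg : R := if 0 <= dg 0%N a then -1 else 1.
have sg1 : sg * sg = 1 by rewrite /sg; case: ifP; rewrite ?mulrNN mulr1.
have sgn : `|sg| = 1 by rewrite /sg; case: ifP; rewrite ?normrN normr1.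
(* Past the knots of [l], the slope at order [m] is [L * (-1) ^+ size l]. If this is not [sg * L],
   an extra knot at [a] corrects it. *)
have [l1 [hk1 sz1 sgl E1]] : exists l1, [/\ knots 0 a l1, (size l1 <= (size l).+1)%N,
    (-1) ^+ size l1 = sg & forall k s, (k <= m)%N -> s <= a -> spl m L c l1 k s = spl m L c l k s].
  have [e|ne] := eqVneq ((-1) ^+ size l : R) sg; first by exists l.
  exists (l ++ [:: a]); split.
  - by apply: knots_cat hk _ => //=; rewrite !lexx.
  - by rewrite size_cat addn1.
  - rewrite size_cat addn1 exprS mulN1r; move: ne; rewrite -signr_odd /sg.
    by case: odd; case: ifP => _; rewrite ?expr1 ?expr0 ?opprK ?eqxx.
  - by move=> k s km sa; apply: spl_cat => // x; rewrite inE => /eqP ->.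
have [y [sy hy] hrem] := principal_knots m dg a b M L sg ab M0 ML sg1 hj' hl'.
have hya := knots_all _ _ _ hy; have hl1a := knots_all _ _ _ hk1.
have ya s : s <= a -> {in y, forall x, s <= x}.
  by move=> sa x xy; have /andP[ax _] := hya x xy; exact: le_trans ax.
pose l' := l1 ++ y; pose Z k s := spl m L c l' k s.
have Za k s : (k <= m)%N -> s <= a -> Z k s = spl m L c l k s.
  by move=> km sa; rewrite /Z spl_cat ?E1 //; exact: ya.
have Zad k : (k <= m)%N -> Z k a = dg k a by move=> km; rewrite Za // hm.
have Zm s : a <= s -> Z m s = dg m a + sg * L * ((s - a) - 2 * alt 1 y s).
  move=> as_; rewrite -(Zad m (leqnn _)) /Z !spl_top !alt_cat (alt_le _ y a) ?mulr0 ?addr0; last exact: ya.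
  have l1a : {in l1, forall x, x <= a} by move=> x xl; have /andP[_ ?] := hl1a x xl.
  have := alt1_after l1 a s l1a as_; rewrite sgl => H.
  have -> : s - 2 * (alt 1 l1 s + sg * alt 1 y s) =
    (s - 2 * alt 1 l1 s - (a - 2 * alt 1 l1 a)) + (a - 2 * alt 1 l1 a) - 2 * sg * alt 1 y s by ring.
  by rewrite H; ring.
have hjZ : jets `[a, b] m Z by exact: jets_spl.
(* The same spline restarted at [a]: its values at [b] are a Taylor sum at [a] plus the term that
   [principal_knots] equates with [taylor_rem], so they match the signal. *)
pose V k s := spl m (sg * L) (fun j => dg j a) [seq x - a | x <- y] k (s - a).
have VE k s : V k s = taylor (m.+1 - k) (fun j => dg (k + j)%N a) (s - a)
    + sg * L * (pw (m.+1 - k) (s - a) - 2 * alt (m.+1 - k) y s).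
  by rewrite /V /spl alt_shift.
have hjV : jets `[a, b] m V by apply: jets_shift; exact: jets_spl.
have Va k : (k <= m)%N -> V k a = dg k a.
  move=> km; rewrite /V subrr spl_start // => x /mapP[x' x'y ->].
  by rewrite subr_ge0; have /andP[] := hya x' x'y.
have ZV k s : (k <= m)%N -> a <= s <= b -> Z k s = V k s.
  move=> km sab; apply/eqP; rewrite -subr_eq0; apply/eqP.
  apply: (jets_zero m (fun k s => Z k s - V k s) a b ab' (jets_subtract _ _ _ _ hjZ hjV)) => //.
    by move=> j jm; rewrite Zad // Va // subrr.
  move=> x /andP[ax _]; rewrite Zm // VE subSnn /taylor big_ord_recl big_ord0 addr0 addn0 pw0 pw1 mulr1.
  by rewrite subrr.
have Zb k : (k <= m)%N -> Z k b = dg k b.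
  move=> km; rewrite ZV // ?lexx ?ab' // VE subSn // -(hrem (m - k)%N (leq_subr _ _)).
  by rewrite /taylor_rem subKn // addrC subrK.
pose D k s := Z k s - dg k s.
have hjD : jets `[a, b] m D by exact: jets_subtract.
have sD s : a <= s <= b -> 0 <= sg * D 0%N s.
  apply: (one_sign m D y sg a b) => //.
    by move=> k km; rewrite /D Zad // Zb // !subrr.
  apply: (alt_mono_spline L sg a b y (dg m) (ltW L0) sgn hy hlL _ (dg m a)) => // x /andP[ax _].
  by rewrite /D Zm.
have hk' : knots 0 b l' by exact: knots_cat hk1 hy.
have hlZ : lip_in `[a, b] L (Z m) by exact: spl_lip (ltW L0) hk'.
have bD s : a <= s <= b -> `|D 0%N s| <= 2 * L * (b - a).
  move=> sab; have L20 : 0 <= L + L by lra.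
  have := jets_small m D (L + L) a b ab' L20 hjD _ (lip_in_subtract _ _ _ _ _ hlZ hlL) 0%N s isT sab.
  move=> /(_ (fun k km => ltac:(by rewrite /D Zad // subrr))) H.
  apply: (le_trans H); rewrite (_ : L + L = 2 * L); last by ring.
  apply: ler_wpM2l; first lra.
  by rewrite subn0 exprS ler_piMr ?subr_ge0 // exprn_ile1 ?subr_ge0.
exists l'; split => //.
- by rewrite size_cat sy -(addSnnS (size l)) leq_add2r.
- by move=> s sa; exact: Za.
move=> s sab; have /andP[as_ sb] := sab.
have s0t : 0 <= s <= t by rewrite (le_trans a0) // (le_trans sb).
have H0 := h0 s s0t; have H1 := sD s sab; have H2 := bD s sab.
have H3 : `|dg 0%N s - dg 0%N a| <= C * (b - a).
  have hd : der_in `[a, s] (dg 0%N) (dg 1%N).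
    by apply: der_in_subset (hj' 0%N m0); apply: itv_cc_subset.
  have H : `|dg 0%N s - dg 0%N a| <= C * (s - a).
    apply: mean_value_norm hd _ => // x /andP[ax xs]; apply: h1.
    by rewrite (le_trans a0) // (le_trans xs) // (le_trans sb).
  apply: (le_trans H); apply: ler_wpM2l; last by rewrite lerB.
  exact: le_trans (h1 s s0t).
rewrite -/(Z 0%N s) (_ : Z 0%N s = dg 0%N s + D 0%N s); last by rewrite /D addrC subrK.
move: H0 H1 H2 H3; rewrite /sg !ler_norml; case: ifP => da.
  move=> /andP[? ?] ? /andP[? ?] /andP[? ?]; apply/andP; split; nra.
move=> /andP[? ?] ? /andP[? ?] /andP[? ?].
have : dg 0%N a < 0 by rewrite ltNge da.
by move=> ?; apply/andP; split; nra.
Qed.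

(** The step length depends only on [m], [L], [N], [t], so the number [r] of knots is common to all
    signals and the splines form a family with finitely many parameters. *)
Lemma perfect_spline_approx m (L N t : R) : (0 < m)%N -> 0 <= L -> 0 < N -> 0 < t ->
  exists r, forall M dg, 0 <= M -> M < L \/ M = 0 /\ L = 0 ->
    jets `[0, t] m dg -> lip_in `[0, t] M (dg m) -> (forall s, 0 <= s <= t -> `|dg 0%N s| <= N) ->
    exists l, [/\ size l = r, knots 0 t l,
      forall s, 0 <= s <= t -> `|spl m L (dg^~ 0) l 0 s| <= N &
      forall k, (k <= m)%N -> spl m L (dg^~ 0) l k t = dg k t].
Proof.
move=> m0 L0 N0 t0; have [C C0 hC] := derivatives_bound N t (ltW N0) t0 m L L0.
(* With more than [x] steps, [dl = t / n] satisfies both [dl <= 1] and [dl * (C + 2 * L) <= N]. *)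
pose x := t * (1 + (C + 2 * L) / N).
pose n := (Num.bound x).+1.
have q0 : 0 <= (C + 2 * L) / N by apply: divr_ge0; lra.
have x0 : 0 <= x by apply: mulr_ge0; lra.
have xn : x < n%:R.
  by have h := archi_boundP x0; apply: lt_trans h _; rewrite ltr_nat.
have n0 : 0 < n%:R :> R by [].
pose dl := t / n%:R.
have dl0 : 0 < dl by exact: divr_gt0.
have dl1 : dl <= 1.
  rewrite ler_pdivrMr // mul1r; apply: le_trans (ltW xn); rewrite /x mulrDr mulr1 lerDl.
  by rewrite mulr_ge0 // ltW.
have dlN : dl * (C + 2 * L) <= N.
  rewrite /dl mulrAC ler_pdivrMr //.
  have -> : t * (C + 2 * L) = N * (t * ((C + 2 * L) / N)) by field; rewrite gt_eqF.
  apply: ler_wpM2l; first exact: ltW.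
  by apply: le_trans (ltW xn); rewrite /x mulrDr mulr1 lerDr ltW.
exists (n * m.+2)%N => M dg M0 [ML|[M00 L00]] hj hl h0; last first.
  (* For [L = 0] knots have no effect, and the signal is already a polynomial on [[0, t]]. *)
  have sp k s : (k <= m)%N -> 0 <= s <= t -> spl m L (dg^~ 0) (nseq (n * m.+2) t) k s = dg k s.
    move=> km st; apply/eqP; rewrite -subr_eq0; apply/eqP.
    have nt : {in nseq (n * m.+2) t, forall x, 0 <= x} by move=> y /nseqP[-> _]; exact: ltW.
    apply: (jets_zero m (fun k s => spl m L (dg^~ 0) (nseq (n * m.+2) t) k s - dg k s) 0 t (ltW t0)) => //.
    - by apply: jets_subtract => //; exact: jets_spl.
    - by move=> j jm; rewrite spl_start // subrr.
    move=> y yt; rewrite spl_top L00 mul0r addr0; have := hl 0 y; rewrite M00 mul0r normr_le0.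
    by rewrite /= !in_itv /= lexx ltW // => /(_ isT yt) /eqP.
  exists (nseq (n * m.+2) t); split.
  - by rewrite size_nseq.
  - elim: (n * m.+2)%N (0) (ltW t0) => [|j IH] a at_ //=; rewrite at_ lexx; split=> //; exact: IH.
  - by move=> s st; rewrite sp //; exact: h0.
  - by move=> k km; rewrite sp // ltW // lexx.
have h1 s : 0 <= s <= t -> `|dg 1%N s| <= C.
  apply: (hC dg) => // u v hu hv; apply: (le_trans (hl u v hu hv)).
  by apply: ler_wpM2r => //; exact: ltW.
have main i : (i <= n)%N -> exists l, [/\ knots 0 (i%:R * dl) l, (size l <= i * m.+2)%N,
   forall s, 0 <= s <= i%:R * dl -> `|spl m L (dg^~ 0) l 0 s| <= N &
   forall k, (k <= m)%N -> spl m L (dg^~ 0) l k (i%:R * dl) = dg k (i%:R * dl)].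
  elim: i => [|i IH] lei.
    exists [::]; split => //; last by move=> k km; rewrite mul0r spl_start.
    move=> s; rewrite mul0r => /andP[s0 s0']; have -> : s = 0 by apply/eqP; rewrite eq_le s0 s0'.
    by rewrite spl_start //; apply: h0; rewrite lexx ltW.
  have [l [hk sz hb hm]] := IH (ltnW lei).
  have E : i.+1%:R * dl - i%:R * dl = dl by rewrite -mulrBl -natrB // subSnn mul1r.
  have [] := perfect_spline_step m L N M C t (i%:R * dl) (i.+1%:R * dl) dg l m0 M0 ML hj hl h0 h1 _ _ _ _ _ hk hm.
  - by rewrite mulr_ge0 // ltW.
  - by rewrite ltr_pM2r // ltr_nat.
  - by rewrite /dl mulrCA ler_piMr ?(ltW t0) // ler_pdivrMr // mul1r ler_nat.
  - by rewrite E.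
  - by rewrite E.
  move=> l' [hk' sz' ext hm' hb']; exists l'; split => //.
    by rewrite mulSn addnC (leq_trans sz') // leq_add2r.
  move=> s /andP[s0 sb]; have [sa|as_] := leP s (i%:R * dl).
    by rewrite ext //; apply: hb; rewrite s0.
  by apply: hb'; rewrite (ltW as_).
have [l [hk sz hb hm]] := main n (leqnn _).
have nt : n%:R * dl = t by rewrite /dl mulrC divfK // gt_eqF.
rewrite nt in hk hb hm.
(* Knots at [t] pad the list to the common length without changing the spline on [[0, t]]. *)
pose p := nseq (n * m.+2 - size l) t.
have hp s : s <= t -> {in p, forall y, s <= y} by move=> st y /nseqP[-> _].
exists (l ++ p); split.
- by rewrite size_cat size_nseq subnKC.
- apply: (knots_cat 0 t t) => //; first exact: ltW.
  by rewrite /p; elim: (_ - _)%N => [|j IH] //=; rewrite !lexx.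
- by move=> s st; rewrite spl_cat ?hb //; apply: hp; case/andP: st.
- by move=> k km; rewrite spl_cat ?hm //; exact: hp.
Qed.

End PerfectSplineApproximation.

(** * Membership of splines in the signal classes *)

Section SplinesInF.
Context {R : realType}.
Implicit Types (a b s : R) (l : seq R).

Lemma ae_half_derivable_tpow1 (c : R) : ae_half_derivable (fun s => tpow 1 (s - c)).
Proof.
apply: negligibleS (negligible_seq [:: c]) => t /= H; rewrite inE.
apply: contra_notT H => tc t0.
have P : exists k, forall s, `|s - t| < `|t - c| -> tpow 1 (s - c) - tpow 1 (t - c) = k * (s - t).
  have [ct|ct] := ltP c t.
    exists 1 => s; rewrite !tpow1E (gtr0_norm (_ : 0 < t - c)) ?subr_gt0 // ltr_norml => /andP[? ?].
    by rewrite !max_r; lra.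
  have {}ct : t < c by rewrite lt_neqAle tc ct.
  exists 0 => s; rewrite !tpow1E (ltr0_norm (_ : t - c < 0)) ?subr_lt0 // ltr_norml => /andP[? ?].
  by rewrite !max_l; lra.
have [k hk] := P.
have h : half_diff_quot (fun s => tpow 1 (s - c)) t @ within `[0, +oo[ t^' --> k.
  apply/half_diff_quot_cvgP => e e0; exists `|t - c|; first by rewrite normr_gt0 subr_eq0.
  by move=> s s0 sd; rewrite hk // subrr normr0 mulr_ge0 // ltW.
by have [] := half_derivativeE _ _ _ t0 h.
Qed.

Lemma ae_half_derivable_alt1 l : ae_half_derivable (fun s : R => alt 1 l s).
Proof.
elim: l => [|c l IH] /=.
  apply: ae_half_derivable_all => t t0.
  by have [] := der_in_half_derive (fun=> 0) (fun=> 0) t (der_in_cst _ _) t0.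
have := ae_half_derivable_lin _ _ 1 (-1) (ae_half_derivable_tpow1 c) IH.
by apply: ae_imply => t h t0; have := h t0; under eq_fun do rewrite mul1r mulN1r.
Qed.

Lemma spl_F m (L : R) (c : nat -> R) l : 0 <= L -> lip_in `[0, +oo[ L (spl m L c l m) ->
  F m L (spl m L c l 0) /\
  forall k s, (k <= m)%N -> 0 <= s -> half_deriven k (spl m L c l 0) s = spl m L c l k s.
Proof.
move=> L0 hl; apply: jets_F => //; first exact: jets_spl.
have h1 : ae_half_derivable (fun s : R => s).
  apply: ae_half_derivable_all => t t0.
  by have [] := der_in_half_derive id (fun=> 1) t (der_in_id _) t0.
have h2 := ae_half_derivable_lin _ _ L (- (2 * L)) h1 (ae_half_derivable_alt1 l).
have h3 : ae_half_derivable (fun=> c m).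
  apply: ae_half_derivable_all => t t0.
  by have [] := der_in_half_derive (fun=> c m) (fun=> 0) t (der_in_cst _ _) t0.
have := ae_half_derivable_lin _ _ 1 1 h3 h2.
apply: ae_imply => t h t0; have := h t0.
suff -> : spl m L c l m = (fun s => 1 * c m + 1 * (L * s + - (2 * L) * alt 1 l s)) by [].
by apply/funext => s; rewrite spl_top; ring.
Qed.

Lemma spl_eq m (L : R) (c c' : nat -> R) l k s : (forall j, (j <= m)%N -> c j = c' j) -> (k <= m)%N ->
  spl m L c l k s = spl m L c' l k s.
Proof.
move=> h km; rewrite /spl; congr (_ + _); apply: eq_bigr => j _; rewrite h //.
by have := ltn_ord j; rewrite ltn_subRL.
Qed.

Lemma tpow_continuous n : continuous (fun x : R => tpow n.+1 x).
Proof.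
case: n => [|n].
  have -> : (fun x : R => tpow 1 x) = (fun x => 2^-1 * (x + `|x|)).
    apply/funext => x; rewrite tpow1E; case: (leP 0 x) => x0.
      by rewrite ger0_norm //; field.
    by rewrite ltr0_norm //; field.
  move=> x; apply: cvgM; first exact: cvg_cst.
  by apply: cvgD; [exact: cvg_id|apply: cvg_norm; exact: cvg_id].
have := der_in_continuous _ _ (der_in_tpow setT (0 : R) n).
by rewrite (_ : (fun s : R => tpow n.+2 (s - 0)) = (fun x => tpow n.+2 x)) //; apply/funext => x; rewrite subr0.
Qed.

End SplinesInF.

(** * Attainment of [gbar], and finiteness of the contact set *)

Section Extremal.
Context {R : realType}.
Implicit Types (a b s : R) (l : seq R).

Lemma rV_norm_le n (v : 'rV[R]_n) (M : R) : 0 <= M -> (forall j, `|v ord0 j| <= M) -> `|v| <= M.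
Proof.
move=> M0 h; rewrite [`|v|]mx_normrE; apply/bigmax_leP; split => // -[i j] _ /=.
by rewrite ord1.
Qed.

Lemma closed_family (T : topologicalType) (I : Type) (P : I -> Prop) (f : I -> T -> R) (a : I -> R) :
  (forall i, continuous (f i)) -> closed [set x | forall i, P i -> f i x <= a i].
Proof.
move=> cf; have -> : [set x | forall i, P i -> f i x <= a i] = \bigcap_(i in P) (f i @^-1` [set y | y <= a i]).
  by apply/seteqP; split => x h i; exact: h.
apply: closed_bigI => i _; apply: closed_comp; last exact: closed_le.
by move=> x _; exact: cf.
Qed.

Section SplineFamily.
Context (m r : nat) (L : R).

(** A spline as one vector: [m.+1] initial derivatives, then [r] knots in any order. Entries beyond
    index [m] default to the first one and are never read for orders up to [m]. *)
Definition pcoef (v : 'rV[R]_(m.+1 + r)) : nat -> R := fun j => v ord0 (lshift r (inord j)).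
Definition pknots (v : 'rV[R]_(m.+1 + r)) : seq R := [seq v ord0 (rshift m.+1 j) | j <- enum 'I_r].
Definition pspl k s v := spl m L (pcoef v) (pknots v) k s.

Lemma rV_coord_continuous n (j : 'I_n) : continuous (fun v : 'rV[R]_n => v ord0 j).
Proof.
apply: (rV_lipschitz_continuous _ _ 1) => // u v; rewrite mul1r.
have := rV_coord_le _ (u - v) j; rewrite !mxE ler_norml => /andP[_]; lra.
Qed.

Lemma pspl_continuous k s : (k <= m)%N -> continuous (pspl k s).
Proof.
move=> km; have cst (x : R) : continuous (fun _ : 'rV[R]_(m.+1 + r) => x) by exact: cst_continuous.
have ca : continuous (fun v => alt (m - k).+1 (pknots v) s).
  rewrite /pknots; elim: (enum 'I_r) => [|j js IH] /=; first exact: cst.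
  have c1 : continuous (fun v : 'rV[R]_(m.+1 + r) => tpow (m - k).+1 (s - v ord0 (rshift m.+1 j))).
    move=> v; apply: (@continuous_comp _ _ _ (fun v : 'rV[R]_(m.+1 + r) => s - v ord0 (rshift m.+1 j))).
      exact: (continuousB (cst s v) (rV_coord_continuous _ _ v)).
    exact: tpow_continuous.
  by move=> v; exact: (continuousB (c1 v) (IH v)).
have ct : continuous (fun v => taylor (m.+1 - k) (fun j => pcoef v (k + j)%N) s).
  rewrite /taylor; elim: (m.+1 - k)%N => [|n IH].
    have -> : (fun v => \sum_(j < 0) pcoef v (k + j) * pw j s) = (fun=> 0).
      by apply/funext => v; rewrite big_ord0.
    exact: cst.
  have -> : (fun v => \sum_(j < n.+1) pcoef v (k + j) * pw j s) =
     (fun v => \sum_(j < n) pcoef v (k + j) * pw j s + pcoef v (k + n) * pw n s).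
    by apply/funext => v; rewrite big_ord_recr.
  by move=> v; exact: (continuousD (IH v) (continuousM (rV_coord_continuous _ _ v) (cst (pw n s) v))).
rewrite /pspl /spl subSn // in ct *.
move=> v; exact: (continuousD (ct v) (continuousM (cst L v) (continuousB (cst _ v) (continuousM (cst 2 v) (ca v))))).
Qed.

End SplineFamily.

(** A maximiser over the compact family is compared with an arbitrary [g] in [G] through
    [(1 - e1) * g], whose Lipschitz constant is strictly below [L] when [L > 0] and which is
    therefore matched by a spline of the family; then [e1] is sent to 0. *)
Lemma perfect_spline_extremal m (L N t : R) i : (0 < m)%N -> 0 <= L -> 0 < N -> 0 < t -> (i <= m)%N ->
  exists (c : nat -> R) l, [/\ lip_in `[0, +oo[ L (spl m L c l m),
    G m L N t (spl m L c l 0) & spl m L c l i t = gbarR m L N i t].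
Proof.
move=> m0 L0 N0 t0 im; have N0' := ltW N0; have t0' := ltW t0.
have [r hr] := perfect_spline_approx m L N t m0 L0 N0 t0.
have [C C0 hC] := derivatives_bound N t N0' t0 m L L0.
(* Bounds the initial derivatives by the Landau constant and the knots by [t]. *)
pose M0 := Num.max C t.
have M00 : 0 <= M0 by rewrite le_max C0.
pose S k s (v : 'rV[R]_(m.+1 + r)) := pspl m r L k s v.
have cS k s : (k <= m)%N -> continuous (S k s) by exact: pspl_continuous.
have cn k s : (k <= m)%N -> continuous (fun v => `|S k s v|).
  move=> km v; apply: (@continuous_comp _ _ _ (S k s) (fun x => `|x|)); first exact: cS.
  exact: norm_continuous.
pose K1 := [set v : 'rV[R]_(m.+1 + r) | forall j : 'I_(m.+1 + r), True -> `|v ord0 j| <= M0].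
(* The Lipschitz condition is imposed directly on the whole half-line: it is closed in [v], and it
   is what [spl_F] asks for. *)
pose K2 := [set v | forall p : R * R, (0 <= p.1 /\ 0 <= p.2) -> `|S m p.1 v - S m p.2 v| <= L * `|p.1 - p.2|].
pose K3 := [set v | forall s, (0 <= s <= t) -> `|S 0%N s v| <= N].
pose K := K1 `&` (K2 `&` K3).
have cK : compact K.
  apply: bounded_closed_compact.
    exists M0; split; [by rewrite num_real|move=> M MM v [h1 _] /=].
    by apply: rV_norm_le => [|j]; [exact: le_trans (ltW MM)|apply: le_trans (ltW MM); exact: h1].
  apply: closedI; first last.
    apply: closedI.
      apply: (@closed_family _ _ _ (fun p v => `|S m p.1 v - S m p.2 v|)) => p v.
      apply: (@continuous_comp _ _ _ (fun v => S m p.1 v - S m p.2 v) (fun x => `|x|)); last exact: norm_continuous.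
      exact: (continuousB (cS m p.1 (leqnn _) v) (cS m p.2 (leqnn _) v)).
    by apply: (@closed_family _ _ _ (fun s v => `|S 0%N s v|)) => s; exact: cn.
  apply: (@closed_family _ _ _ (fun j (v : 'rV[R]_(m.+1 + r)) => `|v ord0 j|)) => j v.
  apply: (@continuous_comp _ _ _ (fun v : 'rV[R]_(m.+1 + r) => v ord0 j) (fun x => `|x|)); first exact: rV_coord_continuous.
  exact: norm_continuous.
have approx M dg : 0 <= M -> M < L \/ M = 0 /\ L = 0 -> jets `[0, t] m dg ->
    lip_in `[0, t] M (dg m) -> (forall s, 0 <= s <= t -> `|dg 0%N s| <= N) ->
    exists2 v, K v & S i t v = dg i t.
  move=> M0' ML hj hl h0; have [l [sl hk hb hm]] := hr M dg M0' ML hj hl h0.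
  have hlL : lip_in `[0, t] L (dg m).
    move=> x y hx hy; apply: (le_trans (hl x y hx hy)); apply: ler_wpM2r => //.
    by case: ML => [/ltW //|[-> ->]].
  pose v : 'rV[R]_(m.+1 + r) := row_mx (\row_j dg j 0) (\row_j nth 0 l j).
  have El : pknots m r v = l.
    rewrite /pknots; under eq_map do rewrite row_mxEr mxE.
    by rewrite (map_comp (nth 0 l) val) val_enum_ord -sl map_nth_iota0 // take_size.
  have Ec j : (j <= m)%N -> pcoef m r v j = dg j 0.
    by move=> jm; rewrite /pcoef row_mxEl mxE inordK.
  have ES k s : (k <= m)%N -> S k s v = spl m L (dg^~ 0) l k s.
    by move=> km; rewrite /S /pspl El; apply: spl_eq.
  exists v; last by rewrite ES // hm.
  split; [|split].
  - move=> j _; case: (split_ordP j) => k ->.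
      rewrite row_mxEl mxE le_max; apply/orP; left; apply: (hC dg) => //; first by rewrite -ltnS.
      by rewrite lexx.
    rewrite row_mxEr mxE le_max; apply/orP; right.
    have kl : nth 0 l k \in l by rewrite mem_nth // sl.
    by have /andP[? ?] := knots_all _ _ _ hk _ kl; rewrite ger0_norm.
  - move=> p [p1 p2]; rewrite !ES //.
    by apply: (spl_lip setT m L 0 t).
  - by move=> s st; rewrite ES //; exact: hb.
have K0 : K !=set0.
  have [||||| v Kv _] := approx 0 (fun _ _ => 0); last by exists v.
  - by [].
  - by move: L0; rewrite le_eqVlt => /orP[/eqP <-|]; [right|left].
  - by move=> k km; exact: der_in_cst.
  - by move=> x y _ _; rewrite subrr normr0 mul0r.
  - by move=> s _; rewrite normr0.
have [u uK hu] := @EVT_max_rV R _ (S i t) K K0 cK (continuous_subspaceT (cS i t im)).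
move: uK; rewrite inE => -[k1 [k2 k3]].
have lipu : lip_in `[0, +oo[ L (spl m L (pcoef m r u) (pknots m r u) m).
  by move=> x y; rewrite /= !in_itv /= !andbT => x0 y0; exact: (k2 (x, y)).
exists (pcoef m r u), (pknots m r u).
have [Fu Eu] := spl_F m L _ _ L0 lipu.
have Gu : G m L N t (spl m L (pcoef m r u) (pknots m r u) 0) by split => // s; exact: k3.
split => //; apply/eqP; rewrite eq_le; apply/andP; split.
  rewrite -Eu //; apply: (le_trans (ler_norm _)); exact: gbarR_ub.
apply: gbarR_le => // g Gg; have [Cb Cb0 hCb] := G_derivatives_bound m L N t L0 N0' t0.
have tt : 0 <= t <= t by rewrite lexx t0'.
have Hb := hCb g Gg i t im tt; have [Fg gN] := Gg.
apply/ler_addgt0Pr => e e0.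
pose e1 := Num.min (1 / 2) (e / (Cb + 1)).
have e10 : 0 < e1 by rewrite lt_min; apply/andP; split; [lra|apply: divr_gt0 => //; lra].
have e11 : e1 <= 1 / 2 by rewrite ge_min lexx.
have e12 : e1 * (Cb + 1) <= e by rewrite -ler_pdivlMr ?ge_min ?lexx ?orbT //; lra.
have p0 : 0 <= 1 - e1 by lra.
have sub : `[0, t]%classic `<=` (`[0, +oo[%classic : set R) by move=> x; rewrite /= !in_itv /= => /andP[->].
have [||||| v Kv Sv] := approx ((1 - e1) * L) (fun k s => (1 - e1) * half_deriven k g s).
- by rewrite mulr_ge0.
- move: L0; rewrite le_eqVlt => /orP[/eqP <-|Lp]; [by right; rewrite mulr0|left].
  by rewrite mulrBl mul1r gtrBl mulr_gt0.
- move=> k km; apply: der_in_scale; apply: der_in_subset sub _; exact: F_jets Fg _ km.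
- move=> x y hx hy; rewrite -mulrBr normrM (ger0_norm p0) -mulrA; apply: ler_wpM2l => //.
  by apply: (F_lip m L g L0 Fg); exact: sub.
- move=> s st; rewrite normrM (ger0_norm p0); have := gN s st.
  by have := normr_ge0 (half_deriven 0 g s); rewrite /=; nra.
have : S i t v <= S i t u by apply: hu; rewrite inE.
rewrite Sv -/(S i t u) => H; have := ler_norm (half_deriven i g t) => H2.
have : e1 * half_deriven i g t <= e1 * Cb by apply: ler_wpM2l; lra.
rewrite /S /pspl in H; lra.
Qed.

(** Each knot contributes either zero or the polynomial [pw n (s - c)], so finitely many polynomials
    cover all pieces, and their coefficients of degree [n] are integer multiples of the inverse
    factorial. *)
Lemma alt_polys n l : exists2 Q : seq {poly R},
  forall s, exists2 q, q \in Q & alt n l s = q.[s] &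
  forall q, q \in Q -> exists z : int, q`_n * n`!%:R = z%:~R.
Proof.
have f0 : n`!%:R != 0 :> R by rewrite pnatr_eq0 -lt0n fact_gt0.
elim: l => [|c l [Q hQ hz]].
  exists [:: 0] => [s|q]; first by exists 0; rewrite ?inE // horner0.
  by rewrite inE => /eqP ->; exists 0; rewrite coef0 mul0r.
pose T := n`!%:R^-1 *: ('X - c%:P) ^+ n.
have TE s : T.[s] = pw n (s - c) by rewrite hornerZ horner_exp hornerXsubC mulrC.
have Tn : T`_n = n`!%:R^-1.
  have := monic_exp n (monicXsubC c); rewrite monicE lead_coefE size_exp_XsubC /= => /eqP e.
  by rewrite coefZ e mulr1.
exists ([seq - q | q <- Q] ++ [seq T - q | q <- Q]) => [s|q].
  have [q qQ e] := hQ s; rewrite /=; have [cs|cs] := leP 0 (s - c).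
    exists (T - q); first by rewrite mem_cat (map_f (fun q => T - q) qQ) orbT.
    by rewrite tpow_ge0 // hornerD hornerN TE e.
  exists (- q); first by rewrite mem_cat (map_f (fun q => - q) qQ).
  by rewrite /tpow ifF ?sub0r ?hornerN ?e //; apply/negbTE; rewrite -ltNge.
rewrite mem_cat => /orP[/mapP|/mapP] [q' q'Q ->]; have [z hzq] := hz q' q'Q.
  by exists (- z); rewrite coefN mulNr hzq mulrNz.
by exists (1 - z); rewrite coefB Tn mulrBl mulVf // hzq intrB.
Qed.

Lemma polys_zeros (Q : seq {poly R}) a b : {in Q, forall q, q != 0} ->
  exists z : seq R, forall q x, q \in Q -> a <= x <= b -> root q x -> x \in z.
Proof.
elim: Q => [|p Q IH] h; first by exists [::].
have [z1 h1] := poly_zeros p a b (h p (mem_head _ _)).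
have [z2 h2] := IH (fun q qQ => h q (mem_behead (s := p :: Q) qQ)).
exists (z1 ++ z2) => q x; rewrite inE mem_cat => /predU1P[->|qQ] xab rx.
  by rewrite h1.
by rewrite (h2 q) ?orbT.
Qed.

(* If [0 < L], the leading coefficient of each piece is an odd multiple of [L / m.+1`!]. *)
Lemma contact_finite m (L N t : R) c l : 0 < L \/ (exists2 j, (0 < j <= m)%N & c j != 0) /\ L = 0 ->
  exists z : seq R, forall s, 0 <= s <= t -> `|spl m L c l 0 s| = N -> s \in z.
Proof.
move=> H; have [Q hQ hz] := alt_polys m.+1 l.
pose p (q : {poly R}) := tpoly m.+1 c + L *: (m.+1`!%:R^-1 *: 'X^(m.+1) - 2 *: q).
have pE q s : alt m.+1 l s = q.[s] -> spl m L c l 0 s = (p q).[s].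
  move=> e; rewrite /spl subn0 e /p hornerD hornerZ hornerD hornerN !hornerZ hornerXn -tpolyE /pw.
  by rewrite mulrC [in RHS](mulrC _ (s ^+ _)); congr (_ + _); rewrite mulrC.
have f0 : m.+1`!%:R != 0 :> R by rewrite pnatr_eq0 -lt0n fact_gt0.
have pn q (e : R) : q \in Q -> p q - e%:P != 0.
  move=> qQ; case: H => [L0|[[j /andP[j0 jm] cj] L0]].
    apply/eqP => /(congr1 (fun r : {poly R} => r`_m.+1)).
    rewrite coefB coefC /= subr0 coefD coefZ coefB !coefZ coefXn eqxx mulr1 coef_poly ltnn add0r coef0.
    move=> /eqP; rewrite mulf_eq0 gt_eqF //= => /eqP /(congr1 (fun x => x * m.+1`!%:R)).
    rewrite mul0r mulrBl mulVf // -mulrA; have [z ->] := hz q qQ.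
    move=> /eqP; rewrite (_ : 1 - 2 * z%:~R = (1 - 2 * z)%:~R); last by rewrite intrB intrM.
    rewrite intr_eq0 subr_eq0 => /eqP /(congr1 (fun x => odd `|x|%N)).
    by rewrite abszM oddM.
  rewrite /p L0 scale0r addr0; apply/eqP => /(congr1 (fun r : {poly R} => r`_j)).
  rewrite coefB coefC -[(j == 0)%N]negbK -lt0n j0 /= subr0 coef_poly ltnS jm coef0 => /eqP.
  rewrite mulf_eq0 (negbTE cj) /= invr_eq0 pnatr_eq0; apply/negP.
  by rewrite -lt0n fact_gt0.
have [|z hzz] := polys_zeros ([seq p q - N%:P | q <- Q] ++ [seq p q - (- N)%:P | q <- Q]) 0 t.
  by move=> q; rewrite mem_cat => /orP[/mapP|/mapP] [q' q'Q ->]; exact: pn.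
exists z => s st sN; have [q qQ e] := hQ s; rewrite (pE q s e) in sN.
have [p0|p0] := leP 0 (p q).[s].
  apply: (hzz (p q - N%:P)) => //; first by rewrite mem_cat (map_f (fun q => p q - N%:P) qQ).
  by rewrite /root hornerD hornerN hornerC subr_eq0 -sN ger0_norm.
apply: (hzz (p q - (- N)%:P)) => //; first by rewrite mem_cat (map_f (fun q => p q - (- N)%:P) qQ) orbT.
by rewrite /root hornerD hornerN hornerC opprK -sN ltr0_norm // subrr.
Qed.

End Extremal.

(** * Optimal linear functionals *)

Section OptimalFunctional.
Context {R : realType}.
Implicit Types (f g : R -> R) (a b s : R) (l : seq R).

(** Nothing is known about [f] at negative arguments; freezing it there gives a function continuous
    on the whole line. *)
Lemma F_extend_continuous m (L : R) f : 0 <= L -> F m L f -> continuous (fun s => f (Num.max 0 s)).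
Proof.
move=> L0 Ff x; apply/cvgrPdist_le => e e0.
have x0 : 0 <= Num.max 0 x by rewrite le_max lexx.
have [d d0 hd] := F_continuous m L f _ e L0 Ff x0 e0.
apply/nbhs_ballP; exists d => //= s; rewrite /ball /= => xs.
rewrite distrC; apply: hd; first by rewrite le_max lexx.
apply: le_lt_trans xs; rewrite distrC ler_norml; apply/andP.
by have := ler_norm (x - s); have := ler_norm (s - x); rewrite (distrC s) => ? ?;
  case: (leP 0 x) => ?; case: (leP 0 s) => ?; split; lra.
Qed.

(** The monomial of degree [k] with value [N] at [t] is a competitor. For [L = 0] this forces the
    extremal polynomial to be nonconstant. *)
Lemma gbarR_gt0 m (L N t : R) k : 0 <= L -> 0 < N -> 0 < t -> (0 < k <= m)%N -> 0 < gbarR m L N k t.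
Proof.
move=> L0 N0 t0 /andP[k0 km].
have pt : 0 < pw k t by rewrite divr_gt0 ?exprn_gt0 // ltr0n fact_gt0.
pose c j := if j == k then N / pw k t else 0.
have lz : lip_in `[0, +oo[ 0 (spl m 0 c [::] m).
  by move=> x y _ _; rewrite !spl_top !mul0r subrr normr0.
have [Fs Es] := spl_F m 0 c [::] (lexx _) lz.
have E0 s : spl m 0 c [::] 0 s = N / pw k t * pw k s.
  rewrite /spl mul0r addr0 /taylor subn0 (bigD1 (inord k : 'I_m.+1)) //= big1.
    by rewrite addr0 inordK // /c eqxx.
  move=> j jk; rewrite /c ifF ?mul0r //; apply/negbTE; apply: contra jk => /eqP <-.
  by rewrite inord_val.
have Ek : spl m 0 c [::] k t = N / pw k t.
  rewrite /spl mul0r addr0 subSn // /taylor big_ord_recl /= pw0 mulr1 addn0 /c eqxx big1 ?addr0 // => j _.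
  by rewrite ifF ?mul0r //; apply/negbTE; rewrite /bump /= gtn_eqF // -[X in (X < _)%N]addn0 ltn_add2l.
have Gs : G m L N t (spl m 0 c [::] 0).
  split; first exact: F_le Fs.
  move=> s /andP[s0 st]; rewrite E0 ger0_norm; last first.
    by apply: mulr_ge0; [apply: divr_ge0; exact: ltW|exact: pw_ge0].
  rewrite mulrAC ler_pdivrMr // ler_pM2l // ler_wpM2r ?invr_ge0 //.
  by apply: lerXn2r; rewrite ?nnegrE // ltW.
have := gbarR_ub m L N k t _ km L0 (ltW N0) t0 Gs; rewrite (Es _ _ km (ltW t0)) Ek => H.
apply: lt_le_trans H; rewrite gtr0_norm divr_gt0 //.
Qed.

(* A signal bounded by [N] on the contact set of an extremal [g] can be mixed into [g] with a small
   weight without violating the bound [N] on the whole of [0, t]. *)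
Lemma contact_sufficient m (L N t : R) k g l f : 0 <= L -> 0 < N -> 0 < t -> (k <= m)%N ->
  G m L N t g -> half_deriven k g t = gbarR m L N k t ->
  (forall s, 0 <= s <= t -> `|g s| = N -> s \in l) ->
  F m L f -> (forall x, x \in l -> `|f x| <= N) -> half_deriven k f t <= gbarR m L N k t.
Proof.
move=> L0 N0 t0 km [Fg gN] gext gl Ff fl; rewrite leNgt; apply/negP => fgt.
have [_ gb0] := gbarE m L N k t km L0 (ltW N0) t0.
set y := half_deriven k f t in fgt; have y0 : 0 < y by exact: le_lt_trans fgt.
(* Scaling by [r < 1] makes [f] strictly smaller than [N] at the contact points, while its
   derivative, now halfway between [y] and [gbar], still exceeds [gbar]. *)
pose r := (y + gbarR m L N k t) / (2 * y).
have ry : r * y = (y + gbarR m L N k t) / 2 by rewrite /r; field; rewrite gt_eqF.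
have r0 : 0 <= r by apply: divr_ge0; lra.
have r1 : r < 1 by rewrite ltr_pdivrMr ?mulr_gt0 // mul1r; lra.
have [F1 E1] := F_scale m L r f L0 Ff.
have {}F1 : F m L (fun s => r * f s).
  by apply: F_le F1; rewrite ger0_norm // ler_piMl // ltW.
have D1 : half_deriven k (fun s => r * f s) t = r * y by rewrite E1 // ltW.
set f1 := (fun s => r * f s) in F1 D1.
suff [x [/andP[x0 x1] hx]] : exists x, 0 < x <= 1 /\ forall s, 0 <= s <= t -> `|(1 - x) * g s + x * f1 s| <= N.
  have xx : 0 <= x <= 1 by rewrite ltW.
  have [Fm Em] := F_convex m L x g f1 L0 xx Fg F1.
  have := gbarR_ub m L N k t _ km L0 (ltW N0) t0 (conj Fm hx).
  rewrite Em //; last exact: ltW.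
  rewrite gext D1 ry => H; have := le_trans (ler_norm _) H.
  have : x * gbarR m L N k t < x * ((y + gbarR m L N k t) / 2) by rewrite ltr_pM2l //; lra.
  lra.
(* The points where [f1] could break the bound form a compact set away from the contact set, so [g]
   is bounded there by a constant below [N]. *)
pose A := [set s | 0 <= s <= t /\ N <= `|f1 (Num.max 0 s)|].
have cf1 := F_extend_continuous m L f1 L0 F1; have cg := F_extend_continuous m L g L0 Fg.
have cA : compact A.
  apply: (subclosed_compact _ (@segment_compact R 0 t)); last by move=> s [].
  have -> : A = `[0, t]%classic `&` ((fun s => `|f1 (Num.max 0 s)|) @^-1` [set z | N <= z]).
    by apply/seteqP; split => s [h1 h2]; (split; [exact: h1|exact: h2]).
  apply: closedI; first exact: interval_closed.
  by apply: closed_comp; [move=> s _; exact: (continuous_norm _ cf1 s)|exact: closed_ge].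
have [A0|nA] := pselect (A !=set0); last first.
  exists 1; split; first by rewrite ltr01 lexx.
  move=> s st; rewrite subrr mul0r add0r mul1r leNgt; apply/negP => H.
  have sm : Num.max 0 s = s by rewrite max_r //; case/andP: st.
  by apply: nA; exists s; split => //; rewrite sm; exact: ltW.
have [u] := compact_EVT_max A0 cA (continuous_subspaceT (continuous_norm _ cg)).
rewrite inE => -[ut uN] hu.
have [v] := compact_EVT_max A0 cA (continuous_subspaceT (continuous_norm _ cf1)).
rewrite inE => -[vt vN] hv.
have u0 : Num.max 0 u = u by rewrite max_r //; case/andP: ut.
have v0 : Num.max 0 v = v by rewrite max_r //; case/andP: vt.
rewrite ?u0 ?v0 in uN vN hu hv.
have gu : `|g u| < N.
  rewrite lt_neqAle gN // andbT; apply/eqP => /(gl u ut) /fl fu.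
  move: uN; rewrite /f1 normrM (ger0_norm r0) => uN.
  by have := normr_ge0 (f u); nra.
have M0 : 0 < `|f1 v| by exact: lt_le_trans vN.
pose c := N - `|g u|; have c0 : 0 < c by rewrite subr_gt0.
(* With this weight the worst value on [A] is [N - x * N]. *)
pose x := c / (`|f1 v| + c).
have cM : 0 < `|f1 v| + c by exact: addr_gt0.
have x0 : 0 < x by exact: divr_gt0.
have x1 : x <= 1 by rewrite ler_pdivrMr // mul1r lerDr ltW.
have xc : x * (`|f1 v| + c) = c by rewrite divfK // gt_eqF.
clearbody x; exists x; split; first by rewrite x0.
move=> s st; have sm : Num.max 0 s = s by rewrite max_r //; case/andP: st.
apply: (le_trans (ler_normD _ _)); rewrite (normrM (1 - x)) (normrM x) (gtr0_norm x0) (ger0_norm (_ : 0 <= 1 - x)) ?subr_ge0 //.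
have [sN|sN] := leP N `|f1 s|.
  have sA : s \in A by rewrite inE; split => //; rewrite sm.
  have := hu s sA; have := hv s sA; rewrite sm => h1 h2.
  have h3 : x * `|f1 s| <= x * `|f1 v| by rewrite ler_pM2l.
  have h4 : (1 - x) * `|g s| <= (1 - x) * `|g u| by apply: ler_wpM2l => //; rewrite subr_ge0.
  have : x * N >= 0 by rewrite mulr_ge0 // ltW.
  by rewrite /c in xc; lra.
have h3 : x * `|f1 s| <= x * N by rewrite ler_pM2l // ltW.
have h4 : (1 - x) * `|g s| <= (1 - x) * N by apply: ler_wpM2l; [rewrite subr_ge0|exact: gN].
lra.
Qed.

(** Hahn-Banach in finite dimension, eliminating one coordinate at a time. Having both signed unit
    vectors among the [y] keeps the admissible weights of each coordinate bounded. *)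
Lemma cone_separation n (Gam : R -> (nat -> R) -> Prop) :
  (forall c y c' y', Gam c y -> Gam c' y' -> Gam (c + c') (fun j => y j + y' j)) ->
  (forall a c y, 0 < a -> Gam c y -> Gam (a * c) (fun j => a * y j)) ->
  (forall c y, Gam c y -> (forall j, (j < n)%N -> y j = 0) -> c <= 0) ->
  (forall j (sg : R), (j < n)%N -> `|sg| = 1 -> exists c y, [/\ Gam c y, y j = sg & forall i, i != j -> y i = 0]) ->
  exists d : nat -> R, forall c y, Gam c y -> c <= \sum_(j < n) d j * y j.
Proof.
elim: n Gam => [|n IH] Gam hD hZ h0 hU.
  by exists (fun=> 0) => c y h; rewrite big_ord0; exact: h0 h _.
(* Elements over the last unit vector bound its weight from below, those over its negative from
   above; the supremum of [A] meets both demands. *)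
pose A := [set c | exists y, [/\ Gam c y, y n = 1 & forall i, (i < n)%N -> y i = 0]].
have ubA c y : Gam c y -> y n = -1 -> (forall i, (i < n)%N -> y i = 0) -> ubound A (- c).
  move=> hc yn yi a [z [ha zn zi]].
  have : a + c <= 0; last by lra.
  apply: (h0 _ _ (hD _ _ _ _ ha hc)) => j; rewrite ltnS leq_eqVlt => /predU1P[->|jn].
    by rewrite zn yn subrr.
  by rewrite zi // yi // addr0.
have hs : has_sup A.
  split.
    have [c [y [hc yn yi]]] := hU n 1 (ltnSn _) (normr1 _).
    by exists c, y; split => // i lin; apply: yi; rewrite neq_ltn lin.
  have [c [y [hc yn yi]]] := hU n (-1) (ltnSn _) (normrN1 _).
  by exists (- c); apply: ubA hc yn _ => i lin; apply: yi; rewrite neq_ltn lin.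
pose dn := sup A.
(* The contribution of the last coordinate is subtracted. Elements whose first [n] coordinates
   vanish are rescaled to [y n = 1] or [y n = -1], where the choice of [dn] gives [c <= 0]. *)
pose Gam' c y := Gam (c + dn * y n) y.
have [||||d hd] := IH Gam'.
- by move=> c y c' y' h h'; rewrite /Gam' mulrDr addrACA; exact: hD.
- by move=> a c y a0 h; rewrite /Gam' mulrCA -mulrDr; exact: hZ.
- move=> c y h yi; have hk a : 0 < a -> Gam (a * (c + dn * y n)) (fun j => a * y j) by move=> a0; exact: hZ.
  have [yn|yn|yn] := ltgtP (y n) 0.
  + have a0 : 0 < - (y n)^-1 by rewrite oppr_gt0 invr_lt0.
    have ub := ubA _ _ (hk _ a0).
    have : dn <= - (- (y n)^-1 * (c + dn * y n)).
      apply: ge_sup; first by case: hs.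
      apply: ub; first by rewrite mulNr mulVf // lt_eqF.
      by move=> i lin; rewrite (yi i lin) mulr0.
    have -> : - (y n)^-1 * (c + dn * y n) = - (y n)^-1 * c - dn by field; rewrite lt_eqF.
    by rewrite opprB lerBrDr gerDl pmulr_rle0.
  + have a0 : 0 < (y n)^-1 by rewrite invr_gt0.
    have : (y n)^-1 * (c + dn * y n) <= dn.
      apply: ub_le_sup; first by case: hs.
      exists (fun j => (y n)^-1 * y j); split; [exact: hk|by rewrite mulVf // gt_eqF|].
      by move=> i lin; rewrite (yi i lin) mulr0.
    by rewrite mulrDr (mulrC dn) mulrA mulVf ?gt_eqF // mul1r gerDr pmulr_rle0.
  + have {}h : Gam c y by move: h; rewrite /Gam' yn; rewrite ?mulr0 ?addr0.
    apply: h0 h _ => j.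
    by rewrite ltnS leq_eqVlt => /predU1P[->|/yi].
- move=> j sg jn sg1; have [c [y [hc yj yi]]] := hU j sg (leqW jn) sg1.
  exists (c - dn * y n), y; split => //.
  by rewrite /Gam' subrK.
exists (fun j => if j == n then dn else d j) => c y hc.
have := hd (c - dn * y n) y; rewrite /Gam' subrK => /(_ hc).
rewrite big_ord_recr /= eqxx => H.
rewrite (eq_bigr (fun j : 'I_n => d j * y j)); first lra.
by move=> j _; rewrite ifF //; apply/negbTE; rewrite neq_ltn ltn_ord.
Qed.

End OptimalFunctional.

(** * Sampling weights and the linear differentiator *)

Section LinearDifferentiator.
Context {R : realType}.
Implicit Types (f g : R -> R) (a b s : R) (l : seq R).

Lemma optimal_nodes m (L N t : R) k : (0 < k <= m)%N -> 0 <= L -> 0 < N -> 0 < t ->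
  exists l : seq R, [/\ (0 < size l)%N, forall x, x \in l -> 0 <= x <= t &
    forall f, F m L f -> (forall x, x \in l -> `|f x| <= N) -> half_deriven k f t <= gbarR m L N k t].
Proof.
move=> kk L0 N0 t0; have /andP[k0 km] := kk; have m0 : (0 < m)%N by exact: leq_trans km.
have [c [l [hl hG hE]]] := perfect_spline_extremal m L N t k m0 L0 N0 t0 km.
have [_ Es] := spl_F m L c l L0 hl.
have gE : half_deriven k (spl m L c l 0) t = gbarR m L N k t by rewrite (Es _ _ km (ltW t0)).
(* If [L = 0] and all higher coefficients vanished, the [k]-th derivative of the extremal spline
   would be 0, against [gbarR_gt0]. *)
have [|z hz] := contact_finite m L N t c l.
  move: L0; rewrite le_eqVlt => /orP[/eqP L0|]; [right|by left].
  split => //; apply: contrapT => H.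
  have := gbarR_gt0 m L N t k (ltac:(by rewrite -L0)) N0 t0 kk.
  rewrite -hE /spl -L0 mul0r addr0 /taylor big1 ?ltxx // => j _.
  have -> : c (k + j)%N = 0; last by rewrite mul0r.
  apply: contrapT => /eqP cj; apply: H; exists (k + j)%N => //.
  rewrite (leq_trans k0) ?leq_addr //=; have := ltn_ord j.
  by rewrite ltn_subRL ltnS.
(* Adding [t] guarantees at least one sample. *)
pose l' := t :: [seq x <- z | 0 <= x <= t].
have hl' x : x \in l' -> 0 <= x <= t.
  rewrite inE mem_filter => /predU1P[->|/andP[] //]; by rewrite lexx ltW.
exists l'; split => // f Ff fN.
apply: (contact_sufficient m L N t k (spl m L c l 0) l') => //.
by move=> s st sN; rewrite inE mem_filter st (hz s st sN) orbT.
Qed.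

Lemma optimal_functional m (L N t : R) k : (0 < k <= m)%N -> 0 <= L -> 0 < N -> 0 < t ->
  exists (n : nat) (d x : nat -> R), [/\ (0 < n)%N, forall j, (j < n)%N -> 0 <= x j <= t &
    forall f y, F m L f -> (forall j, (j < n)%N -> `|y j - f (x j)| <= N) ->
      half_deriven k f t - \sum_(j < n) d j * y j <= gbarR m L N k t].
Proof.
move=> kk L0 N0 t0; have /andP[k0 km] := kk; have [l [sl hl hf]] := optimal_nodes m L N t k kk L0 N0 t0.
pose x j := nth 0 l j; pose n := size l.
(* Here [y] is a vector of samples explained by [f] up to noise, and [c] is the excess of the
   derivative of [f] over the optimal error. The factor [lam] scales [L] and [N] together and turns
   a convex set into a cone; for [y = 0] the excess is nonpositive by [optimal_nodes]. *)
pose Gam (c : R) (y : nat -> R) := exists lam f, [/\ 0 < lam, F m (lam * L) f,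
  forall j, (j < n)%N -> `|y j - f (x j)| <= lam * N & c = half_deriven k f t - lam * gbarR m L N k t].
have [||||d hd] := cone_separation n Gam.
- move=> c y c' y' [l1 [f1 [l10 F1 h1 ->]]] [l2 [f2 [l20 F2 h2 ->]]].
  have [Fm Em] := F_lin m _ _ 1 1 f1 f2 (mulr_ge0 (ltW l10) L0) (mulr_ge0 (ltW l20) L0) F1 F2.
  exists (l1 + l2), (fun s => 1 * f1 s + 1 * f2 s); split.
  + exact: addr_gt0.
  + by move: Fm; rewrite normr1 !mul1r -mulrDl.
  + move=> j jn; have := h1 j jn; have := h2 j jn; rewrite !mul1r => H2 H1.
    have -> : y j + y' j - (f1 (x j) + f2 (x j)) = (y j - f1 (x j)) + (y' j - f2 (x j)) by ring.
    by apply: (le_trans (ler_normD _ _)); rewrite mulrDl; exact: lerD.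
  + by rewrite (Em _ _ km (ltW t0)); ring.
- move=> a c y a0 [l1 [f1 [l10 F1 h1 ->]]].
  have [Fm Em] := F_scale m _ a f1 (mulr_ge0 (ltW l10) L0) F1.
  exists (a * l1), (fun s => a * f1 s); split.
  + exact: mulr_gt0.
  + by move: Fm; rewrite gtr0_norm // mulrA.
  + by move=> j jn; rewrite -mulrBr normrM gtr0_norm // -mulrA ler_pM2l //; exact: h1.
  + by rewrite (Em _ _ km (ltW t0)); ring.
- move=> c y [l1 [f1 [l10 F1 h1 ->]]] yz.
  have [Fm Em] := F_scale m _ l1^-1 f1 (mulr_ge0 (ltW l10) L0) F1.
  rewrite subr_le0 -ler_pdivrMl // -(Em _ _ km (ltW t0)).
  apply: hf.
    by move: Fm; rewrite gtr0_norm ?invr_gt0 // mulKf // gt_eqF.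
  move=> z zl; have zn : (index z l < n)%N by rewrite index_mem.
  have := h1 _ zn; rewrite yz // sub0r normrN /x nth_index // => H.
  by rewrite normrM gtr0_norm ?invr_gt0 // ler_pdivrMl.
- move=> j sg jn sg1; have [Fz Ez] := F_zero m (N^-1 * L) (ltac:(by rewrite mulr_ge0 // invr_ge0 ltW)).
  exists (0 - N^-1 * gbarR m L N k t), (fun i => if i == j then sg else 0); split.
  + exists N^-1, (fun=> 0); split => //; first by rewrite invr_gt0.
      move=> i _; rewrite /= subr0 mulVf ?(gt_eqF N0) //.
by case: ifP => _; rewrite ?sg1 // normr0.
    by rewrite (Ez _ _ km (ltW t0)).
  + by rewrite eqxx.
  + by move=> i /negbTE ->.
exists n, d, x; split => //.
  by move=> j jn; apply: hl; exact: mem_nth.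
move=> f y Ff hy; have : Gam (half_deriven k f t - gbarR m L N k t) y.
  exists 1, f; split => //; first by rewrite mul1r.
    by move=> j jn; rewrite mul1r; exact: hy.
  by rewrite mul1r.
by move=> /hd; lra.
Qed.

(** The zero signal, with noise of size [N] signed against the weights, bounds their absolute sum.
    Linearity and rescaling carry the error bound to every [al]. *)
Lemma optimal_functional_bound m (L N t : R) k n (d x : nat -> R) : (k <= m)%N ->
  0 <= L -> 0 < N -> 0 < t ->
  (forall f y, F m L f -> (forall j, (j < n)%N -> `|y j - f (x j)| <= N) ->
      half_deriven k f t - \sum_(j < n) d j * y j <= gbarR m L N k t) ->
  N * \sum_(j < n) `|d j| <= gbarR m L N k t /\
  forall al h y, 0 <= al -> F m (al * L) h ->
    (forall j, (j < n)%N -> `|y j - h (x j)| <= al * N) ->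
    `|half_deriven k h t - \sum_(j < n) d j * y j| <= gbarR m (al * L) (al * N) k t.
Proof.
move=> km L0 N0 t0 H; have N0' := ltW N0; have t0' := ltW t0; split.
  have [Fz Ez] := F_zero m L L0.
  have := H (fun=> 0) (fun j => - (N * Num.sg (d j))) Fz.
  rewrite (Ez _ _ km t0') sub0r => h; apply: le_trans (h _).
    rewrite mulr_sumr -sumrN; apply: ler_sum => j _.
    by rewrite mulrN opprK mulrCA [`|d j|]normrEsg (mulrC (d j)).
  move=> j _; rewrite subr0 normrN normrM gtr0_norm // ler_piMr //.
  by rewrite normr_sg; case: (d j != 0).
have two h y : F m L h -> (forall j, (j < n)%N -> `|y j - h (x j)| <= N) ->
    `|half_deriven k h t - \sum_(j < n) d j * y j| <= gbarR m L N k t.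
  move=> Fh hy; rewrite ler_norml lerNl; apply/andP; split; last exact: H.
  have [Fm Em] := F_scale m L (-1) h L0 Fh.
  have := H (fun s => -1 * h s) (fun j => -1 * y j).
  rewrite (Em _ _ km t0').
  have -> : \sum_(j < n) d j * (-1 * y j) = - \sum_(j < n) d j * y j.
    by rewrite -sumrN; apply: eq_bigr => j _; rewrite mulN1r mulrN.
  rewrite mulN1r opprK opprB addrC; apply.
    by move: Fm; rewrite normrN1 mul1r.
  by move=> j jn; rewrite -mulrBr mulN1r normrN; exact: hy.
have scaled a h y : 0 < a -> F m (a * L) h -> (forall j, (j < n)%N -> `|y j - h (x j)| <= a * N) ->
    `|half_deriven k h t - \sum_(j < n) d j * y j| <= a * gbarR m L N k t.
  move=> a0 Fh hy.
  have [Fm Em] := F_scale m _ a^-1 h (mulr_ge0 (ltW a0) L0) Fh.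
  have := two (fun s => a^-1 * h s) (fun j => a^-1 * y j).
  rewrite (Em _ _ km t0').
  have -> : \sum_(j < n) d j * (a^-1 * y j) = a^-1 * \sum_(j < n) d j * y j.
    by rewrite mulr_sumr; apply: eq_bigr => j _; rewrite mulrCA.
  rewrite -mulrBr normrM gtr0_norm ?invr_gt0 // ler_pdivrMl //; apply.
    by move: Fm; rewrite gtr0_norm ?invr_gt0 // mulKf // gt_eqF.
  by move=> j jn; rewrite -mulrBr normrM gtr0_norm ?invr_gt0 // ler_pdivrMl //; exact: hy.
move=> al h y; rewrite le_eqVlt => /orP[/eqP <-|a0] Fh hy; last first.
  by apply: le_trans (gbarR_scale m L N k t al km L0 N0' t0 a0); exact: scaled.
rewrite !mul0r in Fh hy *.
have [_ g0] := gbarE m L N k t km L0 N0' t0.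
have [_ g00] := gbarE m 0 0 k t km (lexx _) (lexx _) t0.
apply: le_trans g00; apply/ler_addgt0Pr => e e0; rewrite add0r.
(* For [al = 0] the data satisfy the constraints for every positive [a], so the error is at most
   [a * gbar] and hence 0. *)
pose a := e / (gbarR m L N k t + 1).
have a0 : 0 < a by apply: divr_gt0 => //; lra.
apply: (@le_trans _ _ (a * gbarR m L N k t)).
  apply: scaled => //; first by apply: F_le Fh; rewrite mulr_ge0 // ltW.
  by move=> j /hy H'; apply: (le_trans H'); rewrite mulr_ge0 // ltW.
have : a * (gbarR m L N k t + 1) = e by rewrite divfK // gt_eqF //; lra.
lra.
Qed.

(** For robustness, noise of size [e] changes the output at time [s] by at most [e] times the sum of
    absolute weights, thus by at most [e * gbar / N] taken at the earlier time [t]. *)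
Lemma linear_differentiator_exists (m : nat) (L N : R) : 0 <= L -> 0 < N ->
  exists (P : R -> 'I_m -> nat) (d tau : R -> 'I_m -> nat -> R),
    (forall (t : R) (i : 'I_m), 0 < t ->
       (0 < P t i)%N /\ forall j, (j < P t i)%N -> 0 <= tau t i j <= t) /\
    [/\ causal (linear_differentiator P d tau),
        forall alpha : R, 0 <= alpha ->
          best_worst_case_error (linear_differentiator P d tau) (alpha * L) (alpha * N)
      & strongly_robust (linear_differentiator P d tau)].
Proof.
move=> L0 N0; have N0' := ltW N0.
have /choice[c hc] : forall p : R * 'I_m, exists q : nat * (nat -> R) * (nat -> R), 0 < p.1 ->
   [/\ (0 < q.1.1)%N, forall j, (j < q.1.1)%N -> 0 <= q.2 j <= p.1 &
    forall f y, F m L f -> (forall j, (j < q.1.1)%N -> `|y j - f (q.2 j)| <= N) ->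
      half_deriven p.2.+1 f p.1 - \sum_(j < q.1.1) q.1.2 j * y j <= gbarR m L N p.2.+1 p.1].
  move=> [t i]; have [t0|t0] := ltP 0 t; last by exists (0%N, (fun=> 0), (fun=> 0)).
  have [n [d [x H]]] := optimal_functional m L N t i.+1 (ltn_ord i) L0 N0 t0.
  by exists (n, d, x).
pose P t i := (c (t, i)).1.1; pose d t i := (c (t, i)).1.2.
(* The functional samples at absolute times, whereas the differentiator is written with delays. *)
pose tau t i j := t - (c (t, i)).2 j.
have hc' t i : 0 < t -> _ := hc (t, i).
exists P, d, tau; split.
  move=> t i t0; have [n0 hx _] := hc' t i t0; split => // j jn.
  by have /andP[/= ? ?] := hx j jn; rewrite /tau; apply/andP; split; lra.
have DE u t i : 0 < t -> linear_differentiator P d tau u t ord0 i =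
    \sum_(j < P t i) d t i j * u ((c (t, i)).2 j).
  by move=> t0; rewrite mxE t0; apply: eq_bigr => j _; rewrite /tau subKr.
split.
- move=> u1 u2 t _ _ t0 e; apply/rowP => i; rewrite !mxE; case: ltP => // t0'.
  apply: eq_bigr => j _; rewrite /tau subKr; congr (_ * _); apply: e.
  by have [_ hx _] := hc' t i t0'; exact: hx.
- move=> al a0; apply: best_of_mem_J; [exact: mulr_ge0|exact: mulr_ge0|].
  move=> u t i _ t0; apply/mem_JP => //; [exact: mulr_ge0|exact: mulr_ge0|].
  move=> h /consistentP[Fh hN]; rewrite DE //.
  have [_ hx hH] := hc' t i t0.
  have [_ H] := optimal_functional_bound m L N t i.+1 _ _ _ (ltn_ord i) L0 N0 t0 hH.
  apply: (H al h (fun j => u ((c (t, i)).2 j))) => // j jn.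
  by rewrite distrC; apply: hN; exact: hx.
move=> t i t0; have [_ g0] := gbarE m L N i.+1 t (ltn_ord i) L0 N0' t0.
apply: (@robustness_zero _ _ _ _ _ _ (gbarR m L N i.+1 t / N) 1) => //.
- exists ((fun=> 0) \+ (fun=> 0)); apply: (@F_E_inputs _ m 0 0) => //.
    by case: (F_zero m (0 : R) (lexx _)).
  by move=> s _; rewrite normr0.
- by rewrite divr_ge0.
move=> e u eta s e0 _ _ Ee ts; have s0 : 0 < s by exact: lt_le_trans ts.
rewrite !DE //; have [_ hx hH] := hc' s i s0.
have [H _] := optimal_functional_bound m L N s i.+1 _ _ _ (ltn_ord i) L0 N0 s0 hH.
rewrite -sumrB; apply: (@le_trans _ _ ((\sum_(j < P s i) `|d s i j|) * e)).
  rewrite mulr_suml; apply: (le_trans (ler_norm_sum _ _ _)); apply: ler_sum => j _.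
  rewrite /= -mulrBr opprD addrA subrr sub0r normrM normrN; apply: ler_wpM2l => //.
  by apply: Ee; have /andP[] := hx j (ltn_ord j).
apply: ler_wpM2r; first exact: ltW.
have H2 : N * (\sum_(j < P s i) `|d s i j|) <= gbarR m L N i.+1 t.
  exact: le_trans H (gbarR_anti m L N i.+1 t s (ltn_ord i) L0 N0' t0 ts).
rewrite (ler_pdivlMr _ _ N0) mulrC; exact: H2.
Qed.

End LinearDifferentiator.
(* In the last part, N = 0 < L has to be excluded: there gbar m 0 L k t = 0,
   and no linear combination of finitely many samples differentiates every
   element of F m L exactly. *)
Theorem theorem5p11 (R : realType) (m : nat) (L N : R)
    (hm : (0 < m)%N) (hL : 0 <= L) (hN : 0 <= N) :
  [/\ forall (u : R -> R) (theta : R) (i : 'I_m), inputs u -> 0 < theta ->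
        J m L N i.+1 u theta !=set0,
      forall D : differentiator R m, causal D ->
        (best_worst_case_error D L N <->
         forall (u : R -> R) (t : R) (i : 'I_m), inputs u -> 0 < t ->
           J m L N i.+1 u t (D u t ord0 i)),
      [/\ causal (midpoint_differentiator m L N),
          best_worst_case_error (midpoint_differentiator m L N) L N
        & forall delta : R, 0 < delta <= N ->
            robust_almost_from_beginning (midpoint_differentiator m L N)
              (FE m L (N - delta))]
    & (0 < N \/ L = 0) ->
      exists (P : R -> 'I_m -> nat) (d tau : R -> 'I_m -> nat -> R),
        (forall (t : R) (i : 'I_m), 0 < t ->
           (0 < P t i)%N /\
           forall j, (j < P t i)%N -> 0 <= tau t i j <= t) /\
        [/\ causal (linear_differentiator P d tau),
            forall alpha : R, 0 <= alpha ->
              best_worst_case_error (linear_differentiator P d tau)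
                (alpha * L) (alpha * N)
          & strongly_robust (linear_differentiator P d tau)]].
Proof.
split.
- by move=> u theta i _ t0; exact: J_nonempty.
- move=> D cD; split.
    by move=> bD u t i iu t0; exact: mem_J_of_best.
  exact: best_of_mem_J.
- split; [exact: midpoint_causal|exact: midpoint_best|].
  by move=> delta hd; exact: midpoint_robust.
case=> [N0|L0]; first exact: linear_differentiator_exists.
(* For [L = N = 0] the weights built for noise level 1 serve: every rescaled class has both
   constants 0, which is the instance [alpha = 0] of [h3]. *)
have [P [d [tau [h1 [h2 h3 h4]]]]] := linear_differentiator_exists m L 1 hL ltr01.
move: hN; rewrite le_eqVlt => /orP[/eqP N0|N0]; last exact: linear_differentiator_exists.
exists P, d, tau; split=> //; split=> // alpha a0.
by have := h3 0 (lexx _); rewrite L0 -N0 !mul0r !mulr0.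
Qed.
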